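(* Let $f:\mathbb{T}\to[0,1]$ be measurable, not a.e. equal to $0$ and not a.e. equal to $1$. Then the probability measure $\mathbb{P}^f$ is strong $K$ if and only if $\mathrm{GM}(f)\,\mathrm{GM}(\mathbf 1-f)>0$.
   Context: $\mathbb{T}:=\mathbb{R}/\mathbb{Z}$ with unit Lebesgue measure $\lambda_1$; $\widehat f(k):=\int_{\mathbb{T}} f(x)e^{-2\pi i kx}\,d\lambda_1(x)$. For measurable $f:\mathbb{T}\to[0,1]$, $\mathbb{P}^f$ is the unique Borel probability measure on $\{0,1\}^{\mathbb{Z}}$ such that for all $k\ge1$ and all distinct $e_1,\dots,e_k\in\mathbb{Z}$, $\mathbb{P}^f[\eta(e_1)=1,\dots,\eta(e_k)=1]=\det[\widehat f(e_j-e_i)]_{1\le i,j\le k}$ (it exists and is translation invariant). $\mathrm{GM}(f):=\exp\int_{\mathbb{T}}\log f\,d\lambda_1$ (with $\log 0=-\infty$, $\exp(-\infty)=0$); $\mathbf 1$ is the constant function 1. For $S\subseteq\mathbb{Z}$, $\mathcal{F}(S)$ is the $\sigma$-field on $\{0,1\}^{\mathbb{Z}}$ generated by $\eta(e)$, $e\in S$. A translation-invariant probability measure $\mu$ on $\{0,1\}^{\mathbb{Z}}$ is strong $K$ if for any finite cylinder event $E$ and for all $\epsilon>0$ there exists an $N$ such that $\big|\mu\big(E\mid\mathcal{F}((-\infty,-N]\cap\mathbb{Z})\big)-\mu(E)\big|<\epsilon$ $\mu$-a.e. *)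

(* Defs.v *)
From HB Require Import structures.
From mathcomp Require Import all_boot all_order all_algebra.
From mathcomp Require Import complex.
From mathcomp Require Import all_classical all_reals all_analysis.

Set Implicit Arguments.
Unset Strict Implicit.
Unset Printing Implicit Defensive.

Import Order.TTheory GRing.Theory Num.Theory.
Import numFieldNormedType.Exports.

Local Open Scope classical_set_scope.
Local Open Scope ring_scope.

(* Functions on the circle R/Z are represented by functions f : R -> R of
   period 1 (hypothesis [periodic f 1]); unit Lebesgue measure on the circle is
   Lebesgue measure on the fundamental domain [0, 1[. *)
Definition circle (R : realType) : set R := `[0, 1[.
Arguments circle : clear implicits.

Definition expi (R : realType) (t : R) : R[i] := Complex (cos t) (sin t).

(* The complex integral is taken componentwise. *)
Definition fourier (R : realType) (f : R -> R) (k : int) : R[i] :=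
  let h x := Complex (f x) 0 * expi (- (2 * pi * k%:~R * x)) in
  Complex (\int[lebesgue_measure]_(x in circle R) complex.Re (h x))
          (\int[lebesgue_measure]_(x in circle R) complex.Im (h x)).

(* [lne] and [expeR] satisfy lne 0 = -oo and expeR -oo = 0. *)
Definition GM (R : realType) (g : R -> R) : \bar R :=
  expeR (\int[lebesgue_measure]_(x in circle R) lne (g x)%:E)%E.

(* Preimages of subsets of bool under the coordinates eta e, e in S; the value
   true of a coordinate stands for 1. *)
Definition coord_system (S : set int) : set (set (int -> bool)) :=
  \bigcup_(e in S)
    preimage_set_system setT (fun eta : int -> bool => eta e) measurable.

(* {0,1}^Z; the product sigma-algebra is the Borel one. *)
Notation config := (g_sigma_algebraType (coord_system [set: int])).

Definition sigma_field (S : set int) : set (set config) :=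
  <<s coord_system S >>.

Definition determinantal (R : realType) (f : R -> R)
    (P : probability config R) : Prop :=
  forall (k : nat) (e : 'I_k -> int), (1 <= k)%N -> injective e ->
    Complex (fine (P [set eta : config | forall i, eta (e i) = true])) 0
    = \det (\matrix_(i < k, j < k) fourier f (e j - e i)).

Definition shift_config (n : int) (eta : config) : config :=
  fun e => eta (e + n).

Definition translation_invariant (R : realType)
    (mu : probability config R) : Prop :=
  forall (n : int) (A : set config), measurable A ->
    mu (shift_config n @^-1` A) = mu A.

(* g is a version of the conditional probability mu(E | G), for a
   sub-sigma-algebra G of the measurable sets. *)
Definition is_cond_prob d (T : measurableType d) (R : realType)
    (mu : probability T R) (G : set (set T)) (E : set T) (g : T -> R) : Prop :=
  [/\ forall B : set R, measurable B -> G (g @^-1` B),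
      mu.-integrable setT (EFin \o g) &
      forall A : set T, G A ->
        (\int[mu]_(x in A) (g x)%:E = mu (E `&` A))%E].

(* A finite cylinder event is an element of sigma_field S with S finite.
   Versions of mu(E | G) exist and agree mu-a.e., so that it does not matter
   which version g is used. *)
Definition strong_K (R : realType) (mu : probability config R) : Prop :=
  translation_invariant mu /\
  forall (S : set int) (E : set config), finite_set S -> sigma_field S E ->
  forall eps : R, 0 < eps ->
  exists N : nat, exists2 g : config -> R,
    is_cond_prob mu (sigma_field [set e : int | e <= - N%:Z]) E g &
    {ae mu, forall eta, `|g eta - fine (mu E)| < eps}.

(* Main.v *)
Require Import Defs.
From HB Require Import structures.
From mathcomp Require Import all_boot all_order all_algebra.
From mathcomp Require Import perm complex.
From mathcomp Require Import all_classical all_reals all_analysis.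
From mathcomp Require Import measurable_realfun.
From mathcomp Require Import ring lra zify.

Set Implicit Arguments.
Unset Strict Implicit.
Unset Printing Implicit Defensive.

Import Order.TTheory GRing.Theory Num.Theory.
Import numFieldNormedType.Exports.

Local Open Scope classical_set_scope.
Local Open Scope ring_scope.

(** The numbers [K i j = f^(j - i)] are the inner products in L^2(f) of the
    characters e^(2 pi i k x). Conditioning the process on a cylinder event
    replaces [K] by an iterated Schur complement [condk K L]. Its quadratic form
    at a function [x] on the free sites is at least the squared distance in
    L^2(f) from [x] to the characters of the conditioned sites, with equality
    when all conditioned values are 1; for [1 - condk K L] the same holds in
    L^2(1 - f), with equality when all conditioned values are 0.

    By Szego's theorem, GM(f) is the infimum of the integrals of |p|^2 f over
    polynomials with p(0) = 1. If GM(f) = 0, the character 1 is approximated in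
    L^2(f) by characters of the arbitrarily remote past; conditionally on that
    part of the past being full, the site 0 is occupied with small probability,
    and the process is not strong K. If GM(1 - f) = 0, exchange 0 and 1. If both are
    positive, the prediction errors decrease to a positive limit, and this forces
    the normalised correlation between a fixed character and the remote past to
    vanish, in L^2(f) and in L^2(1 - f). Hence [condk K L] is close to [K] near
    any finite set, uniformly over the cylinders [L] of the remote past, and such
    a uniform bound passes from cylinders to the whole past sigma-field. *)

(** * Kernels conditioned on a cylinder *)

(** A cylinder of the past may mix ones and zeros, and then no single projection describes the
    conditioned kernel. What remains is monotonicity: an occupied site lowers the quadratic form of
    the kernel, an empty site raises it. So, whatever the values in [L], the form of [condk K L] at
    [x] lies between a squared distance in L^2(f) and the squared l^2 norm of [x] minus a squared
    distance in L^2(1 - f), and these bounds involve only the conditioned sites. This is why both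
    geometric means enter.

    The same bounds keep the diagonal of [condk K L] strictly between 0 and 1: a nonzero
    trigonometric polynomial has finitely many zeros, and f is a.e. neither 0 nor 1. Hence no
    denominator vanishes, and cylinders on distinct sites have positive probability.

    Errors are kept relative to the past event, in the form |P(A and F) - P(A) P(F)| <= e P(A). This
    form is additive over disjoint A and stable under approximation in probability, which is what
    allows the passage from cylinders to a sigma-field. *)

Section ConditionalKernel.
Variables (C : numClosedFieldType) (T : eqType).
Implicit Types (K : T -> T -> C) (s : seq T) (x : T -> C) (L : seq (T * bool)).

Definition qform s K x : C :=
  \sum_(i <- s) \sum_(j <- s) x i * (x j)^* * K i j.

(** For the Fourier kernel, [qform s K x] is the squared norm in L^2(f) of the trigonometric sum
    with coefficients [x], and [cross s K x b] is the inner product of that sum with the character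
    of the site [b]. *)
Definition cross s K x (b : T) : C := \sum_(i <- s) x i * K i b.

Definition hermitian_kernel K := forall i j, K j i = (K i j)^*.

Definition posdef K := forall s x,
  uniq s -> has (fun i => x i != 0) s -> 0 < qform s K x.

Definition cmplk K i j : C := (i == j)%:R - K i j.

(* Kernel of the determinantal process conditioned on the value [v] at the site
   [b]: the Schur complement of [K] ([v = true]), or the complement of the Schur
   complement of the complementary kernel ([v = false]). *)
Definition cstep v b K i j : C := K i j - K i b * K b j / (K b b - (~~ v)%:R).

Fixpoint condk K L : T -> T -> C :=
  if L is (b, v) :: L' then cstep v b (condk K L') else K.

Definition flip (g : bool) L := [seq (bv.1, bv.2 (+) g) | bv <- L].

Lemma eq_qform s K x y : {in s, x =1 y} -> qform s K x = qform s K y.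
Proof.
move=> xy; rewrite /qform !big_seq; apply: eq_bigr => i si.
by rewrite !big_seq; apply: eq_bigr => j sj; rewrite !xy.
Qed.

Lemma eq_qform_kernel s K K' x : {in s &, K =2 K'} -> qform s K x = qform s K' x.
Proof.
move=> KK'; rewrite /qform !big_seq; apply: eq_bigr => i si.
by rewrite !big_seq; apply: eq_bigr => j sj; rewrite KK'.
Qed.

Lemma perm_qform s t K x : perm_eq s t -> qform s K x = qform t K x.
Proof.
move=> st; rewrite /qform (perm_big _ st) /=; apply: eq_bigr => i _.
exact: perm_big.
Qed.

Lemma qform_cons b s K x : hermitian_kernel K ->
  qform (b :: s) K x =
  x b * (x b)^* * K b b + x b * (cross s K x b)^* + (x b)^* * cross s K x b
  + qform s K x.
Proof.
move=> hK; rewrite /qform big_cons big_cons -!addrA; congr (_ + _).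
under [X in _ + X = _]eq_bigr do rewrite big_cons.
rewrite big_split /= !addrA; congr (_ + _ + _).
- rewrite /cross rmorph_sum mulr_sumr; apply: eq_bigr => j _.
  by rewrite rmorphM /= -hK mulrA.
- by rewrite /cross mulr_sumr; apply: eq_bigr => j _; ring.
Qed.

Lemma hermitian_real K b : hermitian_kernel K -> K b b \is Num.real.
Proof. by move=> hK; rewrite CrealE -hK. Qed.

Lemma hermitian_cmplk K : hermitian_kernel K -> hermitian_kernel (cmplk K).
Proof.
by move=> hK i j; rewrite /cmplk rmorphB /= rmorph_nat eq_sym -hK.
Qed.

Lemma cmplk_diag K b : cmplk K b b = 1 - K b b.
Proof. by rewrite /cmplk eqxx. Qed.

Lemma cmplkK K i j : cmplk (cmplk K) i j = K i j.
Proof. by rewrite /cmplk subKr. Qed.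

Lemma hermitian_cstep v b K : hermitian_kernel K -> hermitian_kernel (cstep v b K).
Proof.
move=> hK i j; rewrite /cstep rmorphB /= -hK; congr (_ - _).
rewrite !rmorphM /= -!hK [K b i * _]mulrC; congr (_ * _).
apply/esym/CrealP; rewrite realV rpredB ?hermitian_real //.
by case: v; rewrite ?real0 ?real1.
Qed.

Lemma hermitian_condk K L : hermitian_kernel K -> hermitian_kernel (condk K L).
Proof. by move=> hK; elim: L => [//|[b v] L IH] /=; apply: hermitian_cstep. Qed.

(** The correction has rank one. With [K b b] strictly between 0 and 1 its denominator is positive
    for an occupied site and negative for an empty one, so the form decreases in the first case and
    increases in the second. *)
Lemma qform_cstep s v b K x : hermitian_kernel K ->
  qform s (cstep v b K) x =
  qform s K x - `|cross s K x b| ^+ 2 / (K b b - (~~ v)%:R).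
Proof.
move=> hK; rewrite /qform /cstep normCK.
under eq_bigr do under eq_bigr do rewrite mulrBr.
under eq_bigr do rewrite sumrB.
rewrite sumrB; congr (_ - _).
rewrite /cross rmorph_sum !mulr_suml; apply: eq_bigr => i _.
rewrite mulr_sumr mulr_suml; apply: eq_bigr => j _.
by rewrite rmorphM /= -hK; ring.
Qed.

Definition upd x (b : T) (a : C) : T -> C := fun i => if i == b then a else x i.

Lemma upd_notin s x b a : b \notin s -> {in s, upd x b a =1 x}.
Proof. by move=> bs i si; rewrite /upd; case: eqP bs => // <-; rewrite si. Qed.

Lemma cross_upd s K x b a : b \notin s -> cross s K (upd x b a) b = cross s K x b.
Proof.
move=> bs; rewrite /cross !big_seq; apply: eq_bigr => i si.
by rewrite (upd_notin _ _ bs).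
Qed.

(* Completing the square in the coordinate [b]. *)
Lemma qform_cons_square b s K x : hermitian_kernel K -> K b b != 0 ->
  qform (b :: s) K x =
  K b b * `|x b + cross s K x b / K b b| ^+ 2 + qform s (cstep true b K) x.
Proof.
move=> hK k0; rewrite qform_cons // qform_cstep //= subr0.
set q := qform _ _ _; move: k0; set k := K b b => k0; set y := cross _ _ _ _.
have kr : k^* = k by apply/CrealP/hermitian_real.
by rewrite !normCK rmorphD rmorphM rmorphV ?unitfE //= kr; field.
Qed.

Lemma map_flip1 g L : map fst (flip g L) = map fst L.
Proof. by rewrite /flip -map_comp. Qed.

(** Exchange of 0 and 1. Off the conditioned sites the entries [K i b] and [K b j] only change sign
    under [cmplk], so their product is unchanged, while the denominator changes sign; this is why
    [i] and [j] must avoid [L]. *)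
Lemma condk_cmplk g K L i j : uniq (map fst L) ->
  i \notin map fst L -> j \notin map fst L ->
  condk (cmplk K) (flip (~~ g) L) i j = cmplk (condk K (flip g L)) i j.
Proof.
elim: L i j => [//|[b v] L IH] i j /= /andP[bL uL]; rewrite !inE !negb_or.
case/andP=> ib iL /andP[jb jL].
rewrite /cstep !IH // /cmplk eqxx (negPf ib) (eq_sym b) (negPf jb) !sub0r.
set k := condk _ _ b b.
have -> : 1 - k - (~~ (v (+) ~~ g))%:R = - (k - (~~ (v (+) g))%:R).
  by case: (v); case: (g); rewrite /=; ring.
by rewrite invrN; ring.
Qed.

Lemma posdef_cmplkK K : posdef K -> posdef (cmplk (cmplk K)).
Proof.
move=> pK s x us hs; rewrite (@eq_qform_kernel s _ K); first exact: pK.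
by move=> i j _ _; rewrite cmplkK.
Qed.

Lemma qform_upd0 b s K x : hermitian_kernel K -> b \notin s ->
  qform (b :: s) K (upd x b 0) = qform s K x.
Proof.
move=> hK bs; rewrite qform_cons //.
have -> : upd x b 0 b = 0 by rewrite /upd eqxx.
by rewrite conjC0 !mul0r !add0r; apply: eq_qform; apply: upd_notin.
Qed.

Lemma qform1 b K x : qform [:: b] K x = x b * (x b)^* * K b b.
Proof. by rewrite /qform !big_seq1. Qed.

(* Complementing the kernel flips the conditioned values, so the induction has to
   treat both values of [g] at once. *)
Lemma condk_lower_flip g K L s x :
  hermitian_kernel K -> posdef K -> posdef (cmplk K) -> uniq (s ++ map fst L) ->
  exists2 c, {in s, c =1 x} &
    qform (s ++ map fst L) K c <= qform s (condk K (flip g L)) x.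
Proof.
elim: L g K s x => [|[b v] L IH] g K s x hK pK pK' /=.
  by rewrite cats0 => us; exists x.
rewrite cat_uniq /= negb_or => /and3P[us /andP[bs hs] /andP[bL uL]].
have usL : uniq (s ++ map fst L) by rewrite cat_uniq us hs.
have ubL : uniq ([:: b] ++ map fst L) by rewrite /= bL.
have perm_b : perm_eq (s ++ b :: map fst L) (b :: (s ++ map fst L)).
  by rewrite -(cat1s b) perm_catCA.
set K' := condk K (flip g L).
have hK' : hermitian_kernel K' by apply: hermitian_condk.
case: (boolP (v (+) g)) => [vg|nvg].
(* The induction hypothesis at the single site [b] bounds the diagonal entry below by a form at a
   nonzero vector. *)
- have k0 : 0 < K' b b.
    have [c c1] := IH g K [:: b] (fun=> 1) hK pK pK' ubL.
    rewrite qform1 conjC1 !mul1r; apply: lt_le_trans.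
    by apply: pK => //=; rewrite c1 ?mem_head // oner_neq0.
  (* This value at [b] annihilates the completed square, so the form of [K'] on [b :: s] equals that
     of the Schur complement on [s]. *)
  pose x' := upd x b (- (cross s K' x b / K' b b)).
  have [|c cx cle] := IH g K (b :: s) x' hK pK pK'.
    by rewrite /= mem_cat negb_or bs bL.
  exists c => [i si|].
    by rewrite cx ?inE ?si ?orbT // /x' (upd_notin _ _ bs).
  rewrite (perm_qform _ _ perm_b); apply: le_trans cle _.
  rewrite qform_cons_square ?gt_eqF // /x' cross_upd // /upd eqxx addNr normr0.
  rewrite expr0n mulr0 add0r -/(upd _ _ _).
  by rewrite (@eq_qform s _ _ x) //; apply: upd_notin.
(* The upper bound is the lower bound for the complementary kernel, which is where the other value
   of [g] is used. *)
- have k1 : K' b b < 1.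
    have [c c1] := IH (~~ g) (cmplk K) [:: b] (fun=> 1) (hermitian_cmplk hK) pK'
      (posdef_cmplkK pK) ubL.
    rewrite qform1 conjC1 !mul1r condk_cmplk // cmplk_diag -/K' => cle.
    rewrite -subr_gt0; apply: lt_le_trans cle.
    by apply: pK' => //=; rewrite c1 ?mem_head // oner_neq0.
  have [c cx cle] := IH g K s x hK pK pK' usL.
  (* An empty site only raises the form, so the bound without [b] persists; the coefficient 0 adds
     [b] to the list at no cost. *)
  exists (upd c b 0) => [i si|]; first by rewrite (upd_notin _ _ bs) ?cx.
  rewrite (perm_qform _ _ perm_b) qform_upd0 //; last by rewrite mem_cat negb_or bs.
  apply: le_trans cle _; rewrite qform_cstep // -/K' lerDl oppr_ge0.
  by rewrite mulr_ge0_le0 ?exprn_ge0 // invr_le0 subr_le0 ltW.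
Qed.

Lemma flip0 L : flip false L = L.
Proof. by rewrite /flip -[RHS]map_id; apply: eq_map => -[b v] /=; rewrite addbF. Qed.

Lemma condk_lower K L s x :
  hermitian_kernel K -> posdef K -> posdef (cmplk K) -> uniq (s ++ map fst L) ->
  exists2 c, {in s, c =1 x} &
    qform (s ++ map fst L) K c <= qform s (condk K L) x.
Proof. by move=> hK pK pK' us; rewrite -[in condk _ _](flip0 L); apply: condk_lower_flip. Qed.

Lemma condk_lower_cmplk K L s x :
  hermitian_kernel K -> posdef K -> posdef (cmplk K) -> uniq (s ++ map fst L) ->
  exists2 c, {in s, c =1 x} &
    qform (s ++ map fst L) (cmplk K) c <= qform s (cmplk (condk K L)) x.
Proof.
move=> hK pK pK' us.
have [c cx cle] := @condk_lower_flip true (cmplk K) L s x (hermitian_cmplk hK) pK'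
  (posdef_cmplkK pK) us.
exists c => //; apply: le_trans cle _.
move: us; rewrite cat_uniq => /and3P[_ /hasPn hs uL].
have nL i : i \in s -> i \notin map fst L by apply: contraL => /hs.
rewrite (@eq_qform_kernel s _ (cmplk (condk K L))) // => i j si sj.
by have := condk_cmplk false K uL (nL i si) (nL j sj); rewrite flip0 => <-.
Qed.

(** The entry is the conditional probability that [b] is occupied given [L] (see [pr_cyl_cons]). *)
Lemma condk_diag K L b : hermitian_kernel K -> posdef K -> posdef (cmplk K) ->
  uniq (b :: map fst L) -> 0 < condk K L b b < 1.
Proof.
move=> hK pK pK' us; apply/andP; split.
- have [c c1] := @condk_lower K L [:: b] (fun=> 1) hK pK pK' us.
  rewrite qform1 conjC1 !mul1r; apply: lt_le_trans.
  by apply: pK => //=; rewrite c1 ?mem_head // oner_neq0.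
- have [c c1] := @condk_lower_cmplk K L [:: b] (fun=> 1) hK pK pK' us.
  rewrite qform1 conjC1 !mul1r cmplk_diag => cle.
  rewrite -subr_gt0; apply: lt_le_trans cle.
  by apply: pK' => //=; rewrite c1 ?mem_head // oner_neq0.
Qed.

(** With ones only, every step is a minimum over the coefficient at the conditioned site, so any
    choice [c] of these coefficients gives an upper bound. It is used with the nearly null
    polynomials that exist when GM(f) = 0. *)
Lemma condk_upper_ones K L s c :
  hermitian_kernel K -> posdef K -> posdef (cmplk K) -> uniq (s ++ map fst L) ->
  all snd L -> qform s (condk K L) c <= qform (s ++ map fst L) K c.
Proof.
move=> hK pK pK'; elim: L s => [|[b v] L IH] s /=; first by rewrite cats0.
move=> us /andP[-> aL].
have perm_b : perm_eq (s ++ b :: map fst L) ((b :: s) ++ map fst L).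
  by rewrite -(cat1s b) perm_catCA.
have us' : uniq ((b :: s) ++ map fst L) by rewrite -(perm_uniq perm_b).
rewrite (perm_qform _ _ perm_b); apply: le_trans (IH _ us' aL).
have /andP[k0 _] : 0 < condk K L b b < 1.
  apply: condk_diag => //; move: us'.
  by rewrite /= mem_cat negb_or cat_uniq => /andP[/andP[_ ->] /and3P[_ _ ->]].
rewrite qform_cons_square ?gt_eqF //; last exact: hermitian_condk.
by rewrite lerDr mulr_ge0 ?exprn_ge0 // ltW.
Qed.

Lemma condk_upper_zeros K L s c :
  hermitian_kernel K -> posdef K -> posdef (cmplk K) -> uniq (s ++ map fst L) ->
  all (fun bv => ~~ bv.2) L ->
  qform s (cmplk (condk K L)) c <= qform (s ++ map fst L) (cmplk K) c.
Proof.
move=> hK pK pK' us aL; rewrite -[in map fst _](map_flip1 true).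
move: (us); rewrite cat_uniq => /and3P[_ /hasPn hs uL].
have nL i : i \in s -> i \notin map fst L by apply: contraL => /hs.
rewrite (@eq_qform_kernel s _ (condk (cmplk K) (flip true L))); last first.
  by move=> i j si sj; have := condk_cmplk false K uL (nL i si) (nL j sj); rewrite flip0 => <-.
apply: condk_upper_ones; rewrite ?map_flip1 ?all_map //.
- exact: hermitian_cmplk.
- exact: posdef_cmplkK.
- by apply: sub_all aL => -[b v] /= /negbTE ->.
Qed.

End ConditionalKernel.

(** * Minors under Schur complements *)

Section BlockDeterminant.
Variables (F : fieldType) (n : nat).
Implicit Types (a : F) (u : 'rV[F]_n) (v : 'cV[F]_n) (A : 'M[F]_n).

Lemma det_block1_schur a u v A : a != 0 ->
  \det (block_mx a%:M u v A) = a * \det (A - a^-1 *: (v *m u)).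
Proof.
move=> a0.
have -> : block_mx a%:M u v A =
    block_mx (1%:M : 'M[F]_1) 0 (a^-1 *: v) 1%:M *m block_mx a%:M u 0 (A - a^-1 *: (v *m u)).
  rewrite mulmx_block !mul1mx !mul0mx !addr0 ?add0r.
  by rewrite -!scalemxAl mul_mx_scalar scalerA mulVf // scale1r addrC subrK.
by rewrite det_mulmx det_lblock det_ublock !det1 !mul1r det_scalar1.
Qed.

(** The determinant is affine in its corner entry; this allows the corner [K b b] to be replaced by
    [K b b - 1] for an empty site. *)
Lemma det_block1_affine a u v A :
  \det (block_mx a%:M u v A) = a * \det A + \det (block_mx 0 u v A).
Proof.
rewrite (@determinant_multilinear _ _ _ (block_mx 1%:M 0 v A) (block_mx 0 u v A)
  (lshift n ord0) a 1).
- by rewrite det_lblock det1 !mul1r.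
- apply/rowP => j; rewrite !mxE; case: splitP => // k; rewrite ord1 /= => _.
  rewrite !mxE; case: splitP => l _; rewrite ?mxE ?mulr0 ?mul1r ?add0r ?addr0 //.
  by rewrite !ord1 mulr1.
- by apply/matrixP => i j; rewrite !mxE; case: splitP => // -[[|//] ?].
- by apply/matrixP => i j; rewrite !mxE; case: splitP => // -[[|//] ?].
Qed.

End BlockDeterminant.

Section Minors.
Variables (C : numClosedFieldType) (T : eqType).
Implicit Types (K : T -> T -> C) (s : seq T).

Definition submx K s : 'M[C]_(size s) :=
  \matrix_(i, j) K (tnth (in_tuple s) i) (tnth (in_tuple s) j).

Lemma submx_cons K b s : submx K (b :: s) =
  block_mx (K b b)%:M (\row_j K b (tnth (in_tuple s) j))
           (\col_i K (tnth (in_tuple s) i) b) (submx K s) :> 'M[C]_(1 + size s).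
Proof.
apply/matrixP => i j; rewrite !mxE.
have tS (k : 'I_(size s)) (i' : 'I_(size (b :: s))) : i' = (1 + k)%N :> nat ->
    tnth (in_tuple (b :: s)) i' = tnth (in_tuple s) k.
  by move=> e; rewrite !(tnth_nth b) /= e.
have t0 (i' : 'I_(size (b :: s))) : i' = 0%N :> nat -> tnth (in_tuple (b :: s)) i' = b.
  by move=> e; rewrite (tnth_nth b) /= e.
case: splitP => k ek; rewrite !mxE; case: splitP => l el; rewrite ?ord1 ?mxE.
- by rewrite !t0 ?ek ?el ?ord1 //= mulr1n.
- by rewrite (t0 i) ?ek ?ord1 // (tS l j).
- by rewrite (t0 j) ?el ?ord1 // (tS k i).
- by rewrite (tS k i) // (tS l j).
Qed.

Lemma submx_cstep v K b s : submx (cstep v b K) s =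
  submx K s - (K b b - (~~ v)%:R)^-1 *:
    ((\col_i K (tnth (in_tuple s) i) b) *m (\row_j K b (tnth (in_tuple s) j))).
Proof.
by apply/matrixP => i j; rewrite !mxE big_ord1 !mxE /cstep mulrC.
Qed.

Lemma minor_cons_true K b s : K b b != 0 ->
  \det (submx K (b :: s)) = K b b * \det (submx (cstep true b K) s).
Proof. by move=> k0; rewrite submx_cons det_block1_schur // submx_cstep subr0. Qed.

(** The left side is the inclusion-exclusion formula for [s] occupied and [b] empty. By affinity in
    the corner it is minus the minor with corner [K b b - 1], whose Schur complement is
    [cstep false]. *)
Lemma minor_cons_false K b s : K b b != 1 ->
  \det (submx K s) - \det (submx K (b :: s)) =
  (1 - K b b) * \det (submx (cstep false b K) s).
Proof.
move=> k1; rewrite submx_cons det_block1_affine submx_cstep /=.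
set u := \row__ _; set v := \col__ _; set A := submx _ _.
have k0 : K b b - 1 != 0 by rewrite subr_eq0.
have := @det_block1_schur _ _ (K b b - 1) u v A k0.
rewrite det_block1_affine -[1 - _]opprB mulNr => <-; ring.
Qed.

Lemma norm_prod_sub_le (n : nat) (a b : 'I_n -> C) (e : C) :
  (forall i, `|a i| <= 1) -> (forall i, `|b i| <= 1) -> (forall i, `|a i - b i| <= e) ->
  `|\prod_i a i - \prod_i b i| <= n%:R * e.
Proof.
elim: n a b => [|n IH] a b ha hb hab; first by rewrite !big_ord0 subrr normr0 mul0r.
rewrite !big_ord_recl; set A := \prod_(i < n) a _; set B := \prod_(i < n) b _.
have -> : a ord0 * A - b ord0 * B = (a ord0 - b ord0) * A + b ord0 * (A - B) by ring.
apply: le_trans (ler_normD _ _) _; rewrite !normrM.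
have hA : `|A| <= 1 by rewrite normr_prod; apply: prodr_ile1 => i; rewrite normr_ge0 ha.
rewrite -[n.+1%:R]nat1r mulrDl mul1r; apply: lerD.
  by apply: le_trans (hab ord0); rewrite ler_piMr.
apply: (@le_trans _ _ `|A - B|); first by rewrite ler_piMl.
by apply: IH => i.
Qed.

(** Each of the n! products in the Leibniz formula moves by at most n e. *)
Lemma norm_det_sub_le (n : nat) (A B : 'M[C]_n) (e : C) :
  (forall i j, `|A i j| <= 1) -> (forall i j, `|B i j| <= 1) ->
  (forall i j, `|A i j - B i j| <= e) ->
  `|\det A - \det B| <= (n`! * n)%:R * e.
Proof.
move=> hA hB hAB; rewrite /determinant -sumrB.
apply: le_trans (ler_norm_sum _ _ _) _.
apply: le_trans (_ : \sum_(s : {perm 'I_n}) (n%:R * e) <= _).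
  apply: ler_sum => s _; rewrite -mulrBr normrM normr_sign mul1r.
  exact: norm_prod_sub_le.
by rewrite sumr_const card_Sn -[leLHS]mulr_natl natrM mulrA.
Qed.

End Minors.

(** * Closeness of the conditioned kernel to the original one *)

Section ConditionalKernelBounds.
Variables (C : numClosedFieldType) (T : eqType).
Implicit Types (K : T -> T -> C) (s B : seq T) (x : T -> C) (L : seq (T * bool)).

Lemma qform_cat s B K c : hermitian_kernel K ->
  qform (s ++ B) K c = qform s K c + qform B K c +
    \sum_(b <- s) ((c b)^* * cross B K c b + c b * (cross B K c b)^*).
Proof.
move=> hK; elim: s => [|b s IH] /=.
  by rewrite {2}/qform !big_nil add0r addr0.
rewrite !qform_cons // IH big_cons.
have -> : cross (s ++ B) K c b = cross s K c b + cross B K c b by rewrite /cross big_cat.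
rewrite rmorphD /=; ring.
Qed.

(** Arithmetic-geometric mean, weighted so that two such terms cost q + 4 e: the q is paid by the
    form on the conditioned sites in [qform_cat_ge], which explains the limit [size s <= 2] and the
    constant 4 there. *)
Lemma twice_norm_le (X q e : C) : 0 <= q -> 0 <= e -> `|X| ^+ 2 <= e * q ->
  2 * `|X| <= q / 2 + 2 * e.
Proof.
move=> q0 e0 h; have r0 : 0 <= q / 2 + 2 * e by rewrite addr_ge0 ?divr_ge0 ?mulr_ge0.
rewrite -ler_sqr ?nnegrE ?mulr_ge0 // exprMn.
apply: (@le_trans _ _ (2 ^+ 2 * (e * q))); first by rewrite ler_wpM2l ?exprn_ge0.
rewrite -subr_ge0; have -> : (q / 2 + 2 * e) ^+ 2 - 2 ^+ 2 * (e * q) = (q / 2 - 2 * e) ^+ 2.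
  by field.
by rewrite real_exprn_even_ge0 // rpredB ?ger0_real ?divr_ge0 ?mulr_ge0.
Qed.

Lemma qform_cat_ge s B K c e : hermitian_kernel K -> 0 <= e -> (size s <= 2)%N ->
  0 <= qform B K c -> {in s, forall b, `|c b| <= 1} ->
  {in s, forall b, `|cross B K c b| ^+ 2 <= e * qform B K c} ->
  qform s K c - 4 * e <= qform (s ++ B) K c.
Proof.
move=> hK e0 s2 q0 c1 hb; rewrite qform_cat // -addrA lerD2l.
set q := qform B K c in q0 hb *; set r := q / 2 + 2 * e.
have r0 : 0 <= r by rewrite addr_ge0 ?divr_ge0 ?mulr_ge0.
have term b : b \in s -> - r <= (c b)^* * cross B K c b + c b * (cross B K c b)^*.
  move=> bs; set z := _ * cross _ _ _ _.
  have -> : c b * (cross B K c b)^* = z^* by rewrite rmorphM /= conjCK.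
  have zr : z + z^* \is Num.real by rewrite CrealE rmorphD /= conjCK addrC.
  have nz : `|z + z^*| <= r.
    apply: le_trans (ler_normD _ _) _; rewrite norm_conjC -mulr2n -mulr_natl.
    apply: le_trans (twice_norm_le q0 e0 (hb b bs)); rewrite ler_wpM2l //.
    by rewrite normrM norm_conjC ler_piMl // c1.
  by have := real_lerNnormlW zr nz.
have : - (2 * r) <= \sum_(b <- s) ((c b)^* * cross B K c b + c b * (cross B K c b)^*).
  apply: (@le_trans _ _ (\sum_(b <- s) - r)); last first.
    by rewrite big_seq [leRHS]big_seq; apply: ler_sum => b; apply: term.
  rewrite big_const_seq count_predT iter_addr_0 mulNrn lerN2 -[leLHS]mulr_natl.
  by rewrite ler_wpM2r // ler_nat.
have -> : - (4 * e) = q - 2 * r by rewrite /r; field.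
by rewrite lerD2l.
Qed.

Lemma qform_cmplkB K K' s x : qform s (cmplk K) x - qform s (cmplk K') x =
  qform s K' x - qform s K x.
Proof.
rewrite /qform -!sumrB; apply: eq_bigr => i _; rewrite -!sumrB.
by apply: eq_bigr => j _; rewrite /cmplk; ring.
Qed.

Lemma posdef_ge0 K s c : posdef K -> uniq s -> 0 <= qform s K c.
Proof.
move=> pK us; have [hs|/hasPn hs] := boolP (has (fun i => c i != 0) s).
  by rewrite ltW // pK.
rewrite /qform big1_seq // => i /andP[_ si]; rewrite big1 // => j _.
by have /negPn/eqP -> := hs i si; rewrite !mul0r.
Qed.

(** The lower bound in L^2(f) bounds the difference below; the one in L^2(1 - f) bounds it above,
    since the identity in [cmplk] cancels. *)
Lemma qform_condk_close K L s x e :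
  hermitian_kernel K -> posdef K -> posdef (cmplk K) -> uniq (s ++ map fst L) ->
  0 <= e -> (size s <= 2)%N -> {in s, forall b, `|x b| <= 1} ->
  (forall c b, b \in s -> `|cross (map fst L) K c b| ^+ 2 <= e * qform (map fst L) K c) ->
  (forall c b, b \in s -> `|cross (map fst L) (cmplk K) c b| ^+ 2 <=
     e * qform (map fst L) (cmplk K) c) ->
  `|qform s (condk K L) x - qform s K x| <= 4 * e.
Proof.
move=> hK pK pK' us e0 s2 x1 hb hb'.
have uL : uniq (map fst L) by move: us; rewrite cat_uniq => /and3P[].
have [c cx cle] := condk_lower x hK pK pK' us.
have [d dx dle] := condk_lower_cmplk x hK pK pK' us.
have h1 : qform s K x - 4 * e <= qform s (condk K L) x.
  rewrite -(eq_qform K cx); apply: le_trans cle; apply: qform_cat_ge => //.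
  - exact: posdef_ge0.
  - by move=> b bs; rewrite cx ?x1.
  - by move=> b bs; apply: hb.
have h2 : qform s (cmplk K) x - 4 * e <= qform s (cmplk (condk K L)) x.
  rewrite -(eq_qform (cmplk K) dx); apply: le_trans dle; apply: qform_cat_ge => //.
  - exact: hermitian_cmplk.
  - exact: posdef_ge0.
  - by move=> b bs; rewrite dx ?x1.
  - by move=> b bs; apply: hb'.
set D := _ - _.
have hD1 : - (4 * e) <= D by rewrite /D lerBrDl.
have hD2 : D <= 4 * e by rewrite /D -(qform_cmplkB K) lerBlDl -lerBlDr.
have Dr : D \is Num.real by rewrite (ler_real hD2) ger0_real // mulr_ge0.
by rewrite real_ler_norml // hD1.
Qed.

(** Polarisation: the vectors with coefficient 1 at [i] and [z] at [j], for z = 1 and z = i, recover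
    the sum and the difference of the two off-diagonal errors. *)
Lemma condk_close K L i j e :
  hermitian_kernel K -> posdef K -> posdef (cmplk K) -> uniq (map fst L) ->
  i \notin map fst L -> j \notin map fst L -> 0 <= e ->
  (forall c b, b \in [:: i; j] ->
     `|cross (map fst L) K c b| ^+ 2 <= e * qform (map fst L) K c) ->
  (forall c b, b \in [:: i; j] ->
     `|cross (map fst L) (cmplk K) c b| ^+ 2 <= e * qform (map fst L) (cmplk K) c) ->
  `|condk K L i j - K i j| <= 12 * e.
Proof.
move=> hK pK pK' uL iL jL e0 hb hb'; set K' := condk K L.
have diag b : b \in [:: i; j] -> `|K' b b - K b b| <= 4 * e.
  move=> bij; have bL : b \notin map fst L by move: bij; rewrite !inE => /orP[] /eqP ->.
  have := @qform_condk_close K L [:: b] (fun=> 1) e hK pK pK'.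
  rewrite !qform1 conjC1 !mul1r /= bL; apply => // [b' _|c b'|c b']; rewrite ?normr1 //.
    by rewrite inE => /eqP ->; apply: hb.
  by rewrite inE => /eqP ->; apply: hb'.
have [<-|ij] := eqVneq i j.
  apply: le_trans (diag i (mem_head _ _)) _; rewrite ler_wpM2r // ler_nat //.
have [hi hj] : i \in [:: i; j] /\ j \in [:: i; j] by rewrite !inE !eqxx orbT.
have pair z : `|z| <= 1 ->
    `|(K' i i - K i i) + z * z^* * (K' j j - K j j) +
      (z^* * (K' i j - K i j) + z * (K' j i - K j i))| <= 4 * e.
  move=> z1.
  have x1 : {in [:: i; j], forall b, `|if b == i then 1 else z| <= 1 :> C}.
    by move=> b _ /=; case: ifP => // _; rewrite normr1.
  have us : uniq ([:: i; j] ++ map fst L) by rewrite /= inE (negPf ij) iL jL.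
  have := qform_condk_close hK pK pK' us e0 (leqnn 2) x1 hb hb'.
  have E K0 : qform [:: i; j] K0 (fun b => if b == i then 1 else z) =
      K0 i i + z * z^* * K0 j j + (z^* * K0 i j + z * K0 j i).
    rewrite /qform !big_cons !big_nil eqxx [j == i]eq_sym (negPf ij) conjC1; ring.
  rewrite !E.
  by congr (`|_| <= _); rewrite -/K'; ring.
set a := K' i j - K i j in pair *; set b := K' j i - K j i in pair.
have d1 := diag i hi; have d2 := diag j hj.
(* Three errors of at most 4 e each: the form at this vector and the two diagonal entries. *)
have sumle z : `|z| = 1 -> `|z^* * a + z * b| <= 12 * e.
  move=> z1; have zz : z * z^* = 1 by rewrite -normCK z1 expr1n.
  have := pair z; rewrite z1 lexx zz mul1r => /(_ isT) h.
  set u := K' i i - K i i in d1 h; set v := K' j j - K j j in d2 h.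
  have -> : z^* * a + z * b = (u + v + (z^* * a + z * b)) - u - v by ring.
  have -> : 12 * e = 4 * e + 4 * e + 4 * e by ring.
  by rewrite (le_trans (ler_normB _ _)) // lerD // (le_trans (ler_normB _ _)) // lerD.
have h1 : `|a + b| <= 12 * e by have := sumle 1; rewrite normr1 conjC1 !mul1r; apply.
have h2 : `|a - b| <= 12 * e.
  have := sumle 'i; rewrite normCi conjCi => /(_ erefl).
  have -> : - 'i * a + 'i * b = - 'i * (a - b) by ring.
  by rewrite normrM normrN normCi mul1r.
have -> : a = (a + b) / 2 + (a - b) / 2 by field.
apply: le_trans (ler_normD _ _) _; rewrite !normrM normfV normr_nat.
have -> : 12 * e = 12 * e / 2 + 12 * e / 2 by field.
by rewrite lerD // ler_wpM2r // invr_ge0.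
Qed.

(** Conditioning further on [j] occupied leaves a positive diagonal entry at [i], that is |K' i j|^2
    < K' i i K' j j for K' = [condk K L]. *)
Lemma condk_norm_le1 K L i j :
  hermitian_kernel K -> posdef K -> posdef (cmplk K) -> uniq (map fst L) ->
  i \notin map fst L -> j \notin map fst L -> `|condk K L i j| <= 1.
Proof.
move=> hK pK pK' uL iL jL.
have ui : uniq (i :: map fst L) by rewrite /= iL.
have uj : uniq (j :: map fst L) by rewrite /= jL.
have /andP[i0 i1] := condk_diag hK pK pK' ui.
have /andP[j0 j1] := condk_diag hK pK pK' uj.
have [<-|ij] := eqVneq i j; first by rewrite gtr0_norm // ltW.
have uij : uniq (i :: map fst ((j, true) :: L)) by rewrite /= inE negb_or ij iL jL.
have /andP[+ _] := condk_diag hK pK pK' uij.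
rewrite /= /cstep subr0 (hermitian_condk L hK i j) -normCK subr_gt0 ltr_pdivrMr // => h.
rewrite -ler_sqr ?nnegrE // expr1n; apply: le_trans (ltW h) _.
by rewrite mulr_ile1 // ltW.
Qed.

End ConditionalKernelBounds.

(** * Linear prediction *)

(** Cauchy-Schwarz for the vectors (c sqrt d, sqrt q) and (a / sqrt d, sqrt t); it adds one
    orthogonal direction at a time in [gap_bound]. *)
Lemma cauchy_schwarz2 (C : numClosedFieldType) (c a b d q t : C) :
  0 < d -> 0 <= q -> 0 <= t -> `|b| ^+ 2 <= q * t ->
  `|c * a + b| ^+ 2 <= (`|c| ^+ 2 * d + q) * (`|a| ^+ 2 / d + t).
Proof.
move=> d0 q0 t0 bqt.
have d' : d != 0 by rewrite gt_eqF.
set X := `|c| ^+ 2 * d * t; set Y := q * (`|a| ^+ 2 / d).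
set Z := `|c| * `|a| * `|b|.
have X0 : 0 <= X by rewrite !mulr_ge0 ?exprn_ge0 // ltW.
have Y0 : 0 <= Y by rewrite !mulr_ge0 ?exprn_ge0 // invr_ge0 ltW.
have Z0 : 0 <= Z by rewrite !mulr_ge0.
have ZXY : 2 * Z <= X + Y.
  rewrite -ler_sqr ?nnegrE ?(addr_ge0 X0 Y0) ?(mulr_ge0 (ler0n _ 2) Z0) //.
  have -> : (2 * Z) ^+ 2 = 4 * (`|c| ^+ 2 * `|a| ^+ 2) * `|b| ^+ 2 by rewrite /Z; ring.
  apply: le_trans (_ : 4 * (`|c| ^+ 2 * `|a| ^+ 2) * (q * t) <= _).
    by rewrite ler_wpM2l // !mulr_ge0 ?exprn_ge0.
  have -> : 4 * (`|c| ^+ 2 * `|a| ^+ 2) * (q * t) = (X + Y) ^+ 2 - (X - Y) ^+ 2.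
    by rewrite /X /Y; field.
  by rewrite gerBl real_exprn_even_ge0 // rpredB ?ger0_real.
apply: (@le_trans _ _ ((`|c| * `|a| + `|b|) ^+ 2)).
  by apply: lerXn2r; rewrite ?nnegrE ?addr_ge0 ?mulr_ge0 // -normrM ler_normD.
have -> : (`|c| * `|a| + `|b|) ^+ 2 = `|c| ^+ 2 * `|a| ^+ 2 + 2 * Z + `|b| ^+ 2.
  by rewrite /Z; ring.
have -> : (`|c| ^+ 2 * d + q) * (`|a| ^+ 2 / d + t) =
    `|c| ^+ 2 * `|a| ^+ 2 + (X + Y) + q * t by rewrite /X /Y; field.
by rewrite !lerD.
Qed.

(** The right side has n terms in each sum however large m is; this makes the prediction estimate
    uniform in the length of the past. *)
Lemma sum_sub_shift (V : zmodType) (u : nat -> V) m n :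
  \sum_(k < m) (u k - u (k + n)%N) = \sum_(k < n) u k - \sum_(k < n) u (m + k)%N.
Proof.
elim: m => [|m IH]; first by rewrite big_ord0 subrr.
rewrite big_ord_recr /= IH -addrA; congr (_ + _).
have : \sum_(k < n) u (m + k)%N + u (m + n)%N = u m + \sum_(k < n) u (m.+1 + k)%N.
  transitivity (\sum_(k < n.+1) u (m + k)%N); first by rewrite big_ord_recr.
  rewrite big_ord_recl addn0; congr (_ + _).
  by apply: eq_bigr => k _; rewrite /= /bump /= addnA addn1.
move/(canRL (addKr _)) => ->.
by rewrite opprD opprK opprD !addrA [- _ + u m]addrC addrNK subrr add0r.
Qed.

Section StationaryForm.
Variables (C : numClosedFieldType) (form : {poly C} -> {poly C} -> C).
Hypothesis formDl : forall a p q r, form (a *: p + q) r = a * form p r + form q r.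
Hypothesis formC : forall p q, form q p = (form p q)^*.
Hypothesis form_gt0 : forall p, p != 0 -> 0 < form p p.
Hypothesis form_shift : forall p q, form ('X * p) ('X * q) = form p q.
(** This encodes f <= 1: by Parseval the right side is the squared norm for the density 1. *)
Hypothesis form_contract : forall n c,
  form (\poly_(i < n) c i) (\poly_(i < n) c i) <= \sum_(i < n) `|c i| ^+ 2.

Lemma form0l r : form 0 r = 0.
Proof.
have := formDl 1 0 0 r; rewrite scale1r addr0 mul1r -[X in X = _]addr0.
by move/addrI.
Qed.

Lemma formD p q r : form (p + q) r = form p r + form q r.
Proof. by have := formDl 1 p q r; rewrite scale1r mul1r. Qed.

Lemma formZ a p r : form (a *: p) r = a * form p r.
Proof. by have := formDl a p 0 r; rewrite form0l !addr0. Qed.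

Lemma formB p q r : form (p - q) r = form p r - form q r.
Proof. by rewrite -scaleN1r formD formZ mulN1r. Qed.

Lemma formDr p q r : form r (p + q) = form r p + form r q.
Proof. by rewrite formC formD rmorphD /= -!formC. Qed.

Lemma formZr a p r : form r (a *: p) = a^* * form r p.
Proof. by rewrite formC formZ rmorphM /= -formC. Qed.

Lemma formBr p q r : form r (p - q) = form r p - form r q.
Proof. by rewrite formC formB rmorphB /= -!formC. Qed.

Lemma form_suml (I : Type) (s : seq I) (P : pred I) F r :
  form (\sum_(i <- s | P i) F i) r = \sum_(i <- s | P i) form (F i) r.
Proof. by apply: (big_morph (form^~ r)) => [p q|]; [exact: formD|exact: form0l]. Qed.

Lemma form_ge0 p : 0 <= form p p.
Proof. by have [->|/form_gt0/ltW//] := eqVneq p 0; rewrite form0l. Qed.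

Lemma form_shiftn n p q : form ('X^n * p) ('X^n * q) = form p q.
Proof. by elim: n => [|n IH]; rewrite ?expr0 ?mul1r // exprS -!mulrA form_shift. Qed.

(* Gram-Schmidt: [v] minus its projection on the span of 'X, ..., 'X^k. *)
Fixpoint innov k v : {poly C} :=
  if k is k'.+1 then
    let b := innov k' 'X^k in let w := innov k' v in w - (form w b / form b b) *: b
  else v.

Lemma innov_span k v : exists2 r : {poly C}, (size r <= k)%N & innov k v = v + 'X * r.
Proof.
elim: k v => [|k IH] v /=; first by exists 0; rewrite ?size_poly0 // mulr0 addr0.
have [r1 s1 ->] := IH v; have [r2 s2 ->] := IH 'X^(k.+1).
set a := _ / _; exists (r1 - a *: ('X^k + r2)).
  rewrite (leq_trans (size_polyD _ _)) // geq_max (leq_trans s1) //=.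
  rewrite size_polyN (leq_trans (size_scale_leq _ _)) //.
  by rewrite (leq_trans (size_polyD _ _)) // geq_max size_polyXn leqnn /= (leq_trans s2).
by rewrite exprS -!mul_polyC; ring.
Qed.

Lemma ortho_span k (u r : {poly C}) : (size r <= k)%N ->
  (forall j, (j < k)%N -> form 'X^(j.+1) u = 0) -> form ('X * r) u = 0.
Proof.
move=> rk uj; have -> : r = \sum_(j < k) r`_j *: 'X^j.
  rewrite -poly_def; apply/polyP => j; rewrite coef_poly.
  by case: ltnP => // kj; rewrite nth_default // (leq_trans rk).
rewrite mulr_sumr form_suml big1 // => j _.
by rewrite -scalerAr formZ -exprS uj ?mulr0.
Qed.

Lemma coef0_innovX k : (innov k 'X^(k.+1))`_k.+1 = 1.
Proof.
have [r rk ->] := innov_span k 'X^(k.+1).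
by rewrite coefD coefXn eqxx coefXM /= nth_default ?addr0.
Qed.

Lemma innov_orth k v j : (j < k)%N -> form 'X^(j.+1) (innov k v) = 0.
Proof.
elim: k v j => [//|k IH] v j; rewrite ltnS leq_eqVlt => /predU1P[->|jk] /=; last first.
  by rewrite formBr formZr !IH // mulr0 subrr.
set b := innov k 'X^(k.+1); set w := innov k v.
have b0 : form b b != 0.
  rewrite gt_eqF // form_gt0 //; apply/eqP => /(congr1 (fun p : {poly C} => p`_k.+1)).
  by rewrite coef0_innovX coef0 => /eqP; rewrite oner_eq0.
have [r2 s2 eb] := innov_span k 'X^(k.+1).
have -> : 'X^(k.+1) = b - 'X * r2 by rewrite /b eb addrK.
rewrite formB [X in _ - X](@ortho_span k) // ?subr0; last first.
  by move=> i ik; rewrite formBr formZr !IH // mulr0 subrr.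
rewrite formBr formZr rmorphM rmorphV ?unitfE //= -!formC divfK //.
by rewrite subrr.
Qed.

(** The error of the best linear prediction of the character 1 from 'X, ..., 'X^k; [perr k] is the
    squared distance from 1 to their span. *)
Definition predictor k := innov k 1.
Definition perr k := form (predictor k) (predictor k).

Lemma predictor0 k : (predictor k)`_0 = 1.
Proof.
by have [r _] := innov_span k 1; rewrite /predictor => ->; rewrite coefD coef1 coefXM addr0.
Qed.

Lemma perr_gt0 k : 0 < perr k.
Proof.
apply: form_gt0; apply/eqP => /(congr1 (fun p : {poly C} => p`_0)).
by rewrite predictor0 coef0 => /eqP; rewrite oner_eq0.
Qed.

Lemma perr_min k (r : {poly C}) : (size r <= k)%N -> perr k <= form (1 + 'X * r) (1 + 'X * r).
Proof.
move=> rk; have [r0 s0 e0] := innov_span k 1.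
have o (t : {poly C}) : (size t <= k)%N -> form ('X * t) (predictor k) = 0.
  by move=> tk; apply: (ortho_span tk) => j; apply: innov_orth.
have -> : 1 + 'X * r = predictor k + 'X * (r - r0) by rewrite /predictor e0; ring.
have tk : (size (r - r0)%R <= k)%N.
  by rewrite (leq_trans (size_polyD _ _)) // geq_max rk size_polyN.
rewrite formD !formDr o // [form _ ('X * _)]formC o // conjC0 addr0 add0r.
by rewrite lerDl form_ge0.
Qed.

Lemma perr_decr k n : perr (k + n) <= perr k.
Proof.
have [r0 s0 e0] := innov_span k 1.
rewrite {2}/perr /predictor e0; apply: perr_min.
by rewrite (leq_trans s0) // leq_addr.
Qed.

(* Correcting [predictor k] by the terms in 'X^(k+1), ..., 'X^(k+n) gives a
   competitor for [predictor (k + n)]. *)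
Lemma bessel_predictor k n :
  \sum_(i < n) `|form (predictor k) 'X^((k + i).+1)| ^+ 2 <= perr k - perr (k + n).
Proof.
set p := predictor k; set c := fun i => form p 'X^((k + i).+1).
pose w := \poly_(i < n) c i; set s := \sum_(i < n) _.
have [r0 s0 e0] := innov_span k 1.
have su : form p ('X^(k.+1) * w) = s.
  rewrite /w poly_def mulr_sumr formC form_suml rmorph_sum /=; apply: eq_bigr => i _.
  rewrite -scalerAr formZ rmorphM /= -formC -exprD normCK mulrC addSn //.
have h1 : perr (k + n) <= form (p - 'X^(k.+1) * w) (p - 'X^(k.+1) * w).
  have -> : p - 'X^(k.+1) * w = 1 + 'X * (r0 - 'X^k * w).
    by rewrite /p /predictor e0 exprS; ring.
  apply: perr_min; rewrite (leq_trans (size_polyD _ _)) // geq_max size_polyN.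
  rewrite (leq_trans s0) ?leq_addr //= mulrC; have [->|w0] := eqVneq w 0.
    by rewrite mul0r size_poly0.
  by rewrite size_mulXn // leq_add2l size_poly.
have h2 : form ('X^(k.+1) * w) ('X^(k.+1) * w) <= s.
  by rewrite form_shiftn; apply: form_contract.
have sr : s^* = s.
  by apply/CrealP; rewrite ger0_real // sumr_ge0 // => i _; rewrite exprn_ge0.
rewrite lerBrDr -lerBrDl; apply: le_trans h1 _.
rewrite formB !formBr [form ('X^_ * _) p]formC su sr -/(perr k).
by rewrite opprB addrA lerBlDr lerD2l.
Qed.

(** The polynomials 'X^(n-1-k) * [predictor k], k < n, form an orthogonal basis of the polynomials
    of size at most n, with squared norms [perr k]. By stationarity the sum is the squared norm of
    the projection of 'X^(n+i) on their span. *)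
Lemma gap_bound n (q : {poly C}) i : (size q <= n)%N ->
  `|form q 'X^(n + i)| ^+ 2 <=
  form q q * \sum_(k < n) `|form (predictor k) 'X^(k.+1 + i)| ^+ 2 / perr k.
Proof.
elim: n q => [|n IH] q.
  by rewrite leqn0 size_poly_eq0 => /eqP ->; rewrite !form0l normr0 expr0n mul0r.
move=> qn; have [r0 s0 e0] := innov_span n 1.
have [q1 s1 eq1] : exists2 q1 : {poly C}, (size q1 <= n)%N & q = q`_0 *: 1 + 'X * q1.
  exists (drop_poly 1 q); first by rewrite size_drop_poly leq_subLR add1n.
  rewrite -[LHS](poly_take_drop 1) expr1 [_ * 'X]mulrC; congr (_ + _).
  by apply/polyP => -[|j]; rewrite coef_take_poly coefZ coef1 /= ?mulr1 ?mulr0.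
(* Subtracting [c] times the predictor removes the constant term; the remainder is 'X times a
   polynomial of size at most n and is orthogonal to the predictor. *)
set c := q`_0 in eq1; pose q' := q1 - c *: r0.
have s' : (size q' <= n)%N.
  rewrite (leq_trans (size_polyD _ _)) // geq_max s1 size_polyN.
  by rewrite (leq_trans (size_scale_leq _ _)).
have eq : q = c *: predictor n + 'X * q'.
  by rewrite eq1 /predictor e0 /q' -!mul_polyC; ring.
clearbody q'.
have o : form ('X * q') (predictor n) = 0.
  by apply: (ortho_span s') => j; apply: innov_orth.
have Qq : form q q = `|c| ^+ 2 * perr n + form q' q'.
  rewrite eq formD !formDr !formZ !formZr o [form _ ('X * _)]formC o conjC0 form_shift.
  by rewrite -/(perr n) normCK; ring.
have Eq : form q 'X^(n.+1 + i) = c * form (predictor n) 'X^(n.+1 + i) + form q' 'X^(n + i).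
  by rewrite {1}eq formD formZ addSn exprS form_shift.
have T0 m : 0 <= \sum_(k < m) `|form (predictor k) 'X^(k.+1 + i)| ^+ 2 / perr k.
  by apply: sumr_ge0 => k _; rewrite divr_ge0 ?exprn_ge0 // ltW // perr_gt0.
rewrite Eq Qq big_ord_recr /= [X in _ <= _ * X]addrC.
by apply: cauchy_schwarz2; rewrite ?perr_gt0 ?form_ge0 ?T0 // IH.
Qed.

(* Averaged over [N] successive shifts, the Bessel sums telescope; as [perr k]
   tends to [L], the right-hand side is o(N) by Cesaro. *)
Lemma remote_past_bound M N L (q : {poly C}) : 0 < L -> (forall k, L <= perr k) ->
  (size q <= M)%N ->
  N%:R * L * `|form q 'X^(M + N)| ^+ 2 <= form q q * \sum_(k < N) (perr k - L).
Proof.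
move=> L0 Lp qM.
pose a i := \sum_(k < M + N) `|form (predictor k) 'X^((k + i).+1)| ^+ 2 / perr k.
(* The exponent M + N splits as n + i with n >= M in N ways, each giving a bound for the same
   correlation. *)
have h1 (i : 'I_N) : `|form q 'X^(M + N)| ^+ 2 <= form q q * a i.
  have [n nE qn] : exists2 n, (M + N = n + i)%N & (size q <= n)%N.
    exists (M + (N - i))%N; first by rewrite -addnA subnK // ltnW.
    by rewrite (leq_trans qM) // leq_addr.
  rewrite nE; apply: le_trans (gap_bound i qn) _; rewrite ler_wpM2l ?form_ge0 // /a nE.
  rewrite big_split_ord /= lerDl sumr_ge0 // => k _.
  by rewrite divr_ge0 ?exprn_ge0 // ltW // perr_gt0.
have h2 : N%:R * `|form q 'X^(M + N)| ^+ 2 <= form q q * \sum_(i < N) a i.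
  rewrite mulr_sumr -[N in N%:R]card_ord mulr_natl -sumr_const.
  by apply: ler_sum => i _; apply: h1.
(* Summed over the shifts first, each predictor contributes one Bessel sum, and L / [perr k] <=
   1. *)
have h3 : L * \sum_(i < N) a i <= \sum_(k < M + N) (perr k - perr (k + N)).
  rewrite /a exchange_big /= mulr_sumr; apply: ler_sum => k _.
  apply: le_trans (bessel_predictor k N); rewrite mulr_sumr; apply: ler_sum => i _.
  rewrite mulrA ler_pdivrMr ?perr_gt0 // mulrC ler_wpM2l ?exprn_ge0 //.
have h4 : \sum_(k < M + N) (perr k - perr (k + N)) <= \sum_(k < N) (perr k - L).
  rewrite sum_sub_shift sumrB lerB //; apply: ler_sum => k _; exact: Lp.
rewrite -mulrA mulrCA; apply: le_trans (ler_wpM2l (ltW L0) h2) _.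
rewrite mulrCA ler_wpM2l ?form_ge0 //; exact: le_trans h3 h4.
Qed.

End StationaryForm.

(** * Trigonometric approximation *)

Section CircleMean.
Variable R : realType.
Notation mu := (@lebesgue_measure R).
Implicit Types (h g : R -> R).

Lemma measurable_circle : measurable (circle R).
Proof. exact: measurable_itv. Qed.

Lemma measure_circle : mu (circle R) = 1%E.
Proof. by rewrite /circle lebesgue_measure_itv /= lte_fin ltr01 oppr0 adde0. Qed.

Definition bmeas h := measurable_fun (circle R) h /\ exists M : R, forall x, `|h x| <= M.

Definition mean h : R := \int[mu]_(x in circle R) h x.

Lemma bmeas_integrable h : bmeas h -> mu.-integrable (circle R) (EFin \o h).
Proof.
move=> [mh [M hM]]; apply: measurable_bounded_integrable => //.
- exact: measurable_circle.
- by have := ltry (1 : R); rewrite -measure_circle.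
- by exists M; split; [exact: num_real|move=> N /ltW MN x _; apply: le_trans MN].
Qed.

Lemma bmeas_cst (c : R) : bmeas (fun=> c).
Proof. by split; [exact: measurable_cst|exists `|c|]. Qed.

Lemma bmeasD h g : bmeas h -> bmeas g -> bmeas (fun x => h x + g x).
Proof.
move=> [mh [M hM]] [mg [N gN]]; split; first exact: measurable_funD.
by exists (M + N) => x; rewrite (le_trans (ler_normD _ _)) ?lerD.
Qed.

Lemma bmeasM h g : bmeas h -> bmeas g -> bmeas (fun x => h x * g x).
Proof.
move=> [mh [M hM]] [mg [N gN]]; split; first exact: measurable_funM.
by exists (M * N) => x; rewrite normrM ler_pM.
Qed.

Lemma bmeasZ c h : bmeas h -> bmeas (fun x => c * h x).
Proof. exact/bmeasM/bmeas_cst. Qed.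

Lemma bmeasN h : bmeas h -> bmeas (fun x => - h x).
Proof. by move=> /(bmeasZ (-1)); congr bmeas; apply/funext => x; rewrite mulN1r. Qed.

Lemma bmeasB h g : bmeas h -> bmeas g -> bmeas (fun x => h x - g x).
Proof. by move=> bh /bmeasN; apply: bmeasD. Qed.

Lemma bmeas_norm h : bmeas h -> bmeas (fun x => `|h x|).
Proof.
move=> [mh [M hM]]; split; first exact: measurableT_comp.
by exists M => x; rewrite normr_id.
Qed.

Lemma bmeasX h n : bmeas h -> bmeas (fun x => h x ^+ n).
Proof.
move=> bh; elim: n => [|n IH]; first exact: bmeas_cst.
by under eq_fun do rewrite exprS; exact: bmeasM.
Qed.

Lemma bmeas_comp (F : R -> R) h (M : R) : measurable_fun [set: R] F ->
  measurable_fun (circle R) h -> (forall x, `|F (h x)| <= M) -> bmeas (F \o h).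
Proof. by move=> mF mh FM; split; [exact: measurableT_comp|exists M]. Qed.

Lemma bmeas_expR h : bmeas h -> bmeas (fun x => expR (h x)).
Proof.
move=> [mh [M hM]]; apply: (@bmeas_comp expR h (expR M)) => //.
move=> x; rewrite ger0_norm ?expR_ge0 // ler_expR.
exact: le_trans (ler_norm _) (hM x).
Qed.

Lemma meanD h g : bmeas h -> bmeas g -> mean (fun x => h x + g x) = mean h + mean g.
Proof.
by move=> bh bg; rewrite /mean RintegralD //; first [exact: measurable_circle|exact: bmeas_integrable].
Qed.

Lemma meanB h g : bmeas h -> bmeas g -> mean (fun x => h x - g x) = mean h - mean g.
Proof.
by move=> bh bg; rewrite /mean RintegralB //; first [exact: measurable_circle|exact: bmeas_integrable].
Qed.

Lemma meanZ c h : bmeas h -> mean (fun x => c * h x) = c * mean h.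
Proof.
by move=> bh; rewrite /mean RintegralZl //; first [exact: measurable_circle|exact: bmeas_integrable].
Qed.

Lemma meanN h : bmeas h -> mean (fun x => - h x) = - mean h.
Proof.
move=> bh; rewrite -mulN1r -meanZ //; congr mean.
by apply/funext => x; rewrite mulN1r.
Qed.

Lemma mean_cst c : mean (fun=> c) = c.
Proof.
rewrite /mean Rintegral_cst; last exact: measurable_circle.
exact: etrans (congr1 (fun a => c * fine a) measure_circle) (mulr1 c).
Qed.

Lemma le_mean h g : bmeas h -> bmeas g -> (forall x, circle R x -> h x <= g x) ->
  mean h <= mean g.
Proof.
move=> bh bg hg; rewrite /mean; apply: le_Rintegral; last exact: hg.
- exact: measurable_circle.
- exact: bmeas_integrable.
- exact: bmeas_integrable.
Qed.

Lemma mean_ge0 h : (forall x, 0 <= h x) -> 0 <= mean h.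
Proof. by move=> h0; apply: Rintegral_ge0. Qed.

Lemma eq_mean h g : (forall x, circle R x -> h x = g x) -> mean h = mean g.
Proof. by move=> hg; apply: eq_Rintegral => x /[!inE]; apply: hg. Qed.

Definition cbmeas (u : R -> R[i]) :=
  bmeas (fun x => complex.Re (u x)) /\ bmeas (fun x => complex.Im (u x)).

Definition cmean (u : R -> R[i]) : R[i] :=
  Complex (mean (fun x => complex.Re (u x))) (mean (fun x => complex.Im (u x))).

Lemma cReM (a b : R[i]) : complex.Re (a * b) =
  complex.Re a * complex.Re b - complex.Im a * complex.Im b.
Proof. by case: a b => ? ? []. Qed.

Lemma cImM (a b : R[i]) : complex.Im (a * b) =
  complex.Re a * complex.Im b + complex.Im a * complex.Re b.
Proof. by case: a b => ? ? []. Qed.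

Lemma cReD (a b : R[i]) : complex.Re (a + b) = complex.Re a + complex.Re b.
Proof. by case: a b => ? ? []. Qed.

Lemma cImD (a b : R[i]) : complex.Im (a + b) = complex.Im a + complex.Im b.
Proof. by case: a b => ? ? []. Qed.

Lemma cReN (a : R[i]) : complex.Re (- a) = - complex.Re a.
Proof. by case: a. Qed.

Lemma cImN (a : R[i]) : complex.Im (- a) = - complex.Im a.
Proof. by case: a. Qed.

Lemma cReJ (a : R[i]) : complex.Re (a^*) = complex.Re a.
Proof. by case: a. Qed.

Lemma cImJ (a : R[i]) : complex.Im (a^*) = - complex.Im a.
Proof. by case: a. Qed.

Lemma complex_eq (a b : R[i]) : complex.Re a = complex.Re b ->
  complex.Im a = complex.Im b -> a = b.
Proof. by case: a b => ? ? [] ? ? /= -> ->. Qed.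

Lemma cbmeas_cst c : cbmeas (fun=> c).
Proof. by split; apply: bmeas_cst. Qed.

Lemma cbmeasD u v : cbmeas u -> cbmeas v -> cbmeas (fun x => u x + v x).
Proof.
move=> [bu1 bu2] [bv1 bv2]; split.
- by under eq_fun do rewrite cReD; exact: bmeasD.
- by under eq_fun do rewrite cImD; exact: bmeasD.
Qed.

Lemma cbmeasM u v : cbmeas u -> cbmeas v -> cbmeas (fun x => u x * v x).
Proof.
move=> [bu1 bu2] [bv1 bv2]; split.
- by under eq_fun do rewrite cReM; apply: bmeasB; apply: bmeasM.
- by under eq_fun do rewrite cImM; apply: bmeasD; apply: bmeasM.
Qed.

Lemma cbmeasJ u : cbmeas u -> cbmeas (fun x => (u x)^*).
Proof.
move=> [bu1 bu2]; split.
- by under eq_fun do rewrite cReJ.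
- by under eq_fun do rewrite cImJ; exact: bmeasN.
Qed.

Lemma cbmeas_real h : bmeas h -> cbmeas (fun x => (h x)%:C%C).
Proof. by move=> bh; split => //=; exact: bmeas_cst. Qed.

Lemma cbmeasX u n : cbmeas u -> cbmeas (fun x => u x ^+ n).
Proof.
move=> bu; elim: n => [|n IH]; first exact: cbmeas_cst.
by under eq_fun do rewrite exprS; exact: cbmeasM.
Qed.

Lemma cbmeas_sum (I : Type) (s : seq I) (F : I -> R -> R[i]) :
  (forall i, cbmeas (F i)) -> cbmeas (fun x => \sum_(i <- s) F i x).
Proof.
move=> bF; elim: s => [|i s IH].
  by under eq_fun do rewrite big_nil; exact: cbmeas_cst.
by under eq_fun do rewrite big_cons; exact: cbmeasD.
Qed.

Lemma cmeanD u v : cbmeas u -> cbmeas v ->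
  cmean (fun x => u x + v x) = cmean u + cmean v.
Proof.
move=> [bu1 bu2] [bv1 bv2]; apply: complex_eq; rewrite ?cReD ?cImD /= -meanD //.
- by congr mean; apply/funext => x; rewrite cReD.
- by congr mean; apply/funext => x; rewrite cImD.
Qed.

Lemma cmeanZ c u : cbmeas u -> cmean (fun x => c * u x) = c * cmean u.
Proof.
move=> [bu1 bu2]; apply: complex_eq; rewrite ?cReM ?cImM /=.
- rewrite -!meanZ // -meanB; [|exact: bmeasZ..].
  by congr mean; apply/funext => x; rewrite cReM.
- rewrite -!meanZ // -meanD; [|exact: bmeasZ..].
  by congr mean; apply/funext => x; rewrite cImM.
Qed.

Lemma cmeanJ u : cbmeas u -> cmean (fun x => (u x)^*) = (cmean u)^*.
Proof.
move=> [bu1 bu2]; apply: complex_eq; rewrite ?cReJ ?cImJ /= -?meanN //.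
- by congr mean; apply/funext => x; rewrite cReJ.
- by congr mean; apply/funext => x; rewrite cImJ.
Qed.

Lemma cmean_real h : cmean (fun x => (h x)%:C%C) = (mean h)%:C%C.
Proof. by apply: complex_eq => //=; rewrite (mean_cst 0). Qed.

Lemma cmean_cst c : cmean (fun=> c) = c.
Proof. by apply: complex_eq; rewrite /= mean_cst. Qed.

Lemma cmean_sum (I : Type) (s : seq I) (F : I -> R -> R[i]) : (forall i, cbmeas (F i)) ->
  cmean (fun x => \sum_(i <- s) F i x) = \sum_(i <- s) cmean (F i).
Proof.
move=> bF; elim: s => [|i s IH].
  by rewrite big_nil -[RHS](cmean_cst 0); congr cmean; apply/funext => x; rewrite big_nil.
rewrite big_cons -IH -cmeanD //; last exact: cbmeas_sum.
by congr cmean; apply/funext => x; rewrite big_cons.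
Qed.

End CircleMean.

Section Characters.
Variable R : realType.

Definition zc (x : R) : R[i] := expi (2 * pi * x).

Lemma expiD (s t : R) : expi (s + t) = expi s * expi t.
Proof. by apply: complex_eq; rewrite ?cReM ?cImM /= ?cosD ?sinD //; ring. Qed.

Lemma expi0 : expi (0 : R) = 1.
Proof. by rewrite /expi cos0 sin0. Qed.

Lemma expiN (t : R) : expi (- t) = (expi t)^*.
Proof. by apply: complex_eq; rewrite ?cReJ ?cImJ /= ?cosN ?sinN. Qed.

Lemma expiMn (t : R) n : expi (n%:R * t) = expi t ^+ n.
Proof.
elim: n => [|n IH]; first by rewrite mul0r expi0 expr0.
by rewrite -natr1 mulrDl mul1r expiD IH exprSr.
Qed.

Lemma expi_unit (t : R) : expi t * (expi t)^* = 1.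
Proof. by rewrite -expiN -expiD subrr expi0. Qed.

Lemma expi_2pi : expi (2 * pi : R) = 1.
Proof. by rewrite /expi mulr_natl cos2pi sin2pi. Qed.

Lemma measurable_mulrl (a : R) : measurable_fun (circle R) (fun x => a * x).
Proof. exact: mulrl_measurable. Qed.

Lemma bmeas_cos (a : R) : bmeas (fun x => cos (a * x)).
Proof.
apply: (@bmeas_comp _ cos (fun x => a * x) 1).
- by apply: continuous_measurable_fun; exact: continuous_cos.
- exact: measurable_mulrl.
- by move=> x; rewrite ler_norml cos_geN1 cos_le1.
Qed.

Lemma bmeas_sin (a : R) : bmeas (fun x => sin (a * x)).
Proof.
apply: (@bmeas_comp _ sin (fun x => a * x) 1).
- by apply: continuous_measurable_fun; exact: continuous_sin.
- exact: measurable_mulrl.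
- by move=> x; rewrite ler_norml sin_geN1 sin_le1.
Qed.

Lemma cbmeas_expi (a : R) : cbmeas (fun x => expi (a * x)).
Proof. by split; [exact: bmeas_cos|exact: bmeas_sin]. Qed.

Lemma cbmeas_horner (p : {poly R[i]}) : cbmeas (fun x => p.[zc x]).
Proof.
under eq_fun do rewrite horner_coef.
apply: cbmeas_sum => i; apply: cbmeasM; first exact: cbmeas_cst.
exact/cbmeasX/cbmeas_expi.
Qed.

Lemma mean_derive (F h : R -> R) : bmeas h -> continuous h ->
  (forall x : R, is_derive x (1 : R) F (h x)) -> mean h = F 1 - F 0.
Proof.
move=> bh ch dF; rewrite /mean Rintegral_itv_bndo_bndc; last exact: bmeas_integrable.
have cF : continuous F.
  by move=> x; apply/differentiable_continuous/derivable1_diffP; apply: ex_derive.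
rewrite /Rintegral (@continuous_FTC2 _ h F 0 1) ?ltr01 //.
- exact: continuous_subspaceT.
- split; [by move=> x _; exact: ex_derive| |].
  + exact/cvg_at_right_filter/cF.
  + exact/cvg_at_left_filter/cF.
- by move=> x _; rewrite derive1E; apply: derive_val.
Qed.

Lemma expi_zc n (x : R) : zc x ^+ n = expi (2 * pi * n%:R * x).
Proof. by rewrite /zc -expiMn; congr expi; ring. Qed.

Lemma cmean_zcX n : cmean (fun x => zc x ^+ n.+1) = 0.
Proof.
under eq_fun do rewrite expi_zc.
set a := 2 * pi * n.+1%:R : R.
have a0 : a != 0 by rewrite !mulf_neq0 // gt_eqF // pi_gt0.
have /(congr1 (fun z => (complex.Re z, complex.Im z))) /= [c1 s1] : expi a = 1.
  by rewrite /a mulrC expiMn expi_2pi expr1n.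
have clin : continuous (fun x : R => a * x) by move=> x; exact: mulrl_continuous.
have d1 x : is_derive x (1 : R) (fun x => a^-1 * sin (a * x)) (cos (a * x)).
  by apply: is_derive_eq; rewrite /GRing.scale /=; field; exact: a0.
have d2 x : is_derive x (1 : R) (fun x => - a^-1 * cos (a * x)) (sin (a * x)).
  by apply: is_derive_eq; rewrite /GRing.scale /=; field; exact: a0.
apply: complex_eq => /=.
- rewrite (mean_derive (bmeas_cos a) _ d1).
    by rewrite mulr1 mulr0 sin0 s1 mulr0 subrr.
  by move=> x; apply: continuous_comp; [exact: clin|exact: continuous_cos].
- rewrite (mean_derive (bmeas_sin a) _ d2).
    by rewrite mulr1 mulr0 cos0 c1 subrr.
  by move=> x; apply: continuous_comp; [exact: clin|exact: continuous_sin].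
Qed.

Lemma cmean_horner (p : {poly R[i]}) : cmean (fun x => p.[zc x]) = p`_0.
Proof.
have [->|p0] := eqVneq p 0.
  by rewrite coef0 -[RHS](@cmean_cst R 0); congr cmean; apply/funext => x; rewrite horner0.
have -> : (fun x => p.[zc x]) = (fun x => \sum_(i < size p) p`_i * zc x ^+ i).
  by apply/funext => x; rewrite horner_coef.
have bz i : cbmeas (fun x : R => zc x ^+ i) by apply/cbmeasX/cbmeas_expi.
rewrite cmean_sum; last by move=> i; apply: cbmeasM => //; exact: cbmeas_cst.
case: (size p) (size_poly_eq0 p) => [|n _]; first by rewrite eqxx (negPf p0).
rewrite big_ord_recl big1 ?addr0 => [|i _]; rewrite cmeanZ //.
- by rewrite (_ : (fun x => _) = fun=> 1) ?cmean_cst ?mulr1 //; apply/funext => x.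
- by rewrite cmean_zcX mulr0.
Qed.

End Characters.

Section Nsq.
Variable R : realType.
Implicit Types z w : R[i].

(* The squared modulus as an element of [R]; [`|z|] lives in [R[i]]. *)
Definition nsq z : R := complex.Re z ^+ 2 + complex.Im z ^+ 2.

Lemma nsqE z : (nsq z)%:C%C = z * z^*.
Proof. by apply: complex_eq; rewrite ?cReM ?cImM ?cReJ ?cImJ /nsq /=; ring. Qed.

Lemma nsq_ge0 z : 0 <= nsq z.
Proof. by rewrite addr_ge0 ?sqr_ge0. Qed.

Lemma nsqM z w : nsq (z * w) = nsq z * nsq w.
Proof. by rewrite /nsq cReM cImM; ring. Qed.

Lemma nsqJ z : nsq (z^*) = nsq z.
Proof. by rewrite /nsq cReJ cImJ sqrrN. Qed.

Lemma nsqX z n : nsq (z ^+ n) = nsq z ^+ n.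
Proof.
elim: n => [|n IH]; last by rewrite !exprS nsqM IH.
by rewrite !expr0 /nsq /= expr1n expr0n addr0.
Qed.

Lemma nsq_zc (x : R) : nsq (zc x) = 1.
Proof. by rewrite /nsq /= cos2Dsin2. Qed.

Lemma bmeas_nsq (u : R -> R[i]) : cbmeas u -> bmeas (fun x => nsq (u x)).
Proof. by move=> [b1 b2]; apply: bmeasD; apply: bmeasX. Qed.

End Nsq.

(** * Orthogonality of characters and the Fejer kernel *)

Section Fejer.
Variable R : realType.
Implicit Types (x y : R) (p q : {poly R[i]}).

Lemma zc_unit x : zc x * (zc x)^* = 1.
Proof. exact: expi_unit. Qed.

Lemma zcX_unit x n : zc x ^+ n * (zc x ^+ n)^* = 1.
Proof. by rewrite rmorphXn -exprMn zc_unit expr1n. Qed.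

Lemma cmean_characters i j : cmean (fun x : R => zc x ^+ i * (zc x ^+ j)^*) = (i == j)%:R.
Proof.
have key m k : cmean (fun x : R => zc x ^+ (m + k) * (zc x ^+ m)^*) = (k == 0)%:R.
  have -> : (fun x : R => zc x ^+ (m + k) * (zc x ^+ m)^*) = (fun x => zc x ^+ k).
    by apply/funext => x; rewrite addnC exprD -mulrA zcX_unit mulr1.
  case: k => [|k]; last exact: cmean_zcX.
  by rewrite -[RHS](@cmean_cst R); congr cmean; apply/funext => x.
have bz n : cbmeas (fun x : R => zc x ^+ n) by apply/cbmeasX/cbmeas_expi.
have [ij|ij] := leqP j i.
  by rewrite -(subnKC ij) key; congr (_%:R); congr (nat_of_bool _); lia.
transitivity ((cmean (fun x : R => zc x ^+ j * (zc x ^+ i)^*))^*).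
  rewrite -cmeanJ; last exact/cbmeasM/cbmeasJ.
  by congr cmean; apply/funext => x; rewrite rmorphM /= conjCK mulrC.
by rewrite -(subnKC (ltnW ij)) key rmorph_nat; congr (_%:R); congr (nat_of_bool _); lia.
Qed.

Lemma parseval_poly n (c : nat -> R[i]) :
  cmean (fun x => (\poly_(i < n) c i).[zc x] * ((\poly_(i < n) c i).[zc x])^*) =
  \sum_(i < n) c i * (c i)^*.
Proof.
have bz k : cbmeas (fun x : R => zc x ^+ k) by apply/cbmeasX/cbmeas_expi.
have -> : (fun x => (\poly_(i < n) c i).[zc x] * ((\poly_(i < n) c i).[zc x])^*) =
   (fun x => \sum_(i < n) \sum_(j < n) (c i * (c j)^*) * (zc x ^+ i * (zc x ^+ j)^*)).
  apply/funext => x; rewrite horner_poly rmorph_sum mulr_suml; apply: eq_bigr => i _.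
  by rewrite mulr_sumr; apply: eq_bigr => j _; rewrite rmorphM /=; ring.
have bij i j : cbmeas (fun x : R => zc x ^+ i * (zc x ^+ j)^*) by apply/cbmeasM/cbmeasJ.
rewrite cmean_sum => [|i]; last by apply: cbmeas_sum => j; apply: cbmeasM => //; exact: cbmeas_cst.
apply: eq_bigr => i _; rewrite cmean_sum => [|j]; last by apply: cbmeasM => //; exact: cbmeas_cst.
rewrite (bigD1 i) //= cmeanZ // cmean_characters eqxx mulr1 big1 ?addr0 // => j ji.
by rewrite cmeanZ // cmean_characters (inj_eq val_inj) eq_sym (negPf ji) mulr0.
Qed.

(** A one-sided sum: only its squared modulus matters, which over n + 1 is the Fejer kernel.
    Nonnegativity is then immediate and total mass 1 is Parseval's identity. *)
Definition dirichlet n x y : R[i] := \sum_(k < n.+1) (zc x * (zc y)^*) ^+ k.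
Definition fejer n x y : R := nsq (dirichlet n x y) / n.+1%:R.

Lemma fejer_ge0 n x y : 0 <= fejer n x y.
Proof. by rewrite divr_ge0 ?nsq_ge0. Qed.

Lemma cbmeas_dirichlet n x : cbmeas (dirichlet n x).
Proof.
apply: cbmeas_sum => k; apply: cbmeasX; apply: cbmeasM; first exact: cbmeas_cst.
exact/cbmeasJ/cbmeas_expi.
Qed.

Lemma bmeas_fejer n x : bmeas (fejer n x).
Proof. by apply: bmeasM; [exact/bmeas_nsq/cbmeas_dirichlet|exact: bmeas_cst]. Qed.

Lemma mean_fejer n x : mean (fejer n x) = 1.
Proof.
have e y : dirichlet n x y = ((\poly_(k < n.+1) ((zc x)^* ^+ k)).[zc y])^*.
  rewrite horner_poly rmorph_sum; apply: eq_bigr => k _.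
  by rewrite rmorphM /= !rmorphXn /= conjCK exprMn.
apply: (@complexI R); rewrite -cmean_real.
under eq_fun do rewrite /fejer rmorphM /= nsqE e conjCK mulrC [_^* * _]mulrC.
rewrite cmeanZ; last by apply: cbmeasM; [|apply: cbmeasJ]; apply: cbmeas_horner.
rewrite parseval_poly (eq_bigr (fun=> 1)) => [|k _]; last first.
  by rewrite rmorphXn /= conjCK -exprMn mulrC zc_unit expr1n.
by rewrite sumr_const card_ord -(rmorph_nat (real_complex R)) -rmorphM mulVf ?pnatr_eq0.
Qed.

Lemma nsqB_zc x y : nsq (zc x - zc y) = 2 - 2 * cos (2 * pi * (x - y)).
Proof.
rewrite /nsq cReD cImD cReN cImN /= mulrBr cosB.
have := cos2Dsin2 (2 * pi * x); have := cos2Dsin2 (2 * pi * y).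
set a := cos _; set b := sin _; set c := cos _; set d := sin _.
by move=> h1 h2; lra.
Qed.

(** Multiplying the geometric sum by w - 1 gives w^(n+1) - 1, of squared modulus at most 4. *)
Lemma fejer_concentrate n x y : fejer n x y * nsq (zc x - zc y) <= 4 / n.+1%:R.
Proof.
rewrite /fejer mulrAC ler_pM2r ?invr_gt0 ?ltr0n //.
set w := zc x * (zc y)^*.
have -> : nsq (zc x - zc y) = nsq (w - 1).
  have -> : zc x - zc y = (w - 1) * zc y.
    by rewrite mulrBl mul1r /w -mulrA [_^* * _]mulrC zc_unit mulr1.
  by rewrite nsqM nsq_zc mulr1.
have nw : nsq (w ^+ n.+1) = 1 by rewrite nsqX nsqM nsqJ !nsq_zc mulr1 expr1n.
rewrite -nsqM mulrC -subrX1; move: nw; rewrite /nsq cReD cImD cReN cImN /=.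
set a := complex.Re _; set b := complex.Im _ => ab.
have a1 : -1 <= a by have := sqr_ge0 b; have := sqr_ge0 (a - 1); nra.
rewrite oppr0 addr0; nra.
Qed.

(** Under the real part negative frequencies may be conjugated, so every real trigonometric
    polynomial has this form. A polynomial [p] without negative powers is what [poly_le_expR] can
    exponentiate. *)
Definition re_trig (h : R -> R) :=
  exists p, forall x, h x = complex.Re p.[zc x].

Lemma re_trig_sum (I : Type) (s : seq I) (F : I -> R -> R) :
  (forall i, re_trig (F i)) -> re_trig (fun x => \sum_(i <- s) F i x).
Proof.
move=> tF; elim: s => [|i s [p hp]].
  by exists 0 => x; rewrite big_nil horner0.
have [q hq] := tF i; exists (q + p) => x.
by rewrite big_cons hornerD cReD -hp hq.
Qed.

Lemma re_trig_monomial (c : R[i]) j k :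
  re_trig (fun x => complex.Re (c * (zc x ^+ j * (zc x ^+ k)^*))).
Proof.
have [kj|/ltnW jk] := leqP k j.
  exists (c *: 'X^(j - k)) => x; rewrite hornerZ hornerXn.
  have -> : zc x ^+ j = zc x ^+ (j - k) * zc x ^+ k by rewrite -exprD subnK.
  by rewrite -mulrA zcX_unit mulr1.
exists (c^* *: 'X^(k - j)) => x; rewrite hornerZ hornerXn -cReJ !rmorphM /= conjCK.
have -> : zc x ^+ k = zc x ^+ (k - j) * zc x ^+ j by rewrite -exprD subnK.
by congr (complex.Re (_ * _)); rewrite mulrCA [_^* * _]mulrC zcX_unit mulr1.
Qed.

Lemma re_trig_fejer n (g : R -> R) : bmeas g ->
  re_trig (fun x => mean (fun y => g y * fejer n x y)).
Proof.
move=> bg.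
pose c j k := cmean (fun y => (g y / n.+1%:R)%:C%C * ((zc y ^+ j)^* * zc y ^+ k)).
have bz k : cbmeas (fun x : R => zc x ^+ k) by apply/cbmeasX/cbmeas_expi.
have bg' : bmeas (fun y => g y / n.+1%:R) by apply: bmeasM => //; exact: bmeas_cst.
have bjk j k : cbmeas (fun y => (g y / n.+1%:R)%:C%C * ((zc y ^+ j)^* * zc y ^+ k)).
  by apply: cbmeasM; [exact: cbmeas_real|apply: cbmeasM => //; exact: cbmeasJ].
suff -> : (fun x => mean (fun y => g y * fejer n x y)) = (fun x =>
    \sum_(j < n.+1) \sum_(k < n.+1) complex.Re (c j k * (zc x ^+ j * (zc x ^+ k)^*))).
  by do 2 (apply: re_trig_sum => ?); apply: re_trig_monomial.
apply/funext => x; apply: (@complexI R); rewrite -cmean_real.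
pose G x y := \sum_(j < n.+1) \sum_(k < n.+1) (zc x ^+ j * (zc x ^+ k)^*) *
  ((g y / n.+1%:R)%:C%C * ((zc y ^+ j)^* * zc y ^+ k)).
have GE y : (g y * fejer n x y)%:C%C = G x y.
  rewrite /fejer mulrCA mulrC rmorphM /= nsqE /dirichlet rmorph_sum mulr_suml.
  rewrite mulr_sumr; apply: eq_bigr => j _; rewrite !mulr_sumr; apply: eq_bigr => k _.
  by rewrite !rmorphXn !rmorphM /= conjCK !exprMn; ring.
under eq_fun do rewrite GE.
have bG j k : cbmeas (fun y => (zc x ^+ j * (zc x ^+ k)^*) *
    ((g y / n.+1%:R)%:C%C * ((zc y ^+ j)^* * zc y ^+ k))).
  by apply: cbmeasM => //; exact: cbmeas_cst.
have eG : cmean (G x) = \sum_(j < n.+1) \sum_(k < n.+1) c j k * (zc x ^+ j * (zc x ^+ k)^*).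
  rewrite /G cmean_sum => [|j]; last exact: cbmeas_sum.
  apply: eq_bigr => j _; rewrite cmean_sum //; apply: eq_bigr => k _.
  by rewrite cmeanZ // mulrC.
have : complex.Im (cmean (G x)) = 0.
  rewrite -[G x]/(fun y => G x y); under eq_fun do rewrite -GE.
  by rewrite cmean_real.
have cRe_sum (I : Type) (s : seq I) (F : I -> R[i]) :
    complex.Re (\sum_(i <- s) F i) = \sum_(i <- s) complex.Re (F i).
  by apply: (big_morph (@complex.Re R)) => // a b; rewrite cReD.
move=> im0; apply: complex_eq; last by rewrite im0.
by rewrite eG cRe_sum; apply: eq_bigr => j _; rewrite cRe_sum.
Qed.

End Fejer.

Section FejerApproximation.
Variable R : realType.
Notation mu := (@lebesgue_measure R).
Implicit Types (x y : R) (g h : R -> R).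

Lemma cos_2pi_le (d s : R) : 0 < d -> d <= s <= 1 - d -> cos (2 * pi * s) <= cos (2 * pi * d).
Proof.
move=> d0 /andP[ds sd].
have pi0 : 0 < pi :> R := pi_gt0 R.
have bnd (t : R) : 0 <= t <= 2^-1 -> 0 <= 2 * pi * t <= pi by nra.
have le_half (t : R) : d <= t -> t <= 2^-1 -> cos (2 * pi * t) <= cos (2 * pi * d).
  move=> dt t2; have [->//|dt'] := eqVneq d t.
  have {dt'}dt' : d < t by rewrite lt_neqAle dt' dt.
  apply/ltW; rewrite ltr_cos ?in_itv /= ?bnd ?ltr_pM2l ?mulr_gt0 //; lra.
have [s2|s2] := leP s 2^-1; first exact: le_half.
have -> : cos (2 * pi * s) = cos (2 * pi * (1 - s)).
  have -> : 2 * pi * (1 - s) = pi *+ 2 - 2 * pi * s by rewrite -mulr_natl; ring.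
  by rewrite cosB cos2pi sin2pi mul0r addr0 mul1r.
by apply: le_half; lra.
Qed.

(** Near [x] continuity applies; elsewhere the chordal distance is bounded below. As [g] is not
    assumed periodic, points near the opposite end of the period are close on the circle to 0 only,
    which is why [x] must be interior. *)
Lemma modulus_chordal g (M x e : R) : continuous g -> (forall y, `|g y| <= M) ->
  0 < x < 1 -> 0 < e ->
  exists2 C, 0 <= C & forall y, circle R y -> `|g y - g x| <= e + C * nsq (zc x - zc y).
Proof.
move=> cg gM /andP[x0 x1] e0.
have [d0 d00 hd0] : exists2 d, 0 < d & forall y, `|x - y| < d -> `|g y - g x| < e.
  have /cvgrPdist_lt /(_ e e0) := cg x.
  move=> /nbhs_ballP[d /= dpos hd]; exists d => // y xy.
  by rewrite distrC; apply: hd.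
pose d := Num.min d0 (Num.min x (1 - x)).
have dpos : 0 < d by rewrite /d !lt_min d00 x0 subr_gt0.
have [dd0 dx dx1] : [/\ d <= d0, d <= x & d <= 1 - x].
  by rewrite /d; split; rewrite !ge_min lexx ?orbT.
have c1 : cos (2 * pi * d) < 1.
  have hp := pi_gt0 R.
  have h2 : 0 <= 2 * pi * d <= pi by nra.
  have h3 : 0 < 2 * pi * d by rewrite !mulr_gt0.
  by rewrite -[ltRHS](@cos0 R) ltr_cos ?in_itv /= ?h2 ?lexx ?(ltW hp).
set c := cos (2 * pi * d) in c1.
have M0 : 0 <= M := le_trans (normr_ge0 _) (gM x).
exists (M / (1 - c)); first by rewrite divr_ge0 // subr_ge0 ltW.
move=> y; rewrite /circle /= in_itv /= => /andP[y0 y1].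
have [xy|xy] := ltP `|x - y| d.
  apply: le_trans (ltW (hd0 y (lt_le_trans xy dd0))) _.
  by rewrite lerDl mulr_ge0 ?nsq_ge0 // divr_ge0 // subr_ge0 ltW.
have h1 : `|x - y| <= 1 - d by rewrite ler_norml; apply/andP; split; lra.
have h2 : nsq (zc x - zc y) >= 2 * (1 - c).
  rewrite nsqB_zc.
  have -> : cos (2 * pi * (x - y)) = cos (2 * pi * `|x - y|).
    by case: (ger0P (x - y)) => // _; rewrite mulrN cosN.
  by have := @cos_2pi_le d `|x - y| dpos; rewrite xy h1 -/c => /(_ isT); lra.
apply: le_trans (_ : 2 * M <= _).
  by apply: le_trans (ler_normB _ _) _; have := gM y; have := gM x; lra.
have c1' : 0 < 1 - c by rewrite subr_gt0.
apply: le_trans (_ : M / (1 - c) * (2 * (1 - c)) <= _).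
  by rewrite mulrCA divfK ?gt_eqF.
by apply: ler_wpDl; [exact: ltW|rewrite ler_wpM2l // divr_ge0 // ltW].
Qed.

Definition fejer_mean n g x := mean (fun y => g y * fejer n x y).

Lemma fejer_mean_le n g x b : bmeas g -> (forall y, g y <= b) -> fejer_mean n g x <= b.
Proof.
move=> bg gb; rewrite -[leRHS]mulr1 -(mean_fejer n x) -meanZ; last exact: bmeas_fejer.
apply: le_mean; first exact/bmeasM/bmeas_fejer.
  exact/bmeasZ/bmeas_fejer.
by move=> y _; rewrite ler_wpM2r ?fejer_ge0.
Qed.

Lemma fejer_mean_ge n g x a : bmeas g -> (forall y, a <= g y) -> a <= fejer_mean n g x.
Proof.
move=> bg gb; rewrite -[leLHS]mulr1 -(mean_fejer n x) -meanZ; last exact: bmeas_fejer.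
apply: le_mean; [exact/bmeasZ/bmeas_fejer|exact/bmeasM/bmeas_fejer|].
by move=> y _; rewrite ler_wpM2r ?fejer_ge0.
Qed.

Lemma fejer_mean_dist n g x e C : bmeas g -> 0 <= C ->
  (forall y, circle R y -> `|g y - g x| <= e + C * nsq (zc x - zc y)) ->
  `|fejer_mean n g x - g x| <= e + 4 * C / n.+1%:R.
Proof.
move=> bg C0 H.
have bf := bmeas_fejer n x.
have key u v : bmeas u -> bmeas v ->
    (forall y, circle R y -> u y - v y <= e + C * nsq (zc x - zc y)) ->
    mean (fun y => u y * fejer n x y) - mean (fun y => v y * fejer n x y) <=
    e + 4 * C / n.+1%:R.
  move=> bu bv uv; rewrite -meanB; [|exact: bmeasM..].
  have -> : e + 4 * C / n.+1%:R = mean (fun y => e * fejer n x y + 4 * C / n.+1%:R).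
    by rewrite meanD ?mean_cst ?meanZ ?mean_fejer ?mulr1 //; [exact: bmeasZ|exact: bmeas_cst].
  apply: le_mean; first by apply: bmeasB; exact: bmeasM.
    by apply: bmeasD; [exact: bmeasZ|exact: bmeas_cst].
  move=> y Iy; rewrite -mulrBl.
  apply: le_trans (ler_wpM2r (fejer_ge0 n x y) (uv y Iy)) _.
  have -> : 4 * C / n.+1%:R = C * (4 / n.+1%:R) by ring.
  rewrite mulrDl lerD2l -[X in X <= _]mulrA ler_wpM2l // mulrC.
  exact: fejer_concentrate.
have gxE : g x = mean (fun y => g x * fejer n x y) by rewrite meanZ // mean_fejer mulr1.
rewrite ler_norml; apply/andP; split.
  rewrite lerNl opprB gxE; apply: key => //; first exact: bmeas_cst.
  by move=> y Iy; apply: le_trans (H y Iy); rewrite distrC ler_norm.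
rewrite gxE; apply: key => //; first exact: bmeas_cst.
by move=> y Iy; apply: le_trans (H y Iy); rewrite ler_norm.
Qed.

Lemma fejer_cvg g (M x : R) : bmeas g -> continuous g -> (forall y, `|g y| <= M) ->
  0 < x < 1 -> fejer_mean n g x @[n --> \oo] --> g x.
Proof.
move=> bg cg gM x01; apply/cvgrPdist_le => e e0.
have e2 : 0 < e / 2 by rewrite divr_gt0.
have [C C0 HC] := modulus_chordal cg gM x01 e2.
near=> n; rewrite distrC; apply: le_trans (fejer_mean_dist n bg C0 HC) _.
rewrite -lerBrDl ler_pdivrMr ?ltr0n //.
have -> : e - e / 2 = e / 2 by lra.
have : 4 * C / (e / 2) <= n%:R by near: n; exact: nbhs_infty_ger.
rewrite ler_pdivrMr // => hn; rewrite -[n.+1%:R]natr1; lra.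
Unshelve. all: by end_near. Qed.

Lemma fejer_cvg_L1 g (M : R) : bmeas g -> continuous g -> (forall y, `|g y| <= M) ->
  mean (fun x => `|g x - fejer_mean n g x|) @[n --> \oo] --> 0.
Proof.
move=> bg cg gM.
have bt n : bmeas (fejer_mean n g).
  have [p hp] := re_trig_fejer n bg; have [bp _] := cbmeas_horner p.
  by move: bp; congr bmeas; apply/funext => x; rewrite -hp.
have bd n : bmeas (fun x => `|g x - fejer_mean n g x|) by apply/bmeas_norm/bmeasB.
have gM' y : - M <= g y <= M by rewrite -ler_norml.
have M0 : 0 <= M := le_trans (normr_ge0 _) (gM 0).
have tM n x : `|g x - fejer_mean n g x| <= 2 * M.
  apply: le_trans (ler_normB _ _) _; rewrite mulr_natl mulr2n lerD // ler_norml.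
  by rewrite fejer_mean_ge ?fejer_mean_le // => y; have /andP[] := gM' y.
have [| | | | |_ _] := @dominated_convergence _ _ R mu (circle R) (@measurable_circle R)
    (fun n x => (`|g x - fejer_mean n g x|)%:E) (fun=> 0%E) (fun=> (2 * M)%:E).
- by move=> n; apply/measurable_EFinP; have [] := bd n.
- exact: measurable_cst.
(* Pointwise convergence is known on ]0, 1[ only; the endpoint is a null set. *)
- exists [set 0]; split; [exact: measurable_set1|exact: lebesgue_measure_set1|].
  move=> x /= nx; apply/eqP/negPn/negP => x0; apply: nx.
  rewrite /circle /= in_itv /= => /andP[x_ge0 x1].
  have x01 : 0 < x < 1 by rewrite x1 lt_neqAle eq_sym x0 x_ge0.
  apply/fine_cvgP; split; first by near=> n.
  apply/cvgr0Pnorm_le => e e0 /=.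
  have /cvgrPdist_le /(_ e e0) := fejer_cvg bg cg gM x01.
  by apply: filterS => n; rewrite normr_id.
- by apply/bmeas_integrable/bmeas_cst.
- by apply: aeW => x n _ /=; rewrite lee_fin normr_id.
by rewrite integral0 => /fine_cvg.
Unshelve. all: by end_near. Qed.

(** Approximation in mean that keeps the range [a, b]: truncating a continuous approximant to [a, b]
    does not increase its distance to [h], and Fejer means are averages against a probability
    density. The pointwise bounds are needed when the approximant is exponentiated. *)
Lemma trig_approx h (a b e : R) : bmeas h -> (forall x, a <= h x <= b) -> 0 < e ->
  exists2 p : {poly R[i]}, forall x, a <= complex.Re p.[zc x] <= b &
    mean (fun x => `|h x - complex.Re p.[zc x]|) < e.
Proof.
move=> bh hab e0.
have ab : a <= b by have /andP[] := hab 0; exact: le_trans.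
have e2 : 0 < e / 2 by rewrite divr_gt0.
have [g_ [cg_ ig_ g_cvg]] := @approximation_continuous_integrable R (circle R) h
  (@measurable_circle R) (eq_ind_r (fun t => (t < +oo)%E) (ltry 1) (measure_circle R))
  (bmeas_integrable bh).
have [g0 cg0 [ig0 hg0]] : exists2 g0 : R -> R, continuous g0 &
    mu.-integrable (circle R) (EFin \o g0) /\
    \int[mu]_(x in circle R) `|h x - g0 x| < e / 2.
  move/fine_cvg/cvgrPdist_lt: g_cvg => /(_ _ e2) [n _ /(_ n (leqnn n)) /=].
  rewrite sub0r normrN => hn; exists (g_ n) => //; split; first exact: ig_.
  by apply: le_lt_trans hn; rewrite ler_norm.
pose g x := Num.max a (Num.min b (g0 x)).
have gab x : a <= g x <= b by rewrite /g le_max lexx /= ge_max ab ge_min lexx.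
have hg x : `|h x - g x| <= `|h x - g0 x|.
  have /andP[ha hb] := hab x; rewrite /g.
  have n1 := ler_norm (h x - g0 x); have := ler_norm (g0 x - h x).
  rewrite distrC => n2; rewrite ler_norml.
  by case: (leP b (g0 x)) => h1; [case: (leP a b)|case: (leP a (g0 x))] => h2; apply/andP; split; lra.
have cg : continuous g.
  move=> x; apply: (@continuous_max _ _ (fun=> a) (fun x => Num.min b (g0 x))).
    exact: cst_continuous.
  by apply: (@continuous_min _ _ (fun=> b) g0); [exact: cst_continuous|exact: cg0].
have gM x : `|g x| <= `|a| + `|b|.
  have /andP[ga gb] := gab x; rewrite ler_norml.
  have := ler_norm a; have := ler_norm b; have := ler_norm (- a); have := ler_norm (- b).
  by rewrite !normrN => *; apply/andP; split; lra.
have bg : bmeas g.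
  split; last by exists (`|a| + `|b|).
  by apply: measurable_funTS; apply: continuous_measurable_fun.
have hge : mean (fun x => `|h x - g x|) < e / 2.
  apply: le_lt_trans hg0; apply: le_Rintegral => //.
  - exact: measurable_circle.
  - by apply/bmeas_integrable/bmeas_norm/bmeasB.
  - have : mu.-integrable (circle R) (EFin \o (fun x => h x - g0 x)).
      have -> : EFin \o (fun x => h x - g0 x) = ((EFin \o h) \- (EFin \o g0))%E by [].
      by apply: integrableB => //; [exact: measurable_circle|exact: bmeas_integrable].
    exact: integrable_norm.
have /cvgrPdist_lt /(_ _ e2) [n _ /(_ n (leqnn n)) /=] := fejer_cvg_L1 bg cg gM.
rewrite sub0r normrN => hn.
have [p hp] := re_trig_fejer n bg; exists p => [x|].
  rewrite -hp -/(fejer_mean n g x) fejer_mean_ge ?fejer_mean_le // => y;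
  by have /andP[] := gab y.
have bp : bmeas (fun x => complex.Re p.[zc x]) by have [] := cbmeas_horner p.
have bt : bmeas (fun x => `|g x - fejer_mean n g x|).
  apply/bmeas_norm/bmeasB => //; move: bp; congr bmeas; apply/funext => x.
  by rewrite -hp.
apply: le_lt_trans (_ : mean (fun x => `|h x - g x| + `|g x - fejer_mean n g x|) < e).
  apply: le_mean; first exact/bmeas_norm/bmeasB.
    by apply: bmeasD => //; exact/bmeas_norm/bmeasB.
  by move=> x _; rewrite -hp -/(fejer_mean n g x); apply: ler_distD.
rewrite meanD //; last exact/bmeas_norm/bmeasB.
by have := le_lt_trans (ler_norm _) hn; lra.
Qed.

End FejerApproximation.

(** * Szego's theorem *)

Section Szego.
Variable R : realType.
Notation mu := (@lebesgue_measure R).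
Implicit Types (x y : R) (f g h : R -> R) (p P H : {poly R[i]}).

Lemma bmeas_poly p : bmeas (fun x => nsq p.[zc x]).
Proof. exact/bmeas_nsq/cbmeas_horner. Qed.

Lemma bmeas_re_poly p : bmeas (fun x => complex.Re p.[zc x]).
Proof. by have [] := cbmeas_horner p. Qed.

(* With [P = (1 + H/(2m))^m] one has [|P|^2 = (1 + Re H/m + |H|^2/(4m^2))^m],
   which is at most [exp (Re H + |H|^2/(4m))]. *)
Lemma poly_le_expR H (e : R) : H`_0 = 0 -> 0 < e ->
  exists2 P : {poly R[i]}, P`_0 = 1 & forall x, nsq P.[zc x] <= expR (complex.Re H.[zc x] + e).
Proof.
move=> H0 e0; have [_ [K hK]] := bmeas_poly H.
have K0 : 0 <= K := le_trans (normr_ge0 _) (hK 0).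
have [m hm] : exists m : nat, K / (4 * e) <= m.+1%:R.
  exists (Num.bound (K / (4 * e))); apply: ltW.
  apply: lt_trans (_ : (Num.bound (K / (4 * e)))%:R < _); last by rewrite ltr_nat.
  by apply: archi_boundP; rewrite divr_ge0 // mulr_ge0 // ltW.
set M : R := m.+1%:R in hm; have M0 : 0 < M by rewrite ltr0n.
pose c : R[i] := ((2 * M)^-1)%:C%C.
exists ((1 + c *: H) ^+ m.+1) => [|x].
  by rewrite -horner_coef0 horner_exp hornerD hornerZ hornerC !horner_coef0 H0 mulr0 addr0 expr1n.
rewrite horner_exp hornerD hornerZ hornerC nsqX.
set u := H.[zc x]; have hu : nsq u <= K by rewrite (le_trans (ler_norm _) (hK x)).
have -> : nsq (1 + c * u) = 1 + (complex.Re u / M + nsq u / (4 * M ^+ 2)).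
  rewrite /nsq cReD cImD cReM cImM /c /=; set a := complex.Re u; set b := complex.Im u.
  by field; rewrite gt_eqF.
set s := _ + nsq u / _.
have s1 : 0 <= 1 + s.
  have -> : 1 + s = nsq (1 + c * u).
    rewrite /s /nsq cReD cImD cReM cImM /c /=; set a := complex.Re u; set b := complex.Im u.
    by field; rewrite gt_eqF.
  exact: nsq_ge0.
apply: le_trans (_ : expR s ^+ m.+1 <= _).
  by apply: lerXn2r; rewrite ?nnegrE ?expR_ge0 // expR_ge1Dx.
rewrite -expRM_natl ler_expR -/M /s mulrDr [M * (_ / M)]mulrC divfK ?gt_eqF // lerD2l.
have -> : M * (nsq u / (4 * M ^+ 2)) = nsq u / (4 * M) by field; rewrite gt_eqF.
rewrite ler_pdivrMr ?mulr_gt0 //; apply: le_trans hu _.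
by move: hm; rewrite ler_pdivrMr ?mulr_gt0 //; lra.
Qed.

Lemma mean_nsq_ge p : nsq p`_0 <= mean (fun x => nsq p.[zc x]).
Proof.
suff -> : mean (fun x => nsq p.[zc x]) = \sum_(i < size p) nsq p`_i.
  case: (size p) (nth_default 0 (s := p)) => [|n] h.
    by rewrite big_ord0 h // /nsq /= expr0n addr0.
  by rewrite big_ord_recl lerDl sumr_ge0 // => i _; apply: nsq_ge0.
apply: (@complexI R); rewrite -cmean_real rmorph_sum /=.
under eq_fun do rewrite nsqE.
by rewrite -{1 2}[p]coefK parseval_poly; apply: eq_bigr => i _; rewrite nsqE.
Qed.

(** Convexity: exp t - exp s <= exp t (t - s). *)
Lemma expR_sub_le (s t b : R) : t <= b -> expR t - expR s <= expR b * `|s - t|.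
Proof.
move=> tb; apply: le_trans (_ : expR t * (t - s) <= _).
  have := expR_ge1Dx (s - t).
  have -> : expR s = expR t * expR (s - t) by rewrite -expRD addrCA subrr addr0.
  by have := expR_gt0 t; nra.
apply: le_trans (_ : expR t * `|s - t| <= _).
  by rewrite ler_wpM2l ?expR_ge0 // distrC ler_norm.
by rewrite ler_wpM2r // ler_expR.
Qed.

Lemma mean_Re_horner p : mean (fun x => complex.Re p.[zc x]) = complex.Re p`_0.
Proof. by rewrite -cmean_horner. Qed.

Lemma mean_dist_le h g (e : R) : bmeas h -> bmeas g -> mean (fun x => `|h x - g x|) < e ->
  `|mean h - mean g| <= e.
Proof.
move=> bh bg he; rewrite -meanB // ltW //; apply: le_lt_trans he.
apply: le_normr_Rintegral; first exact: measurable_circle.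
exact/bmeas_integrable/bmeasB.
Qed.

Lemma bmeas_ln F (a : R) : bmeas F -> 0 < a -> (forall x, a <= F x <= 1) ->
  bmeas (fun x => ln (F x)).
Proof.
move=> [mF _] a0 haF; apply: (@bmeas_comp _ (@ln R) F (- ln a)) => //.
move=> x; have /andP[aF F1] := haF x; rewrite ler0_norm ?ln_le0 //.
by rewrite lerN2 ler_ln ?posrE // (lt_le_trans a0).
Qed.

Section Regularised.
Variables (F : R -> R) (a : R).
Hypotheses (bF : bmeas F) (a0 : 0 < a) (aF : forall x, a <= F x <= 1).

Let F0 x : 0 < F x. Proof. by have /andP[+ _] := aF x; apply: lt_le_trans. Qed.
Let lnF x : ln a <= ln (F x) <= 0.
Proof. by have /andP[? F1] := aF x; rewrite ln_le0 // andbT ler_ln ?posrE ?F0. Qed.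

(* Multiply [p] by a polynomial [P] with constant term 1 and [|P|^2] at most about
   [F / expR (mean (ln F))], then apply [mean_nsq_ge] to the product. *)
Lemma szego_lower p :
  nsq p`_0 * expR (mean (fun x => ln (F x))) <= mean (fun x => nsq p.[zc x] * F x).
Proof.
have bl := bmeas_ln bF a0 aF.
have [_ [S hS]] := bmeas_poly p.
have S0 : 0 <= S := le_trans (normr_ge0 _) (hS 0).
set X := nsq p`_0 * _; set Y := mean _.
(* The factor 1 - 2 e collects one [e] from [poly_le_expR] and one from replacing the mean of ln F
   by that of its approximant; S e is the cost of replacing F by the exponential of the
   approximant. *)
suff key e : 0 < e -> X * (1 - 2 * e) <= Y + S * e.
  have X0 : 0 <= X by rewrite mulr_ge0 ?nsq_ge0 ?expR_ge0.
  rewrite leNgt; apply/negP => YX.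
  have d0 : 0 < X - Y by rewrite subr_gt0.
  pose e := (X - Y) / (2 * (2 * X + S + 1)).
  have De : 0 < 2 * (2 * X + S + 1) by lra.
  have e0 : 0 < e by rewrite divr_gt0.
  have he : e * (2 * X + S + 1) = (X - Y) / 2 by rewrite /e; field; rewrite gt_eqF //; lra.
  by have := key e e0; nra.
move=> e0; have [A hA Ae] := trig_approx bl lnF e0.
set t := fun x => complex.Re A.[zc x] in hA Ae.
have bt : bmeas t := bmeas_re_poly A.
have mt : mean t = complex.Re A`_0 := mean_Re_horner A.
have [|P P0 hP] := @poly_le_expR (A - (A`_0)%:P) e _ e0.
  by rewrite coefB coefC subrr.
have hPt x : nsq P.[zc x] <= expR (t x - mean t + e).
  by apply: le_trans (hP x) _; rewrite hornerD hornerN hornerC cReD cReN mt.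
have h1 : nsq p`_0 <= mean (fun x => nsq p.[zc x] * expR (t x)) * expR (e - mean t).
  have -> : nsq p`_0 = nsq (p * P)`_0.
    by rewrite coefM big_ord1 subn0 P0 mulr1.
  apply: le_trans (mean_nsq_ge _) _.
  rewrite [leRHS]mulrC -meanZ; last by apply: bmeasM; [exact: bmeas_poly|exact: bmeas_expR].
  apply: le_mean; first exact: bmeas_poly.
    by apply: bmeasZ; apply: bmeasM; [exact: bmeas_poly|exact: bmeas_expR].
  move=> x _; rewrite hornerM nsqM mulrCA ler_wpM2l ?nsq_ge0 // -expRD.
  by apply: le_trans (hPt x) _; rewrite ler_expR; lra.
have h2 : mean (fun x => nsq p.[zc x] * expR (t x)) <= Y + S * e.
  apply: le_trans (_ : mean (fun x => nsq p.[zc x] * F x + S * `|ln (F x) - t x|) <= _).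
    apply: le_mean; first by apply: bmeasM; [exact: bmeas_poly|exact: bmeas_expR].
      apply: bmeasD; first by apply: bmeasM => //; exact: bmeas_poly.
      by apply/bmeasZ/bmeas_norm/bmeasB.
    move=> x _; have nS : nsq p.[zc x] <= S by rewrite (le_trans (ler_norm _) (hS x)).
    have /andP[_ t0] := hA x.
    have := expR_sub_le (ln (F x)) t0; rewrite expR0 mul1r lnK ?posrE ?F0 // => hh.
    have := nsq_ge0 p.[zc x]; have := normr_ge0 (ln (F x) - t x); nra.
  rewrite meanD; [|by apply: bmeasM => //; exact: bmeas_poly|by apply/bmeasZ/bmeas_norm/bmeasB].
  rewrite meanZ; last by apply/bmeas_norm/bmeasB.
  by rewrite lerD2l ler_wpM2l // ltW.
have h3 := mean_dist_le bl bt Ae.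
have h4 : X * expR (- 2 * e) <= mean (fun x => nsq p.[zc x] * expR (t x)).
  apply: le_trans (_ : nsq p`_0 * expR (mean t - e) <= _).
    rewrite /X -mulrA -expRD ler_wpM2l ?nsq_ge0 // ler_expR.
    by move: h3; rewrite ler_norml => /andP[_]; lra.
  apply: le_trans (ler_wpM2r (expR_ge0 _) h1) _.
  by rewrite -mulrA -expRD addrC subrKA subrr expR0 mulr1.
apply: le_trans (le_trans h4 h2).
rewrite ler_wpM2l ?mulr_ge0 ?nsq_ge0 ?expR_ge0 //.
by have := expR_ge1Dx (- 2 * e); lra.
Qed.

(** Here |P|^2 is at most exp (mean t - t + 1) with t close to ln F. The constant 2 exp 2 is
    harmless, as the bound is only used with a geometric mean tending to 0. *)
Lemma szego_upper : exists2 P : {poly R[i]}, P`_0 = 1 &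
  mean (fun x => nsq P.[zc x] * F x) <= 2 * expR 2 * expR (mean (fun x => ln (F x))).
Proof.
have bl := bmeas_ln bF a0 aF.
have a1 : a <= 1 by have /andP[+ +] := aF 0; apply: le_trans.
(* The precision is [a] itself: exp (ln F - t) - 1 is at most |ln F - t| / a, so the mean of exp (ln
   F - t) is at most 2. *)
have [A hA Ae] := trig_approx bl lnF a0.
set t := fun x => complex.Re A.[zc x] in hA Ae.
have bt : bmeas t := bmeas_re_poly A.
have mt : mean t = complex.Re A`_0 := mean_Re_horner A.
have [|P P0 hP] := @poly_le_expR ((A`_0)%:P - A) 1 _ ltr01.
  by rewrite coefB coefC subrr.
exists P => //.
have h1 : mean (fun x => nsq P.[zc x] * F x) <=
    expR (mean t + 1) * mean (fun x => expR (ln (F x) - t x)).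
  have bexp : bmeas (fun x => expR (ln (F x) - t x)) by apply/bmeas_expR/bmeasB.
  rewrite -meanZ //; apply: le_mean; first by apply: bmeasM => //; exact: bmeas_poly.
    exact: bmeasZ.
  move=> x _; apply: le_trans (ler_wpM2r (ltW (F0 x)) (hP x)) _.
  rewrite -{1}[F x]lnK ?posrE // -!expRD ler_expR.
  by rewrite hornerD hornerN hornerC cReD cReN mt /t; lra.
have h2 : mean (fun x => expR (ln (F x) - t x)) <= 2.
  apply: le_trans (_ : mean (fun x => 1 + a^-1 * `|ln (F x) - t x|) <= _).
    apply: le_mean; first exact/bmeas_expR/bmeasB.
      by apply: bmeasD; [exact: bmeas_cst|apply/bmeasZ/bmeas_norm/bmeasB].
    move=> x _; have /andP[ta _] := hA x; have /andP[_ l0] := lnF x.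
    have le1 : ln (F x) - t x <= - ln a by lra.
    have := expR_sub_le 0 le1; rewrite expR0 expRN lnK ?posrE // sub0r normrN.
    by rewrite lerBlDl.
  rewrite meanD ?mean_cst; [|exact: bmeas_cst|by apply/bmeasZ/bmeas_norm/bmeasB].
  rewrite meanZ; last by apply/bmeas_norm/bmeasB.
  suff : a^-1 * mean (fun x => `|ln (F x) - t x|) <= 1 by lra.
  by rewrite mulrC ler_pdivrMr // mul1r ltW.
have h3 := mean_dist_le bl bt Ae.
apply: le_trans h1 _; apply: le_trans (ler_wpM2l (expR_ge0 _) h2) _.
rewrite mulrC -mulrA ler_wpM2l // -expRD ler_expR.
by move: h3; rewrite ler_norml => /andP[+ _]; lra.
Qed.

End Regularised.

End Szego.

(** * Szego's bounds for a density with zeros, by truncation from below *)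

Section GeometricMean.
Variable R : realType.
Notation mu := (@lebesgue_measure R).
Variable f : R -> R.
Hypotheses (mf : measurable_fun [set: R] f) (f01 : forall x, 0 <= f x <= 1).

Definition cut (a : R) x := Num.max (f x) a.

Lemma bmeas_density : bmeas f.
Proof.
split; first exact: measurable_funTS.
by exists 1 => x; have /andP[f0 f1] := f01 x; rewrite ger0_norm.
Qed.

Lemma bmeas_cut a : bmeas (cut a).
Proof.
split; last first.
  exists (1 + `|a|) => x; have /andP[f0 f1] := f01 x; rewrite /cut.
  have := normr_ge0 a; case: (leP (f x) a) => h an; first by rewrite lerDr.
  by rewrite ger0_norm //; lra.
apply: measurable_maxr; first exact: measurable_funTS.
exact: measurable_cst.
Qed.

Lemma cut_itv a x : a <= 1 -> a <= cut a x <= 1.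
Proof.
by move=> a1; have /andP[f0 f1] := f01 x; rewrite /cut le_max lexx orbT /= ge_max f1.
Qed.

Lemma cut_le a x : 0 < a -> f x <= cut a x <= f x + a.
Proof.
move=> a0; have /andP[f0 f1] := f01 x; rewrite /cut le_max lexx /= ge_max.
by apply/andP; split; lra.
Qed.

(** The cutoff exp (-n) gives the value n at a zero of f, and the sequence increases to -ln f, as
    monotone convergence requires. *)
Definition neglog n x : \bar R := (- ln (cut (expR (- n%:R)) x))%:E.

Lemma expRN_le1 n : expR (- n%:R) <= 1 :> R.
Proof. by rewrite -expR0 ler_expR oppr_le0. Qed.

Lemma bmeas_lncut n : bmeas (fun x => ln (cut (expR (- n%:R)) x)).
Proof.
by apply: (bmeas_ln (bmeas_cut _) (expR_gt0 (- n%:R))) => x; apply: cut_itv; exact: expRN_le1.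
Qed.

Lemma neglog_cvg x : neglog n x @[n --> \oo] --> (- lne (f x)%:E)%E.
Proof.
have /andP[f0 f1] := f01 x.
have [fx0|fx0] := eqVneq (f x) 0.
  rewrite fx0 /lne lexx /=.
  have -> : (fun n => neglog n x) = (fun n => (n%:R)%:E).
    apply/funext => n; rewrite /neglog /cut fx0 max_r ?expR_ge0 // expRK opprK //.
  by apply/cvgeryP/cvgryPge => A; exact: nbhs_infty_ger.
have fpos : 0 < f x by rewrite lt_neqAle eq_sym fx0.
rewrite lne_EFin //; apply: cvg_near_cst.
near=> n; rewrite /neglog /cut max_l //.
rewrite -[leRHS]lnK ?posrE // ler_expR lerNl.
by near: n; exact: nbhs_infty_ger.
Unshelve. all: by end_near. Qed.

Lemma neglog_ge0 n x : (0 <= neglog n x)%E.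
Proof.
rewrite lee_fin oppr_ge0 ln_le0 //.
by have /andP[] := cut_itv x (expRN_le1 n).
Qed.

Lemma measurable_neglog n : measurable_fun (circle R) (neglog n).
Proof. by apply/measurable_EFinP; have [] := bmeasN (bmeas_lncut n). Qed.

Lemma neg_lne_ge0 x : (0 <= - lne (f x)%:E)%E.
Proof. by have /andP[_ f1] := f01 x; rewrite oppe_ge0 lne_le0 lee_fin. Qed.

Lemma measurable_neg_lne : measurable_fun (circle R) (fun x => - lne (f x)%:E)%E.
Proof.
apply: (@emeasurable_fun_cvg _ _ _ (circle R) neglog); first exact: measurable_neglog.
by move=> x _; apply: neglog_cvg.
Qed.

Lemma integral_lne :
  (\int[mu]_(x in circle R) lne (f x)%:E = - \int[mu]_(x in circle R) (- lne (f x)%:E))%E.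
Proof.
rewrite -integral_ge0N; last by move=> x _; exact: neg_lne_ge0.
by apply: eq_integral => x _; rewrite oppeK.
Qed.

Lemma integral_ln_cut a : 0 < a <= 1 ->
  (\int[mu]_(x in circle R) (- ln (cut a x))%:E = (- mean (fun x => ln (cut a x)))%:E)%E.
Proof.
move=> /andP[a0 a1].
have bl : bmeas (fun x => ln (cut a x)).
  by apply: (bmeas_ln (bmeas_cut _) a0) => x; apply: cut_itv.
rewrite -meanN // /mean /Rintegral fineK //.
apply: integrable_fin_num; first exact: measurable_circle.
exact/bmeas_integrable/bmeasN.
Qed.

Lemma GM_le_cut a : 0 < a <= 1 -> (GM f <= (expR (mean (fun x => ln (cut a x))))%:E)%E.
Proof.
move=> /andP[a0 a1].
rewrite -[leRHS]/(expeR (mean (fun x => ln (cut a x)))%:E) lee_expeR integral_lne.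
rewrite leeNl -EFinN -integral_ln_cut ?a0 //.
apply: ge0_le_integral.
- exact: measurable_circle.
- move=> x _; rewrite lee_fin oppr_ge0 ln_le0 //.
  by have /andP[] := cut_itv x a1.
- apply/measurable_EFinP.
  suff : bmeas (fun x => - ln (cut a x)) by case.
  by apply/bmeasN/(bmeas_ln (bmeas_cut _) a0) => x; apply: cut_itv.
- exact: measurable_neg_lne.
- move=> x _; have /andP[f0 f1] := f01 x.
  rewrite leeNr -EFinN opprK.
  have [fx0|fx0] := eqVneq (f x) 0; first by rewrite fx0 /lne lexx leNye.
  have fpos : 0 < f x by rewrite lt_neqAle eq_sym fx0.
  have /andP[fc _] := cut_le x a0.
  by rewrite lne_EFin // lee_fin ler_ln ?posrE // (lt_le_trans fpos).
Qed.

Lemma GM_eq0_cut (A : R) : GM f = 0%E ->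
  exists2 a, 0 < a <= 1 & mean (fun x => ln (cut a x)) <= - A.
Proof.
move/eqP; rewrite /GM expeR_eq0 integral_lne eqe_oppLR => /eqP intE.
have cvgI : (\int[mu]_(x in circle R) neglog n x)%E @[n --> \oo] --> +oo%E.
  have -> : +oo%E = (\int[mu]_(x in circle R) limn (neglog^~ x))%E.
    rewrite -[LHS]intE; apply: eq_integral => x _; apply/esym/cvg_lim => //.
    exact: neglog_cvg.
  apply: cvg_monotone_convergence.
  - exact: measurable_circle.
  - exact: measurable_neglog.
  - by move=> n x _; exact: neglog_ge0.
  - move=> x _ m n mn; rewrite lee_fin lerN2 ler_ln ?posrE; last 2 first.
    + by rewrite /cut lt_max expR_gt0 orbT.
    + by rewrite /cut lt_max expR_gt0 orbT.
    by rewrite /cut ge_max !le_max lexx /= ler_expR lerN2 ler_nat mn orbT.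
move/cvgeyPge : cvgI => /(_ A) [n _ /(_ n (leqnn n)) /=].
have en : 0 < expR (- n%:R : R) <= 1 by rewrite expR_gt0 expRN_le1.
rewrite /neglog integral_ln_cut // lee_fin => hA.
by exists (expR (- n%:R)) => //; rewrite lerNr.
Qed.

Definition form_at (p : {poly R[i]}) : R := mean (fun x => nsq p.[zc x] * f x).

Lemma GM_lower (p : {poly R[i]}) : (GM f * (nsq p`_0)%:E <= (form_at p)%:E)%E.
Proof.
have [g gE] : exists g : R, GM f = g%:E.
  have := GM_le_cut (a := 1); rewrite ltr01 lexx => /(_ isT).
  have := expeR_ge0 (\int[mu]_(x in circle R) lne (f x)%:E); rewrite -/(GM f).
  by case: (GM f) => // r; exists r.
rewrite gE -EFinM lee_fin mulrC; apply/ler_addgt0Pr => e e0.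
have [_ [S hS]] := bmeas_poly p.
have S0 : 0 <= S := le_trans (normr_ge0 _) (hS 0).
(* With this cutoff, replacing f by [cut a] changes the weighted integral by at most a S <= e. *)
pose a := Num.min 1 (e / (S + 1)).
have S1 : 0 < S + 1 by rewrite ltr_wpDl.
have a01 : 0 < a <= 1 by rewrite /a lt_min ltr01 divr_gt0 //= ge_min lexx.
have aS : a * S <= e.
  apply: le_trans (_ : a * (S + 1) <= _).
    by rewrite ler_wpM2l ?lerDl //; case/andP: a01 => /ltW.
  by rewrite -ler_pdivlMr // /a ge_min lexx orbT.
have /andP[a0 a1] := a01.
have := GM_le_cut a01; rewrite gE lee_fin => hg.
apply: le_trans (_ : nsq p`_0 * expR (mean (fun x => ln (cut a x))) <= _).
  by rewrite ler_wpM2l ?nsq_ge0.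
apply: le_trans (szego_lower (bmeas_cut a) a0 (fun x => cut_itv x a1) p) _.
apply: le_trans (_ : mean (fun x => nsq p.[zc x] * f x + a * S) <= _).
  apply: le_mean.
  - by apply: bmeasM; [exact: bmeas_poly|exact: bmeas_cut].
  - apply: bmeasD; last exact: bmeas_cst.
    by apply: bmeasM; [exact: bmeas_poly|exact: bmeas_density].
  - move=> x _; have /andP[_ cx] := cut_le x a0.
    have nS : nsq p.[zc x] <= S by rewrite (le_trans (ler_norm _) (hS x)).
    by have := nsq_ge0 p.[zc x]; nra.
rewrite meanD ?mean_cst; [by rewrite lerD2l| |exact: bmeas_cst].
by apply: bmeasM; [exact: bmeas_poly|exact: bmeas_density].
Qed.

Lemma GM_eq0_approx (e : R) : GM f = 0%E -> 0 < e ->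
  exists2 P : {poly R[i]}, P`_0 = 1 & form_at P <= e.
Proof.
move=> g0 e0.
(* The threshold makes the bound 2 exp 2 times the geometric mean of [cut a] at most [e]. *)
have [a /andP[a0 a1] ha] := GM_eq0_cut (- ln (e / (2 * expR 2))) g0.
have [P P0 hP] := szego_upper (bmeas_cut a) a0 (fun x => cut_itv x a1).
exists P => //; apply: le_trans (_ : mean (fun x => nsq P.[zc x] * cut a x) <= _).
  apply: le_mean.
  - by apply: bmeasM; [exact: bmeas_poly|exact: bmeas_density].
  - by apply: bmeasM; [exact: bmeas_poly|exact: bmeas_cut].
  - by move=> x _; rewrite ler_wpM2l ?nsq_ge0 //; have /andP[] := cut_le x a0.
apply: le_trans hP _; have E2 : 0 < 2 * expR 2 :> R by rewrite mulr_gt0 ?expR_gt0.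
rewrite opprK -ler_expR lnK ?posrE ?divr_gt0 // in ha.
by move: ha; rewrite ler_pdivlMr // mulrC.
Qed.

End GeometricMean.

(** * The form of L^2(f) on characters *)

Section ZeroSet.
Variable R : realType.
Notation mu := (@lebesgue_measure R).

Lemma cos_2pi_lt1 (d : R) : 0 < d <= 2^-1 -> cos (2 * pi * d) < 1.
Proof.
move=> /andP[d0 d1]; have hp := pi_gt0 R.
have h2 : 0 <= 2 * pi * d <= pi by nra.
have h3 : 0 < 2 * pi * d by rewrite !mulr_gt0.
by rewrite -[ltRHS](@cos0 R) ltr_cos ?in_itv /= ?h2 ?lexx ?(ltW hp).
Qed.

Lemma zc_inj : {in circle R &, injective (@zc R)}.
Proof.
move=> x y; rewrite !inE /circle /= !in_itv /= => /andP[x0 x1] /andP[y0 y1] xy.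
apply/eqP/negPn/negP => nxy.
have s0 : 0 < `|x - y| by rewrite normr_gt0 subr_eq0.
have s1 : `|x - y| < 1 by rewrite ltr_norml; apply/andP; split; lra.
have : nsq (zc x - zc y) = 0 by rewrite xy subrr /nsq /= expr0n addr0.
rewrite nsqB_zc.
have -> : cos (2 * pi * (x - y)) = cos (2 * pi * `|x - y|).
  by case: (ger0P (x - y)) => // _; rewrite mulrN cosN.
set s := `|x - y| in s0 s1 *; pose d := Num.min s (1 - s).
have d0 : 0 < d by rewrite /d lt_min s0 subr_gt0.
have d1 : d <= s <= 1 - d by rewrite /d; case: (leP s (1 - s)) => ?; lra.
have := cos_2pi_le d0 d1.
have : cos (2 * pi * d) < 1 by apply: cos_2pi_lt1; lra.
by lra.
Qed.

Lemma zeros_null (p : {poly R[i]}) : p != 0 ->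
  {ae mu, forall x : R, circle R x -> p.[zc x] != 0}.
Proof.
move=> p0; have [r pr] := closed_field_poly_normal p.
(* The value [None] outside one period makes the map injective on the preimage of the roots, which
   is therefore finite. *)
pose g x := if x \in circle R then Some (zc x) else None.
have fin : finite_set (g @^-1` (Some @` [set` r])).
  apply: finite_preimage; last exact/finite_image/finite_seq.
  move=> x y; rewrite !inE /g /= => -[z _]; case: ifPn => // Ix _ [z' _].
  by case: ifPn => // Iy _ /(congr1 (odflt 0)) /= /zc_inj; apply.
exists (g @^-1` (Some @` [set` r])); split.
- by apply: closed_measurable; apply: compact_closed => //; exact: finite_compact.
- exact/countable_lebesgue_measure0/finite_set_countable.
move=> x /= /not_implyP[Ix /negP/negPn px].
rewrite /g /= mem_set //; exists (zc x) => //=.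
move: px; rewrite pr hornerZ mulf_eq0 lead_coef_eq0 (negPf p0) /=.
rewrite horner_prod prodf_seq_eq0 => /hasP[z zr]; rewrite hornerXsubC subr_eq0.
by move=> /eqP ->.
Qed.

End ZeroSet.

Section DensityForm.
Variable R : realType.
Notation mu := (@lebesgue_measure R).
Variable f : R -> R.
Hypotheses (mf : measurable_fun [set: R] f) (f01 : forall x, 0 <= f x <= 1).

Let bf := bmeas_density mf f01.
Let f0 x : 0 <= f x. Proof. by case/andP: (f01 x). Qed.

Lemma form_at_ge0 p : 0 <= form_at f p.
Proof. by apply: mean_ge0 => x; rewrite mulr_ge0 ?nsq_ge0. Qed.

Lemma form_at_gt0 p : ~ (f = cst 0 %[ae mu in circle R]) -> p != 0 -> 0 < form_at f p.
Proof.
move=> fn0 p0; rewrite lt_neqAle form_at_ge0 andbT eq_sym; apply/negP => /eqP e0.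
apply: fn0.
have bpf : bmeas (fun x => nsq p.[zc x] * f x).
  by apply: bmeasM => //; exact: bmeas_poly.
have : ae_eq mu (circle R) (fun x => (nsq p.[zc x] * f x)%:E) (cst 0%E).
  apply/ae_eq_integral_abs; first exact: measurable_circle.
    by apply/measurable_EFinP; have [] := bpf.
  transitivity (\int[mu]_(x in circle R) (nsq p.[zc x] * f x)%:E)%E.
    apply: eq_integral => x _; rewrite /= ger0_norm // mulr_ge0 ?nsq_ge0 //.
  rewrite -[LHS]fineK; first by rewrite -[X in X%:E]/(form_at f p) e0.
  apply: integrable_fin_num; first exact: measurable_circle.
  exact: bmeas_integrable.
move=> ae1; apply: filterS2 ae1 (zeros_null p0) => x h1 h2 Ix.
have [] := h1 Ix => /eqP; rewrite mulf_eq0 => /orP[|/eqP //].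
rewrite /nsq paddr_eq0 ?sqr_ge0 // !sqrf_eq0 => /andP[/eqP r0 /eqP i0].
by move/eqP: (h2 Ix); case; apply: complex_eq.
Qed.

Definition sform (p q : {poly R[i]}) : R[i] :=
  cmean (fun x => p.[zc x] * (q.[zc x])^* * (f x)%:C%C).

Lemma cbmeas_sform (p q : {poly R[i]}) : cbmeas (fun x => p.[zc x] * (q.[zc x])^* * (f x)%:C%C).
Proof.
apply: cbmeasM; last exact: cbmeas_real.
by apply: cbmeasM; [|apply: cbmeasJ]; apply: cbmeas_horner.
Qed.

Lemma sformDl a p q r : sform (a *: p + q) r = a * sform p r + sform q r.
Proof.
have bp := cbmeas_sform p r.
transitivity (cmean (fun x => a * (p.[zc x] * (r.[zc x])^* * (f x)%:C%C) +
    q.[zc x] * (r.[zc x])^* * (f x)%:C%C)).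
  by congr cmean; apply/funext => x; rewrite hornerD hornerZ; ring.
rewrite cmeanD; [by rewrite cmeanZ| |exact: cbmeas_sform].
by apply: cbmeasM => //; exact: cbmeas_cst.
Qed.

Lemma sformC p q : sform q p = (sform p q)^*.
Proof.
rewrite /sform -cmeanJ; last exact: cbmeas_sform.
congr cmean; apply/funext => x.
have fr : ((f x)%:C%C : R[i])^* = (f x)%:C%C by exact: conjc_real.
by rewrite !rmorphM /= conjCK fr; ring.
Qed.

Lemma sform_at p : sform p p = (form_at f p)%:C%C.
Proof.
rewrite /form_at -cmean_real; congr cmean; apply/funext => x.
by rewrite rmorphM /= nsqE.
Qed.

Lemma sform_shift p q : sform ('X * p) ('X * q) = sform p q.
Proof.
congr cmean; apply/funext => x; rewrite !hornerM hornerX rmorphM /=.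
by rewrite mulrACA zc_unit mul1r.
Qed.

Lemma sform_contract n (c : nat -> R[i]) :
  sform (\poly_(i < n) c i) (\poly_(i < n) c i) <= \sum_(i < n) `|c i| ^+ 2.
Proof.
have -> : \sum_(i < n) `|c i| ^+ 2 =
    (mean (fun x => nsq (\poly_(i < n) c i).[zc x]))%:C%C.
  rewrite -cmean_real; under [in RHS]eq_fun do rewrite nsqE.
  by rewrite parseval_poly; apply: eq_bigr => i _; rewrite normCK.
rewrite sform_at lecR; apply: le_mean; [|exact: bmeas_poly|].
  by apply: bmeasM => //; exact: bmeas_poly.
by move=> x _; rewrite ler_piMr ?nsq_ge0 //; case/andP: (f01 x).
Qed.

End DensityForm.

Section FourierKernel.
Variable R : realType.
Notation mu := (@lebesgue_measure R).

Definition ec (k : int) (x : R) : R[i] := expi (2 * pi * k%:~R * x).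

Definition fkernel (f : R -> R) (i j : int) : R[i] := fourier f (j - i).

Lemma cbmeas_ec k : cbmeas (ec k).
Proof. exact: cbmeas_expi. Qed.

Lemma ecD k l x : ec (k + l) x = ec k x * ec l x.
Proof. by rewrite /ec -expiD intrD; congr expi; ring. Qed.

Lemma ec_nat (n : nat) x : ec n x = zc x ^+ n.
Proof. by rewrite /ec expi_zc. Qed.

Lemma fkernelE f i j :
  fkernel f i j = cmean (fun x => ec i x * (ec j x)^* * (f x)%:C%C).
Proof.
congr cmean; apply/funext => x; rewrite mulrC; congr (_ * _).
by rewrite /ec -expiN -expiD intrB; congr expi; ring.
Qed.

(** Sites may be negative, so they are shifted by [m]. On the circle this multiplies the sum by a
    unimodular factor and changes no norm or inner product in L^2(f). *)
Definition site_poly (s : seq int) (c : int -> R[i]) (m : int) : {poly R[i]} :=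
  \sum_(i <- s) c i *: 'X^(absz (i + m)).

Definition trig_sum (s : seq int) (c : int -> R[i]) x := \sum_(i <- s) c i * ec i x.

Lemma site_poly_horner s c m x : {in s, forall i, 0 <= i + m} ->
  (site_poly s c m).[zc x] = ec m x * trig_sum s c x.
Proof.
move=> sm; rewrite /site_poly horner_sum /trig_sum mulr_sumr !big_seq.
apply: eq_bigr => i si; rewrite hornerZ hornerXn -ec_nat gez0_abs ?sm // ecD; ring.
Qed.

Lemma ec_unit k x : ec k x * (ec k x)^* = 1.
Proof. exact: expi_unit. Qed.

Lemma coef_site_poly s c m i : uniq s -> {in s, forall i, 0 <= i + m} -> i \in s ->
  (site_poly s c m)`_(absz (i + m)) = c i.
Proof.
move=> us sm si; rewrite /site_poly coef_sum (bigD1_seq i) //=.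
rewrite coefZ coefXn eqxx mulr1 big1_seq ?addr0 // => j /andP[ji sj].
rewrite coefZ coefXn; case: eqP => [e|]; last by rewrite mulr0.
have : (i + m = j + m)%R by rewrite -(gez0_abs (sm _ si)) -(gez0_abs (sm _ sj)) e.
by move/addIr => ij; rewrite ij eqxx in ji.
Qed.

Lemma exists_shift (s : seq int) : exists m : nat, {in s, forall i : int, 0 <= i + m%:Z}.
Proof.
exists (\sum_(i <- s) absz i)%N => i si.
have : (absz i <= \sum_(j <- s) absz j)%N by rewrite (big_rem i) //= leq_addr.
lia.
Qed.

Section Density.
Variable f : R -> R.
Hypotheses (mf : measurable_fun [set: R] f) (f01 : forall x, 0 <= f x <= 1).

Let bf := bmeas_density mf f01.

Lemma hermitian_fkernel : hermitian_kernel (fkernel f).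
Proof.
move=> i j; rewrite !fkernelE -cmeanJ; last first.
  apply: cbmeasM; last exact: cbmeas_real.
  by apply: cbmeasM; [|apply: cbmeasJ]; apply: cbmeas_ec.
congr cmean; apply/funext => x.
have fr : ((f x)%:C%C : R[i])^* = (f x)%:C%C by exact: conjc_real.
by rewrite !rmorphM /= conjCK fr; ring.
Qed.

Lemma qform_fkernel s c m : {in s, forall i, 0 <= i + m} ->
  qform s (fkernel f) c = (form_at f (site_poly s c m))%:C%C.
Proof.
move=> sm; rewrite -sform_at /sform.
transitivity (cmean (fun x => \sum_(i <- s) \sum_(j <- s)
    (c i * (c j)^*) * (ec i x * (ec j x)^* * (f x)%:C%C))); last first.
  congr cmean; apply/funext => x; rewrite site_poly_horner // rmorphM /=.
  rewrite mulrACA ec_unit mul1r /trig_sum rmorph_sum mulr_suml mulr_suml.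
  apply: eq_bigr => i _; rewrite mulr_sumr mulr_suml; apply: eq_bigr => j _.
  by rewrite rmorphM /=; ring.
have bij i j : cbmeas (fun x => ec i x * (ec j x)^* * (f x)%:C%C).
  apply: cbmeasM; last exact: cbmeas_real.
  by apply: cbmeasM; [|apply: cbmeasJ]; apply: cbmeas_ec.
have bcij i j : cbmeas (fun x => c i * (c j)^* * (ec i x * (ec j x)^* * (f x)%:C%C)).
  by apply: cbmeasM => //; exact: cbmeas_cst.
rewrite cmean_sum => [|i]; last exact: cbmeas_sum.
apply: eq_bigr => i _; rewrite cmean_sum //; apply: eq_bigr => j _.
by rewrite cmeanZ // fkernelE.
Qed.

Lemma cross_fkernel s c m b : {in s, forall i, 0 <= i + m} -> 0 <= b + m ->
  cross s (fkernel f) c b = sform f (site_poly s c m) 'X^(absz (b + m)).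
Proof.
move=> sm bm; rewrite /sform /cross.
transitivity (cmean (fun x => \sum_(i <- s) c i * (ec i x * (ec b x)^* * (f x)%:C%C))).
  have bij i : cbmeas (fun x => ec i x * (ec b x)^* * (f x)%:C%C).
    apply: cbmeasM; last exact: cbmeas_real.
    by apply: cbmeasM; [|apply: cbmeasJ]; apply: cbmeas_ec.
  rewrite cmean_sum => [|i]; last by apply: cbmeasM => //; exact: cbmeas_cst.
  by apply: eq_bigr => i _; rewrite cmeanZ // fkernelE.
congr cmean; apply/funext => x; rewrite site_poly_horner // hornerXn -ec_nat gez0_abs //.
rewrite ecD rmorphM /= [(ec b x)^* * _]mulrC mulrACA ec_unit mul1r /trig_sum !mulr_suml.
by apply: eq_bigr => i _; ring.
Qed.

Lemma posdef_fkernel : ~ (f = cst 0 %[ae mu in circle R]) -> posdef (fkernel f).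
Proof.
move=> fn0 s c us /hasP[i si ci]; have [m sm] := exists_shift s.
rewrite (qform_fkernel c sm) ltcR; apply: form_at_gt0 => //.
apply/eqP => P0; move: ci; rewrite -(coef_site_poly c us sm si) P0 coef0.
by rewrite eqxx.
Qed.

(** By orthogonality of characters the identity matrix is the kernel of the density 1. *)
Lemma cmplk_fkernel i j : cmplk (fkernel f) i j = fkernel (fun x => 1 - f x) i j.
Proof.
have bij : cbmeas (fun x => ec i x * (ec j x)^*).
  by apply: cbmeasM; [|apply: cbmeasJ]; apply: cbmeas_ec.
have -> : fkernel (fun x => 1 - f x) i j =
    cmean (fun x => ec i x * (ec j x)^*) + cmean (fun x => -1 * (ec i x * (ec j x)^* * (f x)%:C%C)).
  rewrite fkernelE -cmeanD //; last first.
    by apply: cbmeasM; [exact: cbmeas_cst|apply: cbmeasM => //; exact: cbmeas_real].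
  by congr cmean; apply/funext => x; rewrite rmorphB /= rmorph1; ring.
rewrite cmeanZ; last by apply: cbmeasM => //; exact: cbmeas_real.
rewrite -fkernelE mulN1r /cmplk; congr (_ - _).
have [m sm] := exists_shift [:: i; j].
have hi := sm i (mem_head _ _); have hj : 0 <= j + m%:Z by apply: sm; rewrite !inE eqxx orbT.
have -> : (fun x => ec i x * (ec j x)^*) =
    (fun x => zc x ^+ absz (i + m%:Z) * (zc x ^+ absz (j + m%:Z))^*).
  apply/funext => x; rewrite -!ec_nat !gez0_abs // !ecD rmorphM /= mulrACA ec_unit mulr1 //.
rewrite cmean_characters; congr (_%:R); congr (nat_of_bool _); lia.
Qed.

End Density.

End FourierKernel.

Section RemotePast.
Variable R : realType.
Notation mu := (@lebesgue_measure R).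
Variable f : R -> R.
Hypotheses (mf : measurable_fun [set: R] f) (f01 : forall x, 0 <= f x <= 1).
Hypothesis fn0 : ~ (f = cst 0 %[ae mu in circle R]).

Let bf := bmeas_density mf f01.

Let sform_gt0 p : p != 0 -> 0 < sform f p p.
Proof. by move=> p0; rewrite sform_at ltcR; apply: form_at_gt0. Qed.

Definition pred_error k : R := form_at f (predictor (sform f) k).

Lemma perr_sform k : perr (sform f) k = (pred_error k)%:C%C.
Proof. exact: sform_at. Qed.

Lemma GM_fin : exists2 g : R, GM f = g%:E & 0 <= g.
Proof.
have := GM_le_cut mf f01 (a := 1); rewrite ltr01 lexx => /(_ isT).
have := expeR_ge0 (\int[mu]_(x in circle R) lne (f x)%:E); rewrite -/(GM f).
by case: (GM f) => // r r0 _; exists r.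
Qed.

Lemma pred_error_ge g k : GM f = g%:E -> g <= pred_error k.
Proof.
move=> gE; have := GM_lower mf f01 (predictor (sform f) k).
rewrite predictor0 gE /nsq /= expr1n expr0n addr0 mule1 lee_fin //.
Qed.

Lemma pred_error_decr k n : pred_error (k + n) <= pred_error k.
Proof.
rewrite -lecR -!perr_sform.
exact: (perr_decr (sformDl mf f01) (sformC mf f01) sform_gt0).
Qed.

(** The prediction errors decrease to a limit L >= GM(f) > 0, so their Cesaro means also tend to L.
    The mean excess over L is made at most e L, because [remote_past_bound] carries a factor L on
    the left. *)
Lemma gap_correlation (e : R) : (0 < GM f)%E -> 0 < e -> exists n0, forall M n (q : {poly R[i]}),
  (n0 <= n)%N -> (size q <= M)%N ->
  `|sform f q 'X^(M + n)| ^+ 2 <= e%:C%C * sform f q q.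
Proof.
have [g gE _] := GM_fin; rewrite gE lte_fin => g0 e0.
have nd : nonincreasing_seq pred_error.
  by move=> m n mn; rewrite -(subnKC mn) pred_error_decr.
have lbd : has_lbound (range pred_error).
  by exists g => _ [k _ <-]; apply: pred_error_ge.
have cd := nonincreasing_is_cvgn nd lbd.
set L := limn pred_error in cd.
have Ld k : L <= pred_error k := nonincreasing_cvgn_ge nd cd k.
have gL : g <= L by apply: limr_ge => //; apply: nearW => k; apply: pred_error_ge.
have L0 : 0 < L := lt_le_trans g0 gL.
have eL : 0 < e * L by rewrite mulr_gt0.
have /cvgrPdist_le /(_ _ eL) [n0 _ hn0] := cesaro cd.
exists n0.+1 => M [//|n] q; rewrite ltnS => n0n qM.
have := hn0 n n0n; rewrite ler_distl => /andP[+ _].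
rewrite lerBlDr /arithmetic_mean /= [_^-1 * _]mulrC ler_pdivrMr ?ltr0n // => hs.
have Lp k : L%:C%C <= perr (sform f) k by rewrite perr_sform lecR.
have LC : 0 < L%:C%C :> R[i] by rewrite ltcR.
have := remote_past_bound (sformDl mf f01) (sformC mf f01) sform_gt0 (sform_shift f)
  (sform_contract mf f01) n.+1 LC Lp qM.
set W := `|_| ^+ 2; rewrite sform_at.
have -> : \sum_(k < n.+1) (perr (sform f) k - L%:C%C) =
    (\sum_(k < n.+1) (pred_error k - L))%:C%C.
  by rewrite rmorph_sum; apply: eq_bigr => k _; rewrite rmorphB /= perr_sform.
have hs' : \sum_(k < n.+1) (pred_error k - L) <= n.+1%:R * (e * L).
  move: hs; rewrite /series /= big_mkord sumrB sumr_const card_ord -[L *+ _]mulr_natl.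
  by lra.
move=> H; have nL : 0 < n.+1%:R * L%:C%C :> R[i] by rewrite mulr_gt0 ?ltr0n.
rewrite -(ler_pM2l nL); apply: le_trans H _.
have -> : n.+1%:R * L%:C%C * (e%:C%C * (form_at f q)%:C%C) =
    (form_at f q)%:C%C * (n.+1%:R * (e * L))%:C%C :> R[i].
  by rewrite !rmorphM /= rmorph_nat; ring.
rewrite -!rmorphM /= lecR ler_wpM2l //; exact: form_at_ge0.
Qed.

Lemma remote_past (b : int) (e : R) : (0 < GM f)%E -> 0 < e -> exists N : nat,
  forall s c, {in s, forall i : int, i <= - N%:Z} ->
  `|cross s (fkernel f) c b| ^+ 2 <= e%:C%C * qform s (fkernel f) c.
Proof.
move=> g0 e0; have [n0 hn0] := gap_correlation g0 e0.
(* After a shift by m + N the sites of [s] have exponents at most m, hence size at most m + 1, while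
   the exponent of [b] is at least m + 1 + n0. *)
pose N := (absz b + n0).+1; exists N => s c sN.
have [m sm] := exists_shift (b :: s).
have sm' : {in s, forall i : int, 0 <= i + (m + N)%N%:Z}.
  by move=> i si; have := sm i; rewrite inE si orbT => /(_ isT); lia.
have bm' : 0 <= b + (m + N)%N%:Z by rewrite /N; lia.
rewrite (cross_fkernel mf f01 c sm' bm') (qform_fkernel mf f01 c sm') -sform_at.
have [n [nn0 ->]] : exists n, (n0 <= n)%N /\ absz (b + (m + N)%N%:Z) = (m.+1 + n)%N.
  by exists (absz (b + (absz b + n0)%N%:Z)); rewrite /N; split; lia.
apply: hn0 => //; rewrite /site_poly (leq_trans (size_sum _ _ _)) //.
apply/bigmax_leqP_seq => i si _; rewrite (leq_trans (size_scale_leq _ _)) // size_polyXn.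
by have := sN i si; have := sm' i si; rewrite ltnS; lia.
Qed.

Lemma nsqD_le (z w : R[i]) : nsq (z + w) <= 2 * nsq z + 2 * nsq w.
Proof.
rewrite /nsq cReD cImD; have := sqr_ge0 (complex.Re z - complex.Re w).
by have := sqr_ge0 (complex.Im z - complex.Im w); nra.
Qed.

(* The next coefficient [c] is removed by subtracting [c *: ('X^(N.+1) * P')], where
   [P'] is nearly null and has constant term 1. *)
Lemma GM_eq0_gap N (e : R) : GM f = 0%E -> 0 < e -> exists P : {poly R[i]},
  [/\ P`_0 = 1, forall j, (0 < j < N)%N -> P`_j = 0 & form_at f P <= e].
Proof.
move=> g0; elim: N e => [|N IH] e e0.
  have [P P0 Pe] := GM_eq0_approx mf f01 g0 e0.
  by exists P; split=> // j; rewrite ltn0 andbF.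
case: N IH => [_|N IH].
  have [P P0 Pe] := GM_eq0_approx mf f01 g0 e0.
  by exists P; split=> // -[|j].
(* By |u + v|^2 <= 2 |u|^2 + 2 |v|^2, the bounds e / 4 for [P] and e / (4 (|c|^2 + 1)) for [P']
   contribute at most e / 2 each. *)
have [P [P0 PN Pe]] := IH (e / 4) (divr_gt0 e0 (ltr0Sn _ 3)).
set c := P`_N.+1; have c0 : 0 < 4 * (nsq c + 1) by have := nsq_ge0 c; lra.
have [P' P'0 P'e] := GM_eq0_approx mf f01 g0 (divr_gt0 e0 c0).
exists (P - c *: ('X^(N.+1) * P')); split.
- by rewrite coefB coefZ coefXnM P0 mulr0 subr0.
- move=> j /andP[j0]; rewrite coefB coefZ coefXnM ltnS leq_eqVlt => /predU1P[->|jN].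
    by rewrite ltnn subnn P'0 mulr1 subrr.
  by rewrite jN mulr0 subr0 PN // j0.
have bP (p : {poly R[i]}) : bmeas (fun x => nsq p.[zc x] * f x).
  by apply: bmeasM => //; exact: bmeas_poly.
apply: le_trans (_ : 2 * form_at f P + 2 * nsq c * form_at f P' <= _).
  rewrite /form_at -!meanZ // -meanD; [|exact: bmeasZ..].
  apply: le_mean => //; first by apply: bmeasD; exact: bmeasZ.
  move=> x _; have /andP[fx _] := f01 x.
  rewrite hornerD hornerN hornerZ hornerM hornerXn -[- (_ * _)]mulN1r.
  have := nsqD_le P.[zc x] (-1 * (c * (zc x ^+ N.+1 * P'.[zc x]))).
  rewrite !nsqM nsqX nsq_zc expr1n mul1r.
  have -> : nsq (-1 : R[i]) = 1 by rewrite /nsq /= oppr0 sqrrN expr1n expr0n addr0.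
  by have := nsq_ge0 P.[zc x]; nra.
have hc := nsq_ge0 c.
have : form_at f P' * (4 * (nsq c + 1)) <= e by rewrite -ler_pdivlMr.
by have := form_at_ge0 f01 P'; nra.
Qed.

Lemma GM_eq0_sites (N : nat) (e : R) : GM f = 0%E -> 0 < e -> exists s c,
  [/\ uniq (0 :: s), {in s, forall i, i <= - N.+1%:Z}, c 0 = 1 &
      qform (0 :: s) (fkernel f) c <= e%:C%C].
Proof.
move=> g0 e0; have [P [P0 PN Pe]] := GM_eq0_gap N.+1 g0 e0.
(* Exponents become sites of the opposite sign and coefficients are conjugated, so the trigonometric
   sum is the complex conjugate of [P] on the circle and has the same modulus. Sites beyond the
   degree carry coefficient 0. *)
pose s : seq int := [seq - (N.+1 + j)%:Z | j <- iota 0 (size P)].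
pose c (i : int) : R[i] := (P`_(absz i))^*.
have sN : {in s, forall i, i <= - N.+1%:Z}.
  by move=> i /mapP[j _ ->]; lia.
have us : uniq (0 :: s).
  rewrite /= map_inj_uniq ?iota_uniq ?andbT; last by move=> j k /= ?; lia.
  by apply/negP => /sN; lia.
exists s, c; split => //; first by rewrite /c /= P0 rmorph1.
have [m sm] := exists_shift (0 :: s).
rewrite (qform_fkernel mf f01 c sm) lecR; apply: le_trans Pe.
have -> // : form_at f (site_poly (0 :: s) c m%:Z) = form_at f P.
apply: eq_mean => x _; congr (_ * _).
rewrite site_poly_horner // nsqM.
have -> : nsq (ec m%:Z x) = 1 by rewrite ec_nat nsqX nsq_zc expr1n.
rewrite mul1r -[RHS]nsqJ; congr nsq.
rewrite (@horner_coef_wide _ (N.+1 + size P)) ?leq_addl // big_split_ord /= rmorphD /=.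
rewrite /trig_sum big_cons; congr (_ + _).
  rewrite big_ord_recl big1 => [|k _]; last by rewrite PN ?mul0r //= /bump /= ltnS.
  by rewrite /c addr0 P0 expr0 mulr1 rmorph1 mul1r /ec mulr0 mul0r expi0.
have i0 : iota 0 (size P) = index_iota 0 (size P) by rewrite /index_iota subn0.
rewrite /s big_map i0 big_mkord.
rewrite rmorph_sum; apply: eq_bigr => j _; rewrite /c abszN absz_nat rmorphM /=.
by rewrite -ec_nat /ec -expiN; congr (_ * expi _); rewrite mulrNz; ring.
Qed.

End RemotePast.

(** * Cylinder probabilities *)

Section Cylinders.
Implicit Types (L T : seq (int * bool)) (s : seq int) (S : set int).

Definition cyl L : set config := [set eta | all (fun bv => eta bv.1 == bv.2) L].

Definition ones s : seq (int * bool) := [seq (b, true) | b <- s].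

Lemma sigma_algebra_sigma_field S : sigma_algebra setT (sigma_field S).
Proof. exact: smallest_sigma_algebra. Qed.

Lemma sigma_fieldI S A B : sigma_field S A -> sigma_field S B -> sigma_field S (A `&` B).
Proof.
move=> SA SB; have [S0 SD SU] := sigma_algebra_sigma_field S.
rewrite -[A `&` B]setCK setCI; apply: sigma_algebraC.
by rewrite -bigcup2E; apply: SU => -[|[|n]] //=; exact: sigma_algebraC.
Qed.

Lemma sigma_field_coord S b (v : bool) : S b ->
  sigma_field S [set eta : config | eta b = v].
Proof.
move=> Sb; apply: sub_gen_smallest; exists b => //.
by exists [set v] => //; rewrite setTI.
Qed.

Lemma cyl_cons b v L : cyl ((b, v) :: L) = [set eta : config | eta b = v] `&` cyl L.
Proof.
apply/seteqP; split => eta; rewrite /cyl /=; first by move/andP => [/eqP].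
by move=> [/eqP ? ?]; apply/andP.
Qed.

Lemma cyl_nil : cyl [::] = setT.
Proof. by apply/seteqP; split. Qed.

Lemma cyl_cat L T : cyl (L ++ T) = cyl L `&` cyl T.
Proof. by apply/seteqP; split => eta; rewrite /cyl /= all_cat => /andP. Qed.

Lemma sigma_field_cyl S L : (forall b, b \in map fst L -> S b) -> sigma_field S (cyl L).
Proof.
elim: L => [|[b v] L IH] hS.
  by rewrite cyl_nil -setC0; apply: sigma_algebraC; exact: sigma_algebra0.
rewrite cyl_cons; apply: sigma_fieldI.
  by apply: sigma_field_coord; apply: hS; rewrite /= mem_head.
by apply: IH => c cL; apply: hS; rewrite /= inE cL orbT.
Qed.

Lemma coord_systemS S S' : S `<=` S' -> coord_system S `<=` coord_system S'.
Proof. by move=> SS' A [b /SS' S'b hA]; exists b. Qed.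

Lemma sigma_field_measurable S A : sigma_field S A -> measurable A.
Proof. by apply: sub_smallest2r => //; exact: coord_systemS. Qed.

Lemma measurable_cyl L : measurable (cyl L).
Proof. by apply: (@sigma_field_measurable setT); apply: sigma_field_cyl. Qed.

Lemma cyl_ones_cons b s L : cyl (ones s ++ (b, true) :: L) = cyl (ones (b :: s) ++ L).
Proof. by rewrite !cyl_cat /= !cyl_cons setIA [cyl (ones s) `&` _]setIC -setIA. Qed.

Lemma cyl_split b L : cyl L = cyl ((b, true) :: L) `|` cyl ((b, false) :: L).
Proof.
rewrite !cyl_cons -setIUl; apply/seteqP; split=> eta /=; last by case.
by move=> hL; split=> //; case: (eta b); [left|right].
Qed.

Lemma cyl_split_disj b L : cyl ((b, true) :: L) `&` cyl ((b, false) :: L) = set0.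
Proof. by rewrite !cyl_cons; apply/seteqP; split => eta //= [[-> _] []]. Qed.

End Cylinders.

(** * Conditional determinantal structure of the measure *)

Section DeterminantalMeasure.
Variable R : realType.
Notation mu := (@lebesgue_measure R).
Variable f : R -> R.
Hypotheses (mf : measurable_fun [set: R] f) (f01 : forall x, 0 <= f x <= 1).
Hypothesis fn0 : ~ (f = cst 0 %[ae mu in circle R]).
Hypothesis fn1 : ~ (f = cst 1 %[ae mu in circle R]).
Variable Pf : probability config R.
Hypothesis Pf_det : determinantal f Pf.
Implicit Types (L T : seq (int * bool)) (s : seq int) (S : set int) (A F : set config).

Let K := fkernel f.
Let fc x := 1 - f x.

Lemma compl01 x : 0 <= fc x <= 1.
Proof. by have /andP[? ?] := f01 x; rewrite /fc; apply/andP; split; lra. Qed.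

Lemma measurable_compl : measurable_fun [set: R] fc.
Proof. by apply: measurable_funB => //; exact: measurable_cst. Qed.

Lemma compl_neq0 : ~ (fc = cst 0 %[ae mu in circle R]).
Proof.
move=> [N [mN N0 hN]]; apply: fn1; exists N; split => // x nx; apply: hN => /= hx.
by apply: nx => Ix; have := hx Ix; rewrite /fc => /subr0_eq.
Qed.

Let hK : hermitian_kernel K. Proof. exact: hermitian_fkernel. Qed.
Let pK : posdef K. Proof. exact: posdef_fkernel. Qed.

Lemma posdef_cmplk_fkernel : posdef (cmplk K).
Proof.
move=> s x us hs; rewrite (@eq_qform_kernel _ _ s _ (fkernel fc)) => [|i j _ _].
  exact: (posdef_fkernel measurable_compl compl01 compl_neq0).
exact: cmplk_fkernel.
Qed.

Let pK' := posdef_cmplk_fkernel.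

Definition pr A : R := fine (Pf A).

Lemma pr_fine A : pr A = fine (Pf A).
Proof. by []. Qed.

Lemma prE A : measurable A -> Pf A = (pr A)%:E.
Proof. by move=> mA; rewrite /pr fineK // fin_num_measure. Qed.

Lemma pr_setT : pr setT = 1.
Proof. by rewrite /pr probability_setT. Qed.

Lemma pr_ge0 A : 0 <= pr A.
Proof. by rewrite /pr fine_ge0. Qed.

Lemma prU A F : measurable A -> measurable F -> A `&` F = set0 ->
  pr (A `|` F) = pr A + pr F.
Proof.
move=> mA mF AF; rewrite /pr measureU // fineD //; exact: fin_num_measure.
Qed.

Lemma le_pr A F : measurable A -> measurable F -> A `<=` F -> pr A <= pr F.
Proof.
move=> mA mF AF; rewrite /pr fine_le ?fin_num_measure //.
by apply: le_measure => //; rewrite inE.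
Qed.

Lemma pr_ones s : uniq s -> (pr (cyl (ones s)))%:C%C = \det (submx K s).
Proof.
case: s => [|b s] us.
  by rewrite cyl_nil pr_setT det_mx00.
have e_inj : injective (tnth (in_tuple (b :: s))).
  exact/tuple_uniqP.
have := Pf_det (isT : (1 <= size (b :: s))%N) e_inj.
have -> : cyl (ones (b :: s)) =
    [set eta : config | forall i, eta (tnth (in_tuple (b :: s)) i) = true].
  apply/seteqP; split => eta /=; rewrite -/(ones s).
    move=> h i; have : all (fun bv => eta bv.1 == bv.2) (ones (b :: s)) by [].
    by rewrite all_map => /allP /(_ _ (mem_tnth i (in_tuple (b :: s)))) /eqP.
  move=> h; suff : all (fun bv => eta bv.1 == bv.2) (ones (b :: s)) by [].
  rewrite all_map; apply/allP => c /(tnthP (in_tuple (b :: s)))[i ->] /=.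
  by rewrite h.
exact.
Qed.

(** Given [L], the process off its sites is determinantal with kernel [condk K L]. In the induction
    an occupied head joins [s] and is removed by a Schur complement; an empty head is expressed by
    inclusion-exclusion. *)
Lemma pr_cyl_ones s L : uniq (s ++ map fst L) ->
  (pr (cyl (ones s ++ L)))%:C%C = (pr (cyl L))%:C%C * \det (submx (condk K L) s).
Proof.
elim: L s => [|[b v] L IH] s; first by rewrite !cats0 cyl_nil pr_setT mul1r; apply: pr_ones.
rewrite /= cat_uniq /= negb_or => /and3P[us /andP[bs hs] /andP[bL uL]].
have us1 : uniq (s ++ map fst L) by rewrite cat_uniq us hs.
have us2 : uniq ((b :: s) ++ map fst L) by rewrite /= mem_cat negb_or bs bL.
have ub : uniq (b :: map fst L) by rewrite /= bL.
have /andP[k0 k1] := condk_diag hK pK pK' ub.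
have trueE t : uniq ((b :: t) ++ map fst L) ->
    (pr (cyl (ones t ++ (b, true) :: L)))%:C%C =
    (pr (cyl L))%:C%C * (condk K L b b * \det (submx (cstep true b (condk K L)) t)).
  by move=> ut; rewrite cyl_ones_cons IH // minor_cons_true ?gt_eqF.
have falseE t : uniq (t ++ map fst L) -> uniq ((b :: t) ++ map fst L) ->
    (pr (cyl (ones t ++ (b, false) :: L)))%:C%C =
    (pr (cyl L))%:C%C * ((1 - condk K L b b) * \det (submx (cstep false b (condk K L)) t)).
  move=> ut ut'; rewrite -minor_cons_false ?lt_eqF // mulrBr -!IH // -cyl_ones_cons -rmorphB.
  congr (_%:C%C); apply/eqP; rewrite eq_sym subr_eq addrC eq_sym; apply/eqP.
  rewrite -prU; try exact: measurable_cyl.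
    by rewrite !cyl_cat -setIUr -cyl_split.
  by rewrite !cyl_cat setIACA cyl_split_disj setI0.
have pr1 : (pr (cyl ((b, v) :: L)))%:C%C =
    (pr (cyl L))%:C%C * (if v then condk K L b b else 1 - condk K L b b).
  by case: v; rewrite -[_ :: L]/(ones [::] ++ _ :: L) ?trueE ?falseE //= det_mx00 mulr1.
by rewrite pr1; case: v pr1 => _; rewrite ?trueE ?falseE // mulrA.
Qed.

Lemma pr_split b L :
  pr (cyl L) = pr (cyl ((b, true) :: L)) + pr (cyl ((b, false) :: L)).
Proof.
have := prU (measurable_cyl ((b, true) :: L)) (measurable_cyl ((b, false) :: L))
  (cyl_split_disj b L).
by rewrite -cyl_split.
Qed.

Lemma pr_cyl_cons b v L : uniq (b :: map fst L) ->
  (pr (cyl ((b, v) :: L)))%:C%C =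
  (pr (cyl L))%:C%C * (if v then condk K L b b else 1 - condk K L b b).
Proof.
move=> ub; have /andP[k0 _] := condk_diag hK pK pK' ub.
have ub' : uniq ([:: b] ++ map fst L) by [].
have := pr_cyl_ones ub'; rewrite minor_cons_true ?gt_eqF // det_mx00 mulr1 /= => tE.
case: v => //; rewrite mulrBr mulr1 -tE -rmorphB.
by rewrite (pr_split b L) addrAC subrr add0r.
Qed.

Lemma pr_cyl_gt0 L : uniq (map fst L) -> 0 < pr (cyl L).
Proof.
elim: L => [|[b v] L IH] ub; first by rewrite cyl_nil pr_setT.
have /andP[k0 k1] := condk_diag hK pK pK' ub; have /andP[_ uL] := ub.
rewrite -ltcR pr_cyl_cons //; case: (v); rewrite mulr_gt0 ?ltcR ?IH //.
by rewrite subr_gt0.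
Qed.

End DeterminantalMeasure.

Section FiniteDependence.
Implicit Types (L T : seq (int * bool)) (s : seq int) (S : set int) (A : set config).

Definition depends_on S A := forall eta eta' : config,
  (forall b, S b -> eta b = eta' b) -> A eta -> A eta'.

Lemma depends_onC S A : depends_on S A -> depends_on S (~` A).
Proof. by move=> dA eta eta' e nA A'; apply: nA; apply: dA A' => b /e. Qed.

Lemma depends_onU S A A' : depends_on S A -> depends_on S A' -> depends_on S (A `|` A').
Proof. by move=> dA dA' eta eta' e [/(dA _ _ e)|/(dA' _ _ e)]; [left|right]. Qed.

Lemma depends_onS S S' A : S `<=` S' -> depends_on S A -> depends_on S' A.
Proof. by move=> SS' dA eta eta' e; apply: dA => b /SS'/e. Qed.

Lemma sigma_field_depends S A : sigma_field S A -> depends_on S A.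
Proof.
apply: smallest_sub => {A}.
  split.
  - by move=> eta.
  - by move=> A dA; rewrite setTD; apply: depends_onC.
  - by move=> F dF eta eta' e [n _ Fn]; exists n => //; apply: dF Fn.
by move=> _ [b Sb [V _ <-]] eta eta' e [_ /= Vb]; split=> //=; rewrite -e.
Qed.

(* A set depending on finitely many coordinates is a finite disjoint union of
   cylinders. *)
Lemma cylinder_ind (Q : set config -> Prop) s :
  Q set0 -> (forall T, uniq (map fst T) -> {subset map fst T <= s} -> Q (cyl T)) ->
  (forall A A', measurable A -> measurable A' -> A `&` A' = set0 -> Q A -> Q A' -> Q (A `|` A')) ->
  forall A, measurable A -> depends_on [set` s] A -> Q A.
Proof.
move=> Q0 Qcyl QU A mA dA.
(* [T] records the values already chosen and [t] the sites still free; when [t] is empty, [cyl T]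
   lies inside [A] or is disjoint from it. *)
suff key : forall t T, uniq (t ++ map fst T) -> {subset t ++ map fst T <= s} ->
    {subset s <= t ++ map fst T} -> Q (A `&` cyl T).
  have := key (undup s) [::]; rewrite cyl_nil setIT cats0; apply.
  - exact: undup_uniq.
  - by move=> b; rewrite mem_undup.
  - by move=> b; rewrite mem_undup.
elim=> [|b t IH] T /=.
  move=> uT Ts sT; have [[eta [Aeta Teta]]|none] := pselect (exists eta, (A `&` cyl T) eta).
    suff -> : A `&` cyl T = cyl T by apply: Qcyl.
    apply/seteqP; split=> [x []//|eta' T']; split=> //.
    apply: dA Aeta => b /= bs; have /mapP[[c v] cT /= ->] := sT b bs.
    by move: Teta T' => /allP /(_ _ cT) /eqP /= -> /allP /(_ _ cT) /eqP.
  suff -> : A `&` cyl T = set0 by [].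
  by apply/seteqP; split=> // x hx; apply: none; exists x.
move=> /andP[bt ut] ts st; rewrite (cyl_split b T) setIUr.
have us' v : uniq (t ++ map fst ((b, v) :: T)).
  by rewrite (perm_uniq (_ : perm_eq _ (b :: t ++ map fst T))) /= ?bt // -cat1s perm_catCA.
have mem v c : (c \in t ++ map fst ((b, v) :: T)) = (c \in b :: t ++ map fst T).
  by rewrite /= !(mem_cat, inE) orbCA.
apply: QU.
- by apply: measurableI => //; exact: measurable_cyl.
- by apply: measurableI => //; exact: measurable_cyl.
- by rewrite setIACA cyl_split_disj setI0.
- by apply: IH => // c; rewrite mem; [apply: ts|apply: st].
- by apply: IH => // c; rewrite mem; [apply: ts|apply: st].
Qed.

End FiniteDependence.

Lemma cyl_perm (L L' : seq (int * bool)) : perm_eq L L' -> cyl L = cyl L'.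
Proof. by move=> LL'; apply/seteqP; split=> eta; rewrite /cyl /= (perm_all _ LL'). Qed.

Section Mixing.
Variable R : realType.
Variable Pf : probability config R.
Implicit Types (L T : seq (int * bool)) (s : seq int) (S : set int) (A F : set config).
Notation pr := (pr Pf).

(** The error is relative to [pr (cyl L)], hence uniform for the conditional probabilities of [F]
    over all cylinders of the remote past. *)
Definition mixing F := forall e : R, 0 < e -> exists N : nat,
  forall L, uniq (map fst L) -> {in map fst L, forall b : int, b <= - N%:Z} ->
  `|pr (cyl L `&` F) - pr (cyl L) * pr F| <= e * pr (cyl L).

Lemma pr_set0 : pr set0 = 0.
Proof. by rewrite pr_fine measure0. Qed.

Lemma mixing0 : mixing set0.
Proof.
move=> e e0; exists 0%N => L _ _; rewrite setI0 pr_set0 mulr0 subrr normr0.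
by rewrite mulr_ge0 ?pr_ge0 // ltW.
Qed.

Lemma mixing_lincomb F F' G (c : R) : `|c| <= 1 ->
  (forall L, pr (cyl L `&` G) = pr (cyl L `&` F) + c * pr (cyl L `&` F')) ->
  mixing F -> mixing F' -> mixing G.
Proof.
move=> c1 hG mF mF' e e0; have e2 : 0 < e / 2 by rewrite divr_gt0.
have [N hN] := mF _ e2; have [N' hN'] := mF' _ e2.
exists (N + N')%N => L uL LN.
have prG : pr G = pr F + c * pr F'.
  by have := hG [::]; rewrite cyl_nil !setTI.
have /(hN L uL) h1 : {in map fst L, forall b : int, b <= - N%:Z}.
  by move=> b /LN; lia.
have /(hN' L uL) h2 : {in map fst L, forall b : int, b <= - N'%:Z}.
  by move=> b /LN; lia.
rewrite hG prG; set p := pr (cyl L) in h1 h2 *.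
have -> : pr (cyl L `&` F) + c * pr (cyl L `&` F') - p * (pr F + c * pr F') =
  (pr (cyl L `&` F) - p * pr F) + c * (pr (cyl L `&` F') - p * pr F') by ring.
apply: le_trans (ler_normD _ _) _.
have -> : e * p = e / 2 * p + e / 2 * p by field.
by rewrite lerD // normrM (le_trans _ h2) // ler_piMl.
Qed.

Lemma mixingU F F' : measurable F -> measurable F' -> F `&` F' = set0 ->
  mixing F -> mixing F' -> mixing (F `|` F').
Proof.
move=> mF mF' FF'; apply: (@mixing_lincomb _ _ _ 1); first by rewrite normr1.
move=> L; rewrite mul1r setIUr prU //.
- by apply: measurableI => //; exact: measurable_cyl.
- by apply: measurableI => //; exact: measurable_cyl.
- by rewrite setIACA FF' setI0.
Qed.

Section FromOnes.
Hypothesis mixing_ones : forall s, uniq s -> mixing (cyl (ones s)).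

(** Empty sites are eliminated one by one: the cylinder with [b] empty is the one without [b] minus
    the one with [b] occupied, the case c = -1 of [mixing_lincomb]. *)
Lemma mixing_cyl T s : uniq (s ++ map fst T) -> mixing (cyl (ones s ++ T)).
Proof.
elim: T s => [|[b v] T IH] s; first by rewrite !cats0; apply: mixing_ones.
rewrite /= cat_uniq /= negb_or => /and3P[us /andP[bs hs] /andP[bT uT]].
have u1 : uniq (s ++ map fst T) by rewrite cat_uniq us hs.
have u2 : uniq ((b :: s) ++ map fst T) by rewrite /= mem_cat negb_or bs bT.
case: v; first by rewrite cyl_ones_cons; apply: IH.
apply: (@mixing_lincomb (cyl (ones s ++ T)) (cyl (ones (b :: s) ++ T)) _ (-1)).
- by rewrite normrN normr1.
- move=> L; rewrite mulN1r -cyl_ones_cons -!cyl_cat.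
  have perm v : cyl (L ++ (ones s ++ (b, v) :: T)) = cyl ((b, v) :: (L ++ (ones s ++ T))).
    apply: cyl_perm; rewrite -(cat1s (b, v) T) -(cat1s (b, v) (L ++ _)).
    by rewrite perm_sym perm_catCA perm_cat2l perm_catCA perm_cat2l.
  by rewrite !perm (pr_split Pf b (L ++ (ones s ++ T))) addrAC subrr add0r.
- exact: IH.
- exact: IH.
Qed.

Lemma mixing_finite s F : measurable F -> depends_on [set` s] F -> mixing F.
Proof.
apply: cylinder_ind; first exact: mixing0.
  by move=> T uT _; apply: (@mixing_cyl T [::]).
by move=> A A' mA mA' dis hA hA'; apply: mixingU.
Qed.

End FromOnes.

End Mixing.

(** * From cylinders to conditional probabilities *)

Section Approximation.
Variable R : realType.
Variable Pf : probability config R.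
Implicit Types (L T : seq (int * bool)) (s : seq int) (S : set int) (A F : set config).
Notation pr := (pr Pf).

Definition sdiff A A' : set config := (A `\` A') `|` (A' `\` A).

Lemma measurable_sdiff A A' : measurable A -> measurable A' -> measurable (sdiff A A').
Proof. by move=> mA mA'; apply: measurableU; apply: measurableD. Qed.

Lemma pr_leU A F G : measurable A -> measurable F -> measurable G -> G `<=` A `|` F ->
  pr G <= pr A + pr F.
Proof.
move=> mA mF mG GAF; have mFA : measurable (F `\` A) by apply: measurableD.
have h1 : pr G <= pr (A `|` (F `\` A)).
  apply: le_pr => //; first exact: measurableU.
  move=> x /GAF [|Fx]; first by left.
  by have [Ax|nAx] := pselect (A x); [left|right].
apply: le_trans h1 _; rewrite prU //; last by apply/seteqP; split => x // [? []].
by rewrite lerD2l; apply: le_pr => // x [].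
Qed.

Definition approximable S A := measurable A /\ forall e : R, 0 < e ->
  exists s, [set` s] `<=` S /\ exists A', [/\ measurable A', depends_on [set` s] A' &
    pr (sdiff A A') <= e].

Lemma approximableC S A : approximable S A -> approximable S (~` A).
Proof.
move=> [mA hA]; split; first exact: measurableC.
move=> e e0; have [s [sS [A' [mA' dA' le]]]] := hA e e0.
exists s; split => //; exists (~` A'); split.
- exact: measurableC.
- exact: depends_onC.
- suff -> : sdiff (~` A) (~` A') = sdiff A A' by [].
  rewrite /sdiff !setDE !setCK [X in _ = X]setUC [X in X `|` _ = _]setIC.
  by rewrite [X in _ `|` X = _]setIC.
Qed.

Lemma approximableU S A F : approximable S A -> approximable S F -> approximable S (A `|` F).
Proof.
move=> [mA hA] [mF hF]; split; first exact: measurableU.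
move=> e e0; have e2 : 0 < e / 2 by rewrite divr_gt0.
have [s [sS [A' [mA' dA' leA]]]] := hA _ e2.
have [t [tS [F' [mF' dF' leF]]]] := hF _ e2.
exists (s ++ t); split.
  by move=> b /=; rewrite mem_cat => /orP[/sS|/tS].
exists (A' `|` F'); split; first exact: measurableU.
  apply: depends_onU; [apply: depends_onS dA'|apply: depends_onS dF'] => b /= bs;
  by rewrite mem_cat bs ?orbT.
have h : pr (sdiff (A `|` F) (A' `|` F')) <= pr (sdiff A A') + pr (sdiff F F').
  apply: pr_leU; try exact: measurable_sdiff.
    by apply: measurable_sdiff; apply: measurableU.
  move=> x; rewrite /sdiff /= => -[[[Ax|Fx] /not_orP[nA nF]]|[[Ax|Fx] /not_orP[nA nF]]].
  - by left; left.
  - by right; left.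
  - by left; right.
  - by right; right.
by apply: le_trans h _; lra.
Qed.

(** By continuity from below a finite partial union misses at most e / 2, and that union is itself
    approximable within e / 2. *)
Lemma approximable_bigcup S (F : (set config)^nat) :
  (forall n, approximable S (F n)) -> approximable S (\bigcup_n F n).
Proof.
move=> hF; have mF n : measurable (F n) by have [] := hF n.
have mU : measurable (\bigcup_n F n) by apply: bigcupT_measurable.
split => // e e0; have e2 : 0 < e / 2 by rewrite divr_gt0.
pose G n := \big[setU/set0]_(i < n) F i.
have aG n : approximable S (G n).
  rewrite /G; elim: n => [|n IH]; last by rewrite big_ord_recr; apply: approximableU.
  rewrite big_ord0; split => // d d0; exists [::]; split => //.
  exists set0; split => //; rewrite /sdiff setD0 setU0 pr_fine measure0 /=; exact: ltW.
have mG n : measurable (G n) by have [] := aG n.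
have UG : \bigcup_n G n = \bigcup_n F n.
  apply/seteqP; split => x [n _].
    by rewrite /G -bigcup_mkord => -[k _ Fk]; exists k.
  by move=> Fx; exists n.+1 => //; rewrite /G -bigcup_mkord; exists n => /=.
have ndG : nondecreasing_seq G.
  by move=> m n mn; apply/subsetPset; rewrite /G => x; rewrite -!bigcup_mkord =>
    -[k /= km Fk]; exists k => //=; apply: leq_trans mn.
have cv : pr (G n) @[n --> \oo] --> pr (\bigcup_n F n).
  have := nondecreasing_cvg_mu (mu := Pf) mG _ ndG; rewrite UG => /(_ mU).
  by move=> h; apply: fine_cvg; rewrite -(prE Pf mU).
have /cvgrPdist_le /(_ _ e2) [n _ /(_ n (leqnn n)) hn] := cv.
have [_ /(_ _ e2) [s [sS [A' [mA' dA' le']]]]] := aG n.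
exists s; split => //; exists A'; split => //.
have GU : G n `<=` \bigcup_n F n by rewrite -UG; apply: bigcup_sup.
have mD : measurable (\bigcup_n F n `\` G n) by apply: measurableD.
have hD : pr (\bigcup_n F n `\` G n) <= e / 2.
  have : pr (\bigcup_n F n) = pr (G n) + pr (\bigcup_n F n `\` G n).
    rewrite -prU //; first by rewrite setDUK.
    by apply/seteqP; split => x // [? []].
  by move=> eU; move: hn; rewrite eU [pr (G n) + _]addrC addrK ger0_norm ?pr_ge0.
have h : pr (sdiff (\bigcup_n F n) A') <=
    pr (\bigcup_n F n `\` G n) + pr (sdiff (G n) A').
  apply: pr_leU => //; try exact: measurable_sdiff.
  move=> x [[Ux nA]|[Ax nU]].
    by have [Gx|nG] := pselect (G n x); [right; left|left].
  by right; right; split => // /GU.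
by apply: le_trans h _; lra.
Qed.

Lemma sigma_field_approximable S A : sigma_field S A -> approximable S A.
Proof.
apply: smallest_sub => {A}.
  split.
  - split => // e e0; exists [::]; split => //; exists set0; split => //.
    by rewrite /sdiff setD0 setU0 pr_fine measure0 /=; exact: ltW.
  - by move=> A hA; rewrite setTD; apply: approximableC.
  - by move=> F hF; apply: approximable_bigcup.
move=> A hA; have SA : sigma_field S A by apply: sub_gen_smallest.
have mA := sigma_field_measurable SA.
split => // e e0; case: hA => b Sb [V _ AV].
exists [:: b]; split; first by move=> c; rewrite /= inE => /eqP ->.
exists A; split => //.
  rewrite -AV => eta eta' ee [_ /= Vb]; split=> //=.
  by rewrite -ee //= inE.
by rewrite /sdiff setDv setU0 pr_fine measure0 /=; exact: ltW.
Qed.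

(** The inequality adds up over disjoint cylinders, so it holds for sets depending on finitely many
    sites of [S]; both sides are continuous in [A] for the probability of the symmetric
    difference. *)
Lemma past_bound S F (e : R) : measurable F -> 0 < e ->
  (forall T, uniq (map fst T) -> (forall b, b \in map fst T -> S b) ->
     `|pr (cyl T `&` F) - pr (cyl T) * pr F| <= e * pr (cyl T)) ->
  forall A, sigma_field S A -> `|pr (A `&` F) - pr A * pr F| <= e * pr A.
Proof.
move=> mF e0 hT A SA; have [mA hA] := sigma_field_approximable SA.
have fin s A' : [set` s] `<=` S -> measurable A' -> depends_on [set` s] A' ->
    `|pr (A' `&` F) - pr A' * pr F| <= e * pr A'.
  move=> sS; move: A'; apply: (@cylinder_ind (fun B => `|pr (B `&` F) - pr B * pr F| <= e * pr B)).
  - by rewrite set0I pr_set0 mulr0 mul0r subrr normr0.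
  - by move=> T uT Ts; apply: hT => // b /Ts; apply: sS.
  - move=> B B' mB mB' dis hB hB'; rewrite setIUl !prU //; try exact: measurableI.
      have -> : pr (B `&` F) + pr (B' `&` F) - (pr B + pr B') * pr F =
        (pr (B `&` F) - pr B * pr F) + (pr (B' `&` F) - pr B' * pr F) by ring.
      by rewrite mulrDr (le_trans (ler_normD _ _)) // lerD.
    by rewrite setIACA setIid dis set0I.
have F1 : pr F <= 1 by rewrite -(pr_setT Pf); apply: le_pr.
have F0 := pr_ge0 Pf F.
apply/ler_addgt0Pr => d d0.
have c0 : 0 < 3 + e by lra.
(* Replacing [A'] by [A] costs at most x in each product term on the left and e x on the right; 3 +
   e covers all of them. *)
have [s [sS [A' [mA' dA' hd]]]] := hA (d / (3 + e)) (divr_gt0 d0 c0).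
have := fin s A' sS mA' dA'.
set x := d / (3 + e) in hd *; have dx : d = x * (3 + e) by rewrite /x divfK ?gt_eqF.
have mS := measurable_sdiff mA mA'.
have near G : measurable G -> `|pr (A `&` G) - pr (A' `&` G)| <= x.
  move=> mG.
  have a1 : pr (A `&` G) <= pr (A' `&` G) + pr (sdiff A A').
    apply: pr_leU => //; try exact: measurableI.
    move=> y [Ay Gy]; have [A'y|nA'] := pselect (A' y); first by left.
    by right; left.
  have a2 : pr (A' `&` G) <= pr (A `&` G) + pr (sdiff A A').
    apply: pr_leU => //; try exact: measurableI.
    move=> y [Ay Gy]; have [A'y|nA'] := pselect (A y); first by left.
    by right; right.
  by rewrite ler_norml; apply/andP; split; lra.
have n1 := near F mF; have := near setT measurableT; rewrite !setIT => n2.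
move: n1 n2; rewrite !ler_norml dx => /andP[n1 n1'] /andP[n2 n2'] /andP[n3 n3'].
have x0 : 0 <= x by rewrite (le_trans (pr_ge0 _ _) hd).
by apply/andP; split; nra.
Qed.

End Approximation.

Section CoarseMeasures.
Variable R : realType.
Variables (Pf : probability config R) (S : set int) (F : set config).
Hypothesis mF : measurable F.

(* The configuration space with the smaller sigma-field, so that Radon-Nikodym
   yields a [sigma_field S]-measurable density. *)
Definition coarse := g_sigma_algebraType (coord_system S).

Definition to_coarse : config -> coarse := id.

Lemma coarse_measurable (A : set coarse) : measurable A -> measurable (A : set config).
Proof. exact: sigma_field_measurable. Qed.

Lemma measurable_to_coarse : measurable_fun [set: config] to_coarse.
Proof. by move=> _ A mA; rewrite setTI; apply: coarse_measurable. Qed.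

Definition coarse_pr (A : set coarse) : \bar R := Pf (A : set config).
(** The proof that [F] is measurable is an argument so that the measure instances, whose additivity
    depends on it, can be found from the term. *)
Definition coarse_restr of measurable F := fun A : set coarse => Pf ((A : set config) `&` F).

Let coarse_pr0 : coarse_pr set0 = 0%E. Proof. exact: measure0. Qed.
Let coarse_pr_ge0 A : (0 <= coarse_pr A)%E. Proof. exact: measure_ge0. Qed.
Let coarse_pr_sigma : semi_sigma_additive coarse_pr.
Proof.
move=> G mG tG mU; apply: measure_semi_sigma_additive => //.
  by move=> n; apply: coarse_measurable.
exact: coarse_measurable.
Qed.

HB.instance Definition _ := isMeasure.Build _ coarse R coarse_pr
  coarse_pr0 coarse_pr_ge0 coarse_pr_sigma.

Let coarse_pr_fin : fin_num_fun coarse_pr.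
Proof. by move=> A mA; apply: fin_num_measure; apply: coarse_measurable. Qed.

HB.instance Definition _ := @Measure_isFinite.Build _ coarse R coarse_pr coarse_pr_fin.

Local Notation restr := (coarse_restr mF).

Let coarse_restr0 : restr set0 = 0%E.
Proof. by rewrite /coarse_restr set0I measure0. Qed.
Let coarse_restr_ge0 A : (0 <= restr A)%E. Proof. exact: measure_ge0. Qed.
Let coarse_restr_sigma : semi_sigma_additive restr.
Proof.
move=> G mG tG mU; rewrite /coarse_restr setI_bigcupl.
apply: measure_semi_sigma_additive => //.
- by move=> n; apply: measurableI => //; apply: coarse_measurable.
- exact: trivIset_setIr.
- by rewrite -setI_bigcupl; apply: measurableI => //; apply: coarse_measurable.
Qed.

HB.instance Definition _ := isMeasure.Build _ coarse R restr
  coarse_restr0 coarse_restr_ge0 coarse_restr_sigma.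

Let coarse_restr_fin : fin_num_fun restr.
Proof.
by move=> A mA; apply: fin_num_measure; apply: measurableI => //; apply: coarse_measurable.
Qed.

HB.instance Definition _ := @Measure_isFinite.Build _ coarse R restr coarse_restr_fin.

End CoarseMeasures.

Section ConditionalProbability.
Variable R : realType.
Variables (Pf : probability config R) (S : set int) (F : set config).
Hypothesis mF : measurable F.
Notation pr := (pr Pf).

Lemma measurable_config_fun (g : config -> R) :
  (forall B : set R, measurable B -> sigma_field S (g @^-1` B)) ->
  measurable_fun [set: config] g.
Proof. by move=> mg _ B mB; rewrite setTI; apply: sigma_field_measurable; apply: mg. Qed.

Lemma cond_prob_exists : exists g : config -> R, is_cond_prob Pf (sigma_field S) F g.
Proof.
have dom : coarse_restr Pf (S := S) mF `<< coarse_pr Pf (S := S).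
  apply/null_content_dominatesP => A mA A0.
  apply/eqP; rewrite eq_le measure_ge0 andbT -A0.
  apply: le_measure; rewrite ?inE.
  - by apply: measurableI => //; apply: coarse_measurable.
  - exact: coarse_measurable.
  - by move=> x [].
have [h [h0 hfin hint hE]] := radon_nikodym_sigma_finite dom.
have mh : measurable_fun [set: coarse S] h := measurable_int _ hint.
have mg : measurable_fun [set: coarse S] (fine \o h) by exact: measurableT_comp.
have hg x : (fine (h x))%:E = h x by rewrite fineK.
pose g : config -> R := fine \o h.
have gS (B : set R) : measurable B -> sigma_field S (g @^-1` B).
  by move=> mB; have := mg measurableT B mB; rewrite setTI.
have mgc := measurable_config_fun gS.
(* Change of variables along the identity map [to_coarse] carries integrals from the coarse space
   back to [Pf]. *)
have intE (A : set (coarse S)) : measurable A ->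
    (\int[Pf]_(x in (A : set config)) (g x)%:E = \int[coarse_pr Pf (S := S)]_(x in A) h x)%E.
  move=> mA; rewrite (ge0_integral_pushforward (@measurable_to_coarse S) Pf) //.
  - by apply: eq_integral => x _; rewrite /g /= hg.
  - exact: measurable_funTS.
exists g; split => //.
- apply/integrableP; split; first exact/measurable_EFinP.
  have -> : (\int[Pf]_x `|(EFin \o g) x| = \int[Pf]_x (g x)%:E)%E.
    by apply: eq_integral => x _; rewrite /= ger0_norm // fine_ge0.
  rewrite -[X in integral _ X]/([set: coarse S] : set config) intE //.
  have /integrableP[_] := hint; under eq_integral do rewrite gee0_abs //.
  by [].
- by move=> A SA; rewrite setIC intE // -hE.
Qed.

Lemma ae_not_of_integral_le0 (A : set config) (h : config -> R) : measurable A ->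
  Pf.-integrable setT (EFin \o h) -> (forall x, A x -> 0 < h x) ->
  (\int[Pf]_(x in A) (h x)%:E <= 0)%E -> {ae Pf, forall x, ~ A x}.
Proof.
move=> mA ih hpos le0.
have ihA : Pf.-integrable A (EFin \o h) by exact: integrableS ih.
have : ae_eq Pf A (EFin \o h) (cst 0%E).
  apply/ae_eq_integral_abs => //; first exact: measurable_int ihA.
  have -> : (\int[Pf]_(x in A) `|(EFin \o h) x| = \int[Pf]_(x in A) (h x)%:E)%E.
    by apply: eq_integral => x /[!inE] Ax; rewrite /= ger0_norm // ltW // hpos.
  apply/eqP; rewrite eq_le le0 /=; apply: integral_ge0 => x Ax.
  by rewrite lee_fin ltW // hpos.
case=> N [mN N0 hN]; exists N; split => // x nnA; apply: hN => /= hx.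
by apply: nnA => Ax; have [h0] := hx Ax; have := hpos x Ax; rewrite h0 ltxx.
Qed.

Lemma integral_pr_cst (A : set config) (c : R) : measurable A ->
  (\int[Pf]_(x in A) c%:E = (c * pr A)%:E)%E.
Proof. by move=> mA; rewrite EFinM -(prE Pf mA); exact: (integral_cst Pf mA c%:E). Qed.

Lemma integral_sub_cst (A : set config) (h : config -> R) (c : R) : measurable A ->
  Pf.-integrable setT (EFin \o h) ->
  (\int[Pf]_(x in A) (h x - c)%:E = \int[Pf]_(x in A) (h x)%:E - (c * pr A)%:E)%E.
Proof.
move=> mA ih; have ihA : Pf.-integrable A (EFin \o h) by exact: integrableS ih.
have ic : Pf.-integrable A (EFin \o cst c).
  by apply: (@integrableS _ _ _ _ setT) => //; exact: finite_measure_integrable_cst.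
rewrite integralB_EFin //; congr (_ - _)%E.
by rewrite integral_pr_cst.
Qed.

(** The bound is tested on the sets where g exceeds [pr F + e] or falls below [pr F - e]. They
    belong to [sigma_field S] because g is measurable for it, and the bound forces them to be
    null. *)
Lemma cond_prob_close (g : config -> R) (e : R) : is_cond_prob Pf (sigma_field S) F g ->
  (forall A, sigma_field S A -> `|pr (A `&` F) - pr A * pr F| <= e * pr A) ->
  {ae Pf, forall eta, `|g eta - pr F| <= e}.
Proof.
move=> [gS ig gE] he; have mg := measurable_config_fun gS.
have gEr A : sigma_field S A -> (\int[Pf]_(x in A) (g x)%:E = (pr (A `&` F))%:E)%E.
  move=> SA; rewrite gE // setIC -prE //; apply: measurableI => //.
  exact: sigma_field_measurable SA.
have ic c : Pf.-integrable setT (EFin \o cst c) by exact: finite_measure_integrable_cst.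
have up : {ae Pf, forall x, ~ (g @^-1` [set y | pr F + e < y]) x}.
  have SA : sigma_field S (g @^-1` [set y | pr F + e < y]).
    by apply: gS; rewrite -set_itvoy; exact: measurable_itv.
  apply: (@ae_not_of_integral_le0 _ (fun x => g x - (pr F + e))).
  - exact: sigma_field_measurable SA.
  - exact: (integrableB measurableT ig (ic (pr F + e))).
  - by move=> x /=; rewrite subr_gt0.
  - rewrite integral_sub_cst //; last exact: sigma_field_measurable SA.
    rewrite gEr // -EFinB lee_fin.
    by have := he _ SA; rewrite ler_norml => /andP[_]; lra.
have lo : {ae Pf, forall x, ~ (g @^-1` [set y | y < pr F - e]) x}.
  have SA : sigma_field S (g @^-1` [set y | y < pr F - e]).
    by apply: gS; rewrite -set_itvNyo; exact: measurable_itv.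
  have mA := sigma_field_measurable SA.
  apply: (@ae_not_of_integral_le0 _ (fun x => (pr F - e) - g x)) => //.
  - exact: (integrableB measurableT (ic (pr F - e)) ig).
  - by move=> x /=; rewrite subr_gt0.
  - rewrite integralB_EFin //; last 2 first.
    + exact: integrableS (ic (pr F - e)).
    + exact: integrableS ig.
    rewrite gEr // integral_pr_cst // -EFinB lee_fin.
    by have := he _ SA; rewrite ler_norml => /andP[+ _]; lra.
apply: filterS2 up lo => x /= nu nl.
move/negP: nu; move/negP: nl; rewrite -!leNgt => nl nu.
by rewrite ler_norml; apply/andP; split; lra.
Qed.

Lemma cond_prob_bound (g : config -> R) (e : R) : 0 <= e -> is_cond_prob Pf (sigma_field S) F g ->
  {ae Pf, forall eta, `|g eta - pr F| < e} ->
  forall A, sigma_field S A -> `|pr (A `&` F) - pr A * pr F| <= e * pr A.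
Proof.
move=> e0 [gS ig gE] ae A SA; have mg := measurable_config_fun gS.
have mA := sigma_field_measurable SA.
have e1 : (\int[Pf]_(x in A) (g x - pr F)%:E = (pr (A `&` F) - pr A * pr F)%:E)%E.
  rewrite integral_sub_cst // gE // setIC prE; last exact: measurableI.
  by rewrite -EFinB [pr F * _]mulrC.
rewrite -lee_fin -[leLHS]/(`|(pr (A `&` F) - pr A * pr F)%:E|)%E -e1.
have mgA : measurable_fun A (fun x => (g x - pr F)%:E).
  by apply/measurable_EFinP; apply: measurable_funB; [exact: measurable_funTS|exact: measurable_cst].
apply: le_trans (le_abse_integral _ mA mgA) _.
have -> : (e * pr A)%:E = (e%:E * Pf A)%E by rewrite EFinM -(prE Pf mA).
apply: integral_le_bound => //.
case: ae => N [mN N0 hN]; exists N; split => // x nx; apply: hN => /= hx.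
by apply: nx => _; rewrite lee_fin ltW.
Qed.

End ConditionalProbability.

(** * Translation invariance *)

Lemma shift_cyl_ones n s :
  shift_config n @^-1` cyl (ones s) = cyl (ones [seq b + n | b <- s]).
Proof.
by apply/seteqP; split => eta; rewrite /cyl /= !all_map.
Qed.

Lemma measurable_shift n : measurable_fun [set: config] (shift_config n).
Proof.
apply: (@measurability _ _ _ _ setT (shift_config n) (coord_system setT)) => //.
move=> _ [_ [b _ [V mV <-]] <-]; rewrite !setTI.
apply: sub_gen_smallest; exists (b + n) => //; exists V => //.
by rewrite setTI.
Qed.

(** The all-ones cylinders are closed under intersection and generate the sigma-algebra, so they
    determine a probability measure. *)
Lemma config_sigma_ones :
  @measurable _ config = <<s [set A | exists s, A = cyl (ones s)] >>.
Proof.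
apply/seteqP; split => A.
  apply: smallest_sub => {A}; first exact: smallest_sigma_algebra.
  have [s0 sD _] :=
    @smallest_sigma_algebra _ setT [set A : set config | exists s, A = cyl (ones s)].
  move=> _ [b _ [V _ <-]]; rewrite setTI.
  have sT : <<s [set A | exists s, A = cyl (ones s)] >> [set eta : config | eta b = true].
    apply: sub_gen_smallest; exists [:: b]; apply/seteqP; split => eta; rewrite /cyl /=.
      by move=> ->.
    by rewrite andbT => /eqP.
  have [Vt|Vt] := pselect (V true); have [Vf|Vf] := pselect (V false).
  - suff -> : (fun eta : config => eta b) @^-1` V = setT `\` set0.
      exact: sD.
    by apply/seteqP; split => // eta; rewrite setD0 /=; case: (eta b).
  - suff -> : (fun eta : config => eta b) @^-1` V = [set eta : config | eta b = true] by [].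
    by apply/seteqP; split => eta /=; case: (eta b).
  - suff -> : (fun eta : config => eta b) @^-1` V = setT `\` [set eta : config | eta b = true].
      exact: sD.
    by apply/seteqP; split => eta /=; case: (eta b); intuition congruence.
  - suff -> : (fun eta : config => eta b) @^-1` V = set0 by [].
    by apply/seteqP; split => // eta /=; case: (eta b).
apply: smallest_sub => {A}; first exact: smallest_sigma_algebra.
by move=> _ [s ->]; apply: measurable_cyl.
Qed.

Lemma cyl_ones_undup s : cyl (ones s) = cyl (ones (undup s)).
Proof.
by apply/seteqP; split => eta; rewrite /cyl /= !all_map => /allP h; apply/allP => b bs;
  apply: h; rewrite mem_undup in bs *.
Qed.

Lemma cyl_onesE (k : nat) (e : 'I_k -> int) :
  cyl (ones (codom e)) = [set eta : config | forall i, eta (e i) = true].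
Proof.
apply/seteqP; split => eta; rewrite /cyl /= all_map.
  by move=> /allP h i; have := h _ (codom_f e i) => /= /eqP.
by move=> h; apply/allP => _ /codomP[i ->] /=; rewrite h.
Qed.

Lemma determinantal_translation_invariant (R : realType) (f : R -> R)
  (Pf : probability config R) : determinantal f Pf -> translation_invariant Pf.
Proof.
move=> Pf_det n A mA.
have mS := measurable_shift n.
apply: (@measure_unique _ _ config [set A | exists s, A = cyl (ones s)] (fun=> setT)
  config_sigma_ones _ _ _ (pushforward Pf (shift_config n)) Pf) => //.
- by move=> _ _ [s ->] [t ->]; exists (s ++ t); rewrite /ones map_cat cyl_cat.
- by move=> _; exists [::]; rewrite cyl_nil.
- by apply/seteqP; split => // x _; exists 0%N.
(* [determinantal] speaks of distinct sites. The determinants agree because their entries depend on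
   differences of sites only. *)
- move=> _ [s ->]; rewrite cyl_ones_undup.
  rewrite -[LHS]/(Pf (shift_config n @^-1` cyl (ones (undup s)))) shift_cyl_ones.
  have us := undup_uniq s; case: (undup s) us => [|b t] us //.
  set e := tnth (in_tuple (b :: t)).
  have e_inj : injective e by exact/tuple_uniqP.
  have en_inj : injective (fun i => e i + n) by move=> i j /addIr/e_inj.
  have cod_e : codom e = b :: t by rewrite codomE -[RHS]/(val (in_tuple (b :: t))) map_tnth_enum.
  have := Pf_det _ _ (isT : (1 <= size (b :: t))%N) e_inj.
  rewrite -cyl_onesE cod_e => h1.
  have := Pf_det _ _ (isT : (1 <= size (b :: t))%N) en_inj.
  rewrite -cyl_onesE => h2.
  have cE : codom (fun i => e i + n) = [seq b + n | b <- b :: t].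
    transitivity [seq c + n | c <- codom e]; last by rewrite cod_e.
    exact: (map_comp (fun c => c + n) e).
  rewrite cE in h2.
  have dE : \matrix_(i < size (b :: t), j < size (b :: t)) fourier f (e j + n - (e i + n)) =
     \matrix_(i < size (b :: t), j < size (b :: t)) fourier f (e j - e i).
    by apply/matrixP => i j; rewrite !mxE opprD addrACA subrr addr0.
  rewrite dE -h1 in h2; case: h2 => h2.
  transitivity (pr Pf (cyl (ones (b :: t))))%:E; last first.
    by symmetry; apply: prE; exact: measurable_cyl.
  apply: etrans (congr1 EFin h2); apply: prE; exact: measurable_cyl.
- by move=> k; rewrite -[ltLHS]/(Pf setT) probability_setT ltry.
Qed.

(** * The two implications *)

Section PositiveMeans.
Variable R : realType.
Notation mu := (@lebesgue_measure R).
Variable f : R -> R.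
Hypotheses (mf : measurable_fun [set: R] f) (f01 : forall x, 0 <= f x <= 1).
Hypothesis fn0 : ~ (f = cst 0 %[ae mu in circle R]).
Hypothesis fn1 : ~ (f = cst 1 %[ae mu in circle R]).
Variable Pf : probability config R.
Hypothesis Pf_det : determinantal f Pf.
Hypotheses (GMf : (0 < GM f)%E) (GMc : (0 < GM (fun x => (1 - f x)%R))%E).
Implicit Types (L : seq (int * bool)) (s : seq int).
Notation pr := (pr Pf).

Let K := fkernel f.

Lemma uniform_remote_past s (e : R) : 0 < e -> exists N : nat, forall b, b \in s ->
  - N%:Z < b /\ forall t c, {in t, forall i : int, i <= - N%:Z} ->
    `|cross t K c b| ^+ 2 <= e%:C%C * qform t K c /\
    `|cross t (cmplk K) c b| ^+ 2 <= e%:C%C * qform t (cmplk K) c.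
Proof.
move=> e0; elim: s => [|b s [N hN]]; first by exists 0%N.
have [N1 hN1] := remote_past mf f01 fn0 b GMf e0.
have [N2 hN2] := remote_past (measurable_compl mf) (compl01 f01) (compl_neq0 fn1) b GMc e0.
exists (N + N1 + N2 + (absz b).+1)%N => b'; rewrite inE => /predU1P[->|b's].
  split; first by lia.
  move=> t c ht; split; first by apply: hN1 => i /ht; lia.
  have bt : b \notin t by apply/negP => /ht; lia.
  have -> : cross t (cmplk K) c b = cross t (fkernel (fun x => 1 - f x)) c b.
    by rewrite /cross; apply: eq_bigr => i _; rewrite cmplk_fkernel.
  rewrite (@eq_qform_kernel _ _ t _ (fkernel (fun x => 1 - f x))) => [|i j _ _].
    by apply: hN2 => i /ht; lia.
  exact: cmplk_fkernel.
have [h1 h2] := hN b' b's; split; first by lia.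
by move=> t c ht; apply: h2 => i /ht; lia.
Qed.

Lemma normcR (x : R) : `|x%:C%C| = `|x|%:C%C :> R[i].
Proof. by rewrite normc_def /= expr0n addr0 sqrtr_sqr. Qed.

Lemma mixing_ones s : uniq s -> mixing Pf (cyl (ones s)).
Proof.
move=> us e e0.
have hK : hermitian_kernel K by exact: hermitian_fkernel.
have pK : posdef K by exact: posdef_fkernel.
have pK' : posdef (cmplk K) by exact: posdef_cmplk_fkernel.
pose M := ((size s)`! * size s)%N.
(* 12 comes from [condk_close], M from [norm_det_sub_le]; the successor avoids a division by 0 when
   [s] is empty. *)
pose d := e / (12 * M.+1%:R).
have d0 : 0 < d by rewrite divr_gt0 ?mulr_gt0.
have [N hN] := uniform_remote_past s d0.
exists N => L uL LN.
have sL b : b \in s -> b \notin map fst L.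
  by move=> bs; apply/negP => /LN; have [+ _] := hN b bs; lia.
have usL : uniq (s ++ map fst L).
  by rewrite cat_uniq us uL andbT; apply/hasPn => b bL; apply: contraL bL => /sL.
rewrite -lecR -normcR -cyl_cat (@cyl_perm (L ++ ones s) (ones s ++ L)); last by rewrite perm_catC.
rewrite rmorphB rmorphM /= (pr_cyl_ones mf f01 fn0 fn1 Pf_det usL) (pr_ones Pf_det us).
rewrite -mulrBr normrM normcR (ger0_norm (pr_ge0 Pf _)) rmorphM /= [leRHS]mulrC.
apply: ler_wpM2l; first by rewrite lecR pr_ge0.
have close : `|\det (submx (condk K L) s) - \det (submx K s)| <= M%:R * (12 * d%:C%C).
  apply: norm_det_sub_le => i j; rewrite !mxE.
  - by apply: condk_norm_le1 => //; apply: sL; exact: mem_tnth.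
  - exact: (condk_norm_le1 (L := [::]) hK pK pK').
  - have ijs b : b \in [:: tnth (in_tuple s) i; tnth (in_tuple s) j] -> b \in s.
      by rewrite !inE => /orP[]/eqP->; exact: mem_tnth.
    apply: condk_close => //; try (by apply: sL; exact: mem_tnth).
    + by rewrite lecR ltW.
    + by move=> c b /ijs /hN [_ h]; have [] := h (map fst L) c LN.
    + by move=> c b /ijs /hN [_ h]; have [] := h (map fst L) c LN.
apply: le_trans close _.
have -> : M%:R * (12 * d%:C%C) = (M%:R * (12 * d))%:C%C :> R[i].
  by rewrite !rmorphM /= !rmorph_nat.
rewrite lecR /d.
have -> : M%:R * (12 * (e / (12 * M.+1%:R))) = e * (M%:R / M.+1%:R) :> R.
  by have := pnatr_eq0 R M.+1; move: (M.+1%:R) => m m0; field; rewrite m0.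
by rewrite ler_piMr ?(ltW e0) // ler_pdivrMr // mul1r ler_nat.
Qed.

End PositiveMeans.

Section StrongK.
Variable R : realType.
Notation mu := (@lebesgue_measure R).
Variable f : R -> R.
Hypotheses (mf : measurable_fun [set: R] f) (f01 : forall x, 0 <= f x <= 1).
Hypothesis fn0 : ~ (f = cst 0 %[ae mu in circle R]).
Hypothesis fn1 : ~ (f = cst 1 %[ae mu in circle R]).
Variable Pf : probability config R.
Hypothesis Pf_det : determinantal f Pf.
Notation pr := (pr Pf).

Let K := fkernel f.

(** Strong K for a single site, with tolerance half the probability p of the event: the conditional
    probability given any cylinder of the remote past then stays above p / 2. *)
Lemma strong_K_site v : strong_K Pf -> exists2 e : R, 0 < e & exists N : nat,
  forall L, uniq (0 :: map fst L) -> {in map fst L, forall b : int, b <= - N%:Z} ->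
  e%:C%C <= if v then condk K L 0 0 else 1 - condk K L 0 0.
Proof.
move=> [_ sK]; pose E := cyl [:: (0, v)].
have SE : sigma_field [set (0 : int)] E.
  by apply: sigma_field_cyl => b; rewrite inE => /eqP.
have mE : measurable E := measurable_cyl _.
have p0 : 0 < pr E by apply: (pr_cyl_gt0 mf f01 fn0 fn1 Pf_det).
have p2 : 0 < pr E / 2 by rewrite divr_gt0.
have [N [g gP gE]] := sK _ E (finite_set1 _) SE _ p2.
exists (pr E / 2) => //; exists N => L uL LN; have /andP[_ uL'] := uL.
have SA : sigma_field [set e : int | e <= - N%:Z] (cyl L) by exact: sigma_field_cyl.
have := cond_prob_bound mE (ltW p2) gP gE SA.
have -> : cyl L `&` E = cyl ((0, v) :: L).
  by rewrite -cyl_cat (@cyl_perm _ ((0, v) :: L)) // perm_catC.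
rewrite ler_norml => /andP[lo _].
have L0 : 0 < pr (cyl L) by exact: (pr_cyl_gt0 mf f01 fn0 fn1 Pf_det).
have le : (pr E / 2) * pr (cyl L) <= pr (cyl ((0, v) :: L)) by lra.
move: le; rewrite -lecR (pr_cyl_cons mf f01 fn0 fn1 Pf_det) // rmorphM mulrC.
by rewrite ler_pM2l // ltcR.
Qed.

Lemma strong_K_GM_gt0 : strong_K Pf -> (0 < GM f)%E.
Proof.
move=> /(strong_K_site true)[e e0 [N hN]].
have [g gE g0] := GM_fin mf f01.
rewrite gE lte_fin lt_neqAle g0 andbT eq_sym; apply/eqP => gz.
have GM0 : GM f = 0%E by rewrite gE gz.
have e2 : 0 < e / 2 by rewrite divr_gt0.
have [s [c [us sN c0 qe]]] := GM_eq0_sites mf f01 N GM0 e2.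
have fs : map fst (ones s) = s by rewrite -map_comp map_id.
have := hN (ones s); rewrite fs => /(_ us) /=.
have sN' : {in s, forall b : int, b <= - N%:Z} by move=> b /sN; lia.
move=> /(_ sN') hle.
have hK : hermitian_kernel K by exact: hermitian_fkernel.
have pK : posdef K by exact: posdef_fkernel.
have pK' : posdef (cmplk K) by exact: posdef_cmplk_fkernel.
have us1 : uniq ([:: 0] ++ map fst (ones s)) by rewrite fs.
have a1 : all snd (ones s) by rewrite all_map; apply/allP.
have := condk_upper_ones c hK pK pK' us1 a1.
rewrite fs qform1 c0 conjC1 !mul1r => /(le_trans hle) /le_trans /(_ qe).
by rewrite lecR; lra.
Qed.

Lemma strong_K_GM_compl_gt0 : strong_K Pf -> (0 < GM (fun x => (1 - f x)%R))%E.
Proof.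
move=> /(strong_K_site false)[e e0 [N hN]].
have mc := measurable_compl mf; have c01 := compl01 f01; have cn0 := compl_neq0 fn1.
have [g gE g0] := GM_fin mc c01.
rewrite gE lte_fin lt_neqAle g0 andbT eq_sym; apply/eqP => gz.
have GM0 : GM (fun x => (1 - f x)%R) = 0%E by rewrite gE gz.
have e2 : 0 < e / 2 by rewrite divr_gt0.
have [s [c [us sN c0 qe]]] := GM_eq0_sites mc c01 N GM0 e2.
pose L := [seq (b, false) | b <- s].
have fs : map fst L = s by rewrite -map_comp map_id.
have := hN L; rewrite fs => /(_ us) /=.
have sN' : {in s, forall b : int, b <= - N%:Z} by move=> b /sN; lia.
move=> /(_ sN') hle.
have hK : hermitian_kernel K by exact: hermitian_fkernel.
have pK : posdef K by exact: posdef_fkernel.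
have pK' : posdef (cmplk K) by exact: posdef_cmplk_fkernel.
have us1 : uniq ([:: 0] ++ map fst L) by rewrite fs.
have a1 : all (fun bv => ~~ bv.2) L by rewrite all_map; apply/allP.
have := condk_upper_zeros c hK pK pK' us1 a1.
rewrite fs qform1 c0 conjC1 !mul1r {1}/cmplk eqxx => /(le_trans hle).
rewrite (@eq_qform_kernel _ _ _ (cmplk K) (fkernel (fun x => 1 - f x))); last first.
  by move=> i j _ _; exact: cmplk_fkernel.
move=> /le_trans /(_ qe).
by rewrite lecR; lra.
Qed.

End StrongK.

Theorem corollary8p4 (R : realType) (f : R -> R)
    (f_periodic : periodic f 1)
    (f_measurable : measurable_fun [set: R] f)
    (f01 : forall x : R, 0 <= f x <= 1)
    (f_neq0 : ~ (f = cst 0 %[ae lebesgue_measure in circle R]))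
    (f_neq1 : ~ (f = cst 1 %[ae lebesgue_measure in circle R]))
    (Pf : probability config R) (Pf_det : determinantal f Pf) :
  strong_K Pf <-> (0 < GM f * GM (fun x => 1 - f x)%R)%E.
Proof.
split=> [sK|].
  rewrite mule_gt0 //; first exact: (strong_K_GM_gt0 _ _ _ _ Pf_det).
  exact: (strong_K_GM_compl_gt0 _ _ _ _ Pf_det).
(* Both means are finite and nonnegative, so a positive product makes each of them positive. *)
have [g gE g0] := GM_fin f_measurable f01.
have [h hE h0] := GM_fin (measurable_compl f_measurable) (compl01 f01).
rewrite gE hE -EFinM lte_fin => gh0.
have GMf : (0 < GM f)%E.
  by rewrite gE lte_fin lt_neqAle g0 andbT; apply: contraTneq gh0 => <-; rewrite mul0r ltxx.
have GMc : (0 < GM (fun x => (1 - f x)%R))%E.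
  by rewrite hE lte_fin lt_neqAle h0 andbT; apply: contraTneq gh0 => <-; rewrite mulr0 ltxx.
split; first exact: determinantal_translation_invariant Pf_det.
move=> S E /finite_seqP[s ->] SE e e0.
have mE := sigma_field_measurable SE.
(* [cond_prob_close] yields a weak inequality, strong K asks for a strict one. *)
have e2 : 0 < e / 2 by rewrite divr_gt0.
have mix := mixing_finite (mixing_ones f_measurable f01 f_neq0 f_neq1 Pf_det GMf GMc).
have [N hN] := mix s E mE (sigma_field_depends SE) _ e2.
exists N; have [g' gP] := cond_prob_exists Pf [set e : int | e <= - N%:Z] mE.
exists g' => //.
have := cond_prob_close mE gP (past_bound mE e2 hN).
apply: filterS => eta /le_lt_trans; apply.
by rewrite ltr_pdivrMr // ltr_pMr // ltr1n.
Qed.
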